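(* Let $\mathcal{A}$ be a finite alphabet and let $H \subset \mathcal{A}^{\mathbb{Z}}$ be a nonempty one-dimensional subshift of finite type. Then $$\left\{h(X_{H,\mathcal{F}}) : \mathcal{F} \text{ a finite set of forbidden patterns over } \mathcal{A} \text{ with } X_{H,\mathcal{F}}\neq\emptyset\right\}=[0,h(H)]\cap\Pi_1,$$ where $\Pi_1$ is the set of right-recursively enumerable real numbers.
   Context: A pattern over $\mathcal{A}$ is an element $p\in\mathcal{A}^{P}$ with $P\subset\mathbb{Z}^2$ finite; it appears in $x\in\mathcal{A}^{\mathbb{Z}^2}$ if some translate of $x$ coincides with $p$ on $P$. For a set $\mathcal{F}$ of patterns, $X_{\mathcal{F}}$ is the set of $x\in\mathcal{A}^{\mathbb{Z}^2}$ in which no $p\in\mathcal{F}$ appears. A subshift of finite type (SFT) is a subshift defined by a finite set of forbidden patterns. For a one-dimensional SFT $H\subset\mathcal{A}^{\mathbb{Z}}$ and a finite set $\mathcal{F}$ of forbidden (two-dimensional) patterns, $$X_{H,\mathcal{F}} := \{ x \in \mathcal{A}^{\mathbb{Z}^2} \mid x\in X_{\mathcal{F}} \text{ and } \forall j \in \mathbb{Z},\ (x_{k,j})_{k \in \mathbb{Z}} \in H\}.$$ The topological entropy of a (nonempty) $d$-dimensional subshift $X$ is $h(X)=\lim_{n\to\infty}\frac{\log_2 N_X(n,\dots,n)}{n^d}$, where $N_X(n,\dots,n)$ is the number of patterns of support $\{0,\dots,n-1\}^d$ appearing in configurations of $X$; for $H$ this is used with $d=1$ and for $X_{H,\mathcal{F}}$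 with $d=2$. A real number is right-recursively enumerable ($\Pi_1$-computable) if there is a decreasing computable sequence of rationals converging to it. *)

(* Defs.v *)
From mathcomp Require Import all_boot all_order all_algebra finmap.
From mathcomp Require Import all_classical all_reals all_analysis.

Set Implicit Arguments.
Unset Strict Implicit.
Unset Printing Implicit Defensive.

Import Order.TTheory GRing.Theory Num.Theory.
Import numFieldNormedType.Exports.
Local Open Scope fset_scope.
Local Open Scope fmap_scope.
Local Open Scope classical_set_scope.
Local Open Scope ring_scope.

(* Everything up to the entropy is parametrized by the lattice G, which is
   instantiated with [int] and with the group [int * int]. *)

(* A finite map is exactly a function from a finite set of positions to A. *)
Notation pattern G A := {fmap G -> A}.

Definition appears (G : zmodType) (A : finType) (p : pattern G A)
    (x : G -> A) : Prop :=
  exists t : G, forall (u : G) (a : A), p.[? u] = Some a -> x (t + u) = a.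

Definition avoiding (G : zmodType) (A : finType) (F : {fset pattern G A}) :
    set (G -> A) :=
  [set x | forall p, p \in F -> ~ appears p x].

Definition is_SFT (G : zmodType) (A : finType) (X : set (G -> A)) : Prop :=
  exists F : {fset pattern G A}, X = avoiding F.

Definition horizontally_constrained (A : finType) (H : set (int -> A))
    (F : {fset pattern (int * int)%type A}) : set (int * int -> A) :=
  [set x | avoiding F x /\ forall j : int, H (fun k : int => x (k, j))].

Definition pattern_count (G : zmodType) (A : finType) (X : set (G -> A))
    (P : {fset G}) : nat :=
  #|[set p : {ffun P -> A} |
      `[< exists2 x, X x & appears (FinMap p : pattern G A) x >]]%SET|.

Definition box1 (n : nat) : {fset int} := [fset (val k)%:Z | k in 'I_n].

Definition box2 (n : nat) : {fset int * int} := (box1 n `*` box1 n)%fset.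

Definition log2 (R : realType) (r : R) : R := ln r / ln 2.

Definition entropy1 (R : realType) (A : finType) (X : set (int -> A)) : R :=
  lim ((fun n : nat =>
    log2 (pattern_count X (box1 n))%:R / n%:R : R) @ \oo).

Definition entropy2 (R : realType) (A : finType) (X : set (int * int -> A)) :
    R :=
  lim ((fun n : nat =>
    log2 (pattern_count X (box2 n))%:R / n%:R ^+ 2 : R) @ \oo).

(* Kleene's partial recursive functions: [recfun n] is the type of programs
   for partial functions from nat^n to nat. *)
Inductive recfun : nat -> Type :=
| Rzero n : recfun n
| Rsucc : recfun 1
| Rproj n (i : 'I_n) : recfun n
| Rcomp m n (f : recfun m) (g : 'I_m -> recfun n) : recfun n
| Rprim n (f : recfun n) (g : recfun n.+2) : recfun n.+1
| Rmin n (f : recfun n.+1) : recfun n.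

(* [reval c v y]: program c halts on input v with output y.
   For [Rprim f g], s lists the successive values of the recursion on the first
   argument: s 0 = f w and s k.+1 = g (k, s k, w), where v = (l, w).
   For [Rmin f], y is the least zero of z |-> f (z, v), all the previous values
   being defined. *)
Fixpoint reval (n : nat) (c : recfun n) : n.-tuple nat -> nat -> Prop :=
  match c in recfun n return n.-tuple nat -> nat -> Prop with
  | Rzero _ => fun _ y => y = 0%N
  | Rsucc => fun v y => y = (thead v).+1
  | Rproj _ i => fun v y => y = tnth v i
  | Rcomp m _ f g => fun v y =>
      exists w : m.-tuple nat,
        (forall i, reval (g i) v (tnth w i)) /\ reval f w y
  | Rprim _ f g => fun v y =>
      exists s : nat -> nat,
        [/\ reval f [tuple of behead v] (s 0%N),
            forall k, (k < thead v)%N ->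
              reval g [tuple of k :: s k :: behead v] (s k.+1)
          & y = s (thead v)]
  | Rmin _ f => fun v y =>
      reval f [tuple of y :: v] 0%N /\
      forall z, (z < y)%N -> exists k, reval f [tuple of z :: v] k.+1
  end.

Definition computable (f : nat -> nat) : Prop :=
  exists c : recfun 1, forall n, reval c [tuple n] (f n).

Definition computable_rat_seq (q : nat -> rat) : Prop :=
  exists s a b : nat -> nat,
    [/\ computable s, computable a, computable b
      & forall n, b n != 0%N /\
                  q n = (-1) ^+ s n * (a n)%:R / (b n)%:R].

(* Right-recursively enumerable reals; "decreasing" is understood as
   nonincreasing. *)
Definition Pi1 (R : realType) : set R :=
  [set r | exists q : nat -> rat,
    [/\ computable_rat_seq q,
        forall n, q n.+1 <= q n
      & (fun n => ratr (q n) : R) @ \oo --> r]].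
Arguments Pi1 : clear implicits.

(* Main.v *)
(* The entropy of a plane SFT is the infimum of the computable rates of its locally
   admissible square patterns, by compactness; hence it is in Pi1, and forbidding patterns
   only lowers the entropy of the plane subshift whose rows are free in H, which is h(H).

   Conversely let h < h(H) be the limit of a nonincreasing computable sequence of
   rationals. Bounding the walks of the transition graph of H by their loops yields words
   of H of a common length that concatenate freely and whose number exceeds the rate h;
   so any plane SFT can be encoded into blocks of such words, with part of the rows left
   free, and the entropy of the result is the density of free rows. That density is
   controlled by a zero-entropy SFT of tiles. The tiles compare the 2-adic levels of the
   row and of the column of each cell, which forces a hierarchy of levels; on the columns
   of level l, of density 2^-(l+1), they write a tape of 2^(l+1) cells, and from each level
   to the next they run one step of a counter machine. The columns of level l are
   selected iff the l-th digit of an infinite binary word is 1, and the machine, reading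
   these digits, checks that the number they represent stays below every term of the
   rational sequence. The maximal density is then h, suitably rescaled. *)
Require Import Defs.
From HB Require Import structures.
From mathcomp Require Import all_boot all_order all_algebra finmap.
From mathcomp Require Import all_classical all_reals all_analysis.
From mathcomp Require Import zify ring lra.
Import Order.TTheory GRing.Theory Num.Theory.
Import numFieldNormedType.Exports.
Set Implicit Arguments.
Unset Strict Implicit.
Unset Printing Implicit Defensive.
Local Open Scope classical_set_scope.
Local Open Scope ring_scope.

(** * Tiles comparing 2-adic levels of rows and columns *)

(** One machine step per level suffices: the levels are infinitely many, and a counter grows by at
    most one per step while the length of the tape doubles. Nothing prevents a smaller density, and
    the entropy retains the largest one; this is how a nonincreasing sequence of rationals fits.

    The constants look circular: words of [H] must be numerous enough to name all the tiles, whereas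
    the tiles contain a machine whose test involves the length of these words. Only the ratio
    between this length and the number of bits carried by a word enters the test, so the words are
    lengthened by a common factor once the tiles are known.

    A density of columns lies between 0 and 1. The wanted rate is therefore split into an integer
    number of rows that are free in every block and one more row that is free in the selected
    columns only. The strict inequality [h < h(H)] provides the few rows that mark the blocks; the
    value [h(H)] itself leaves no room for marks and is reached separately. *)

Lemma const_int (T : Type) (f : int -> T) :
  (forall j, f (j + 1) = f j) -> forall j k, f j = f k.
Proof.
move=> fS; suff f0 j : f j = f 0 by move=> j k; rewrite f0 [RHS]f0.
elim/int_rect: j => [//|n IH|n IH]; first by rewrite intS addrC fS.
by rewrite -IH -(fS (- n.+1%:Z)); congr f; lia.
Qed.

Lemma clock_int (f : int -> nat) : (forall j, (f j < 4)%N) ->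
  (forall j, f (j + 1) = ((f j).+1 %% 4)%N) ->
  forall j k, (f j)%:Z = ((j - k + (f k)%:Z) %% 4)%Z.
Proof.
move=> f4 fS j k; have := @const_int _ (fun j => (((f j)%:Z - j) %% 4)%Z).
move=> /(_ _ j k) /= F; have := f4 j; have := f4 k.
suff /F : forall i, (((f (i + 1))%:Z - (i + 1)) %% 4)%Z = (((f i)%:Z - i) %% 4)%Z.
  by move: (f j) (f k) => a b; lia.
by move=> i; rewrite fS; move: (f i) => a; lia.
Qed.

(* A tape system rules an infinite sequence of tapes: the tape of level [l] has
   [2 ^ l.+1] cells and a global state; [ts_bord], [ts_adj] constrain one tape, and
   [ts_nxt], [ts_stp] relate a tape and the first half of the next one. *)
Record tape_sys := TapeSys {
  glob : finType; cell : finType;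
  ts_ini : glob -> Prop; ts_ini0 : cell -> Prop;
  ts_bord : glob -> cell -> Prop; ts_adj : glob -> cell -> cell -> Prop;
  ts_nxt : cell -> cell -> Prop; ts_stp : glob -> glob -> Prop }.

(* A column or row has level [l] if its index, relative to an origin, is an odd
   multiple of [2 ^ l]. A cell is [Eq] if its column and row have the same level, [Gi]
   or [Go] if the column has the greater level, [Li] or [Lo] if the row has; [i] and [o]
   alternate along the columns and the rows. *)
Inductive ctype := Eq | Gi | Go | Li | Lo.

Section Tiles.
Variable S : tape_sys.

(* On the columns (or rows) of level [l], [lz] marks the first of each zone of [2 ^ l.+1]
   consecutive ones, [lzeta] counts the zones modulo 4, [lg] is the global state and
   [lth] the cell of the tape of level [l]. *)
Record lab := Lab { lz : bool; lzeta : 'I_4; lg : glob S; lth : cell S }.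
Definition lab_tup l := (lz l, lzeta l, lg l, lth l).
Definition tup_lab t := let: (a, b, c, d) := t in Lab a b c d.
Lemma lab_tupK : cancel lab_tup tup_lab. Proof. by case. Qed.
HB.instance Definition _ := Finite.copy lab (can_type lab_tupK).

(* [vt], [ht] are clocks that force the order of the types of the cells met along a
   column or a row; [vlam], [hmu] are the labels of the column and of the row, and
   [hkap] carries the label of the previous column. The bits [vd1], [hu1] draw the
   diagonal of each square zone, which makes row and column labels agree; [vd2], [hu2]
   draw the diagonals along which a tape is compared with the next one. *)
Record vcol := Vcol { vsg : bool; vt : 'I_4; vlam : lab; vd1 : bool;
                      vg : bool; vd2 : bool }.
Definition vcol_tup v := (vsg v, vt v, vlam v, vd1 v, vg v, vd2 v).
Definition tup_vcol t := let: (a, b, c, d, e, f) := t in Vcol a b c d e f.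
Lemma vcol_tupK : cancel vcol_tup tup_vcol. Proof. by case. Qed.
HB.instance Definition _ := Finite.copy vcol (can_type vcol_tupK).

Record hcol := Hcol { htau : bool; ht : 'I_4; hmu : lab; hkap : lab;
  hu1 : bool; hseen : bool; hu2 : bool; hg : bool }.
Definition hcol_tup v :=
  (htau v, ht v, hmu v, hkap v, hu1 v, hseen v, hu2 v, hg v).
Definition tup_hcol t :=
  let: (a, b, c, d, e, f, g, h) := t in Hcol a b c d e f g h.
Lemma hcol_tupK : cancel hcol_tup tup_hcol. Proof. by case. Qed.
HB.instance Definition _ := Finite.copy hcol (can_type hcol_tupK).

Definition nb (k l : lab) : Prop :=
  lg k = lg l /\
  if lz l then (lzeta l = (lzeta k).+1 %% 4 :> nat)%N /\ ts_bord (lg l) (lth l)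
  else lzeta l = lzeta k /\ ts_adj (lg l) (lth k) (lth l).

Definition adv4 (t t' : 'I_4) (k : nat) : Prop :=
  t = k :> nat /\ (t' = k.+1 %% 4 :> nat)%N.

(** The guard [vg] is raised by [Gi] and lowered by [Eq], [Li] and [Lo]. A column of odd index meets
    no [Gi], whence the exemption when [oi] holds. *)
Record colev (oi : bool) (v v' : vcol) (k : nat) : Prop := ColEv {
  ce_t : adv4 (vt v) (vt v') k;
  ce_g : ~~ oi -> vg v /\ ~~ vg v';
  ce_d2 : ~~ oi -> vd2 v' = vd2 v }.

Record rowev (oj : bool) (h h' : hcol) (k : nat) : Prop := RowEv {
  re_t : adv4 (ht h) (ht h') k;
  re_g : ~~ oj -> hg h /\ ~~ hg h' }.

(** [hu1] and [vd1] are exchanged: a bit coming from the left leaves upwards, one coming from below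
    leaves to the right, so bits move along diagonals. [hseen] tells whether the row has met a
    diagonal since the last start of a zone, and [eq_zs] demands one in every zone. *)
Record eqrule (h : hcol) (v : vcol) (h' : hcol) (v' : vcol) : Prop := EqRule {
  eq_kap : hkap h' = vlam v;
  eq_nb : nb (hkap h) (vlam v);
  eq_z : lz (vlam v) -> ~~ vsg v;
  eq_d1 : vd1 v' = hu1 h;
  eq_u1 : hu1 h' = vd1 v;
  eq_seen : hseen h' = hu1 h || (~~ lz (vlam v) && hseen h);
  eq_zs : lz (vlam v) -> hseen h;
  eq_diag : hu1 h -> lz (hmu h) = lz (vlam v) /\ lth (hmu h) = lth (vlam v);
  eq_u2 : hu2 h' = hu2 h }.

(** This is the meeting of a row with a column of the level just above, and [hkap] holds the label
    of the preceding column of the level of the row. A zone of the next level has twice as many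
    columns, twice as sparse, hence covers four zones: it starts where a zone with [lzeta] equal to
    0 does. *)
Record girule (h : hcol) (v : vcol) (h' : hcol) (v' : vcol) : Prop := GiRule {
  gi_g : ~~ vg v; gi_g' : vg v';
  gi_z : lz (vlam v) = lz (hkap h) && (lzeta (hkap h) == 0 :> nat)%N;
  gi_stp : ts_stp (lg (hkap h)) (lg (vlam v));
  gi_d2 : vd2 v' = if lz (hmu h) then lz (vlam v) else hu2 h;
  gi_u2 : hu2 h' = vd2 v;
  gi_nxt : vd2 v' -> ts_nxt (lth (hmu h)) (lth (vlam v)) }.

Definition rowpass (h h' : hcol) : Prop :=
  [/\ hkap h' = hkap h, hu1 h' = hu1 h & hseen h' = hseen h].
Definition colpass (v v' : vcol) : Prop := vt v' = vt v /\ vd1 v' = vd1 v.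

Definition rule (e : ctype) (oi oj : bool) (h : hcol) (v : vcol)
    (h' : hcol) (v' : vcol) : Prop :=
  [/\ vlam v' = vlam v, vsg v' = vsg v, hmu h' = hmu h, htau h' = htau h &
   match e with
   | Eq => [/\ colev oi v v' (2 * htau h), rowev oj h h' (2 * vsg v)
             & eqrule h v h' v']
   | Gi => [/\ rowev oj h h' 1, rowpass h h', colpass v v' & girule h v h' v']
   | Go => [/\ rowev oj h h' 3, rowpass h h', colpass v v', hu2 h' = hu2 h
             & vg v' = vg v /\ vd2 v' = vd2 v]
   | Li => [/\ colev oi v v' 1, vd1 v' = vd1 v,
              rowpass h h', ht h' = ht h & [/\ hu2 h' = hu2 h, ~~ hg h & hg h']]
   | Lo => [/\ colev oi v v' 3, vd1 v' = vd1 v,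
              rowpass h h', ht h' = ht h & hu2 h' = hu2 h /\ hg h' = hg h]
   end].

(** The type is prescribed only where a coordinate is odd, that is where the column or the row has
    the lowest level; even cells are left to the next level. *)
Definition phase (e : ctype) (i j : int) : Prop :=
  [/\ (i %% 2 = 1)%Z -> (j %% 2 = 1)%Z -> e = Eq,
      (i %% 2 = 1)%Z -> (j %% 4 = 2)%Z -> e = Li,
      (i %% 2 = 1)%Z -> (j %% 4 = 0)%Z -> e = Lo,
      (i %% 4 = 2)%Z -> (j %% 2 = 1)%Z -> e = Gi &
      (i %% 4 = 0)%Z -> (j %% 2 = 1)%Z -> e = Go].

Definition oddz (i : int) : bool := (i %% 2 == 1)%Z.

(** The constraints as seen from one level of the hierarchy, in coordinates where this level is 0:
    [h i j] and [v i j] are the left and bottom edges of the cell, and the cells with two even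
    coordinates will form a system of the same kind. *)
Record Sys (h : int -> int -> hcol) (v : int -> int -> vcol) : Prop := SysI {
  sys_rule : forall i j, exists2 e, phase e i j &
    rule e (oddz i) (oddz j) (h i j) (v i j) (h (i + 1) j) (v i (j + 1));
  sys_sg : forall i j, oddz i -> vsg (v i j) = (i %% 4 == 3)%Z;
  sys_tau : forall i j, oddz j -> htau (h i j) = (j %% 4 == 3)%Z }.

(* The symbol of a cell consists of the colours of its left and bottom edges
   and of its coordinates modulo 4. *)
Definition tile := (hcol * vcol * 'I_4 * 'I_4)%type.
Definition th (z : tile) := z.1.1.1.
Definition tv (z : tile) := z.1.1.2.
Definition ta (z : tile) := z.1.2.
Definition tb (z : tile) := z.2.

(** The second [match] settles the components that [rule] leaves open, so that the left and bottom
    edges together with the type determine the right and top ones. Zero entropy comes from this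
    determinism. *)
Record tile_rule (z zr zu : tile) : Prop := TileRule {
  tr_ar : (ta zr = (ta z).+1 %% 4 :> nat)%N;
  tr_br : tb zr = tb z;
  tr_au : ta zu = ta z;
  tr_bu : (tb zu = (tb z).+1 %% 4 :> nat)%N;
  tr_rule : exists2 e, phase e (ta z : nat) (tb z : nat) &
    rule e (odd (ta z)) (odd (tb z)) (th z) (tv z) (th zr) (tv zu) /\
    match e with
    | Eq => [/\ ~~ vg (tv zu), vd2 (tv zu) = vd2 (tv z) & ~~ hg (th zr)]
    | Gi | Go => ~~ hg (th zr)
    | Li | Lo => ~~ vg (tv zu) /\ vd2 (tv zu) = vd2 (tv z)
    end;
  tr_sg : odd (ta z) -> [/\ vsg (tv z) = (ta z == 3 :> nat)%N,
    lz (vlam (tv z)) = (ta z == 1 :> nat)%N,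
    ts_ini (lg (vlam (tv z))) & ts_ini0 (lth (vlam (tv z)))];
  tr_tau : odd (tb z) -> htau (th z) = (tb z == 3 :> nat)%N }.

Definition tiling (z : int -> int -> tile) : Prop :=
  forall i j, tile_rule (z i j) (z (i + 1) j) (z i (j + 1)).

(** The edges [h1], [v1] leave an even cell and [h'], [v'] enter the next even ones. The odd line
    crossed in between may alter [vg], [vd2] or [hg], but only where the exemptions of the next
    level make [rule] ignore them. *)
Lemma rule_aux e oi oj h v h1 v1 h' v' (oi' oj' : bool) :
  rule e false false h v h1 v1 ->
  (e = Gi \/ e = Go -> ~~ oi') -> (e = Li \/ e = Lo -> ~~ oj') ->
  oi = oi' -> oj = oj' ->
  (if oi' then [/\ vlam v' = vlam v1, vsg v' = vsg v1, vt v' = vt v1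
     & vd1 v' = vd1 v1] else v' = v1) ->
  (if oj' then [/\ htau h' = htau h1, ht h' = ht h1, hmu h' = hmu h1,
     hkap h' = hkap h1 & [/\ hu1 h' = hu1 h1, hseen h' = hseen h1
     & hu2 h' = hu2 h1]] else h' = h1) ->
  rule e oi oj h v h' v'.
Proof.
move=> [e1 e2 e3 e4 R] noG noL -> -> V H.
have [V1 V2 V3 V4] : [/\ vlam v' = vlam v1, vsg v' = vsg v1, vt v' = vt v1
     & vd1 v' = vd1 v1] by case: oi' V {noG} => // ->.
have [H1 H2 H3 H4 [H5 H6 H7]] : [/\ htau h' = htau h1, ht h' = ht h1,
   hmu h' = hmu h1, hkap h' = hkap h1 & [/\ hu1 h' = hu1 h1,
   hseen h' = hseen h1 & hu2 h' = hu2 h1]] by case: oj' H {noL} => // ->.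
have CE k : colev false v v1 k -> colev oi' v v' k.
  move=> [a b c]; split=> [|o|o]; first by rewrite /adv4 V3.
    by case: oi' V o {noG} => // -> _; apply: b.
  by case: oi' V o {noG} => // -> _; apply: c.
have RE k : rowev false h h1 k -> rowev oj' h h' k.
  move=> [a b]; split=> [|o]; first by rewrite /adv4 H2.
  by case: oj' H o {noL} => // -> _; apply: b.
split; rewrite ?V1 ?V2 ?H1 ?H3 //.
case: e R noG noL => R noG noL.
- case: R => [/CE ? /RE ? [*]]; split=> //; split=> //; congruence.
- have := noG (or_introl _ erefl); case: oi' V {noG CE} => // ? _; subst v'.
  case: R => [/RE ? [? ? ?] ? [*]]; split=> //; first by split; congruence.
  by split=> //; congruence.
- have := noG (or_intror _ erefl); case: oi' V {noG CE} => // ? _; subst v'.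
  case: R => [/RE ? [? ? ?] ? ? ?]; split=> //; last by congruence.
  by split; congruence.
- have := noL (or_introl _ erefl); case: oj' H {noL RE} => // ? _; subst h'.
  case: R => [/CE ? ? [? ? ?] ? ?]; split=> //; congruence.
- have := noL (or_intror _ erefl); case: oj' H {noL RE} => // ? _; subst h'.
  case: R => [/CE ? ? [? ? ?] ? ?]; split=> //; congruence.
Qed.

Lemma vcol_eq (v v' : vcol) : vsg v = vsg v' -> vt v = vt v' ->
  vlam v = vlam v' -> vd1 v = vd1 v' -> vg v = vg v' -> vd2 v = vd2 v' ->
  v = v'.
Proof. by case: v v' => ? ? ? ? ? ? [] ? ? ? ? ? ? /= -> -> -> -> -> ->. Qed.

Lemma hcol_eq (h h' : hcol) : htau h = htau h' -> ht h = ht h' ->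
  hmu h = hmu h' -> hkap h = hkap h' -> hu1 h = hu1 h' ->
  hseen h = hseen h' -> hu2 h = hu2 h' -> hg h = hg h' -> h = h'.
Proof.
by case: h h' => ? ? ? ? ? ? ? ? [] ? ? ? ? ? ? ? ? /= -> -> -> -> -> -> -> ->.
Qed.

Section Derive.
Variables (h : int -> int -> hcol) (v : int -> int -> vcol).
Hypothesis sys : Sys h v.

Lemma vlam_const i j k : vlam (v i j) = vlam (v i k).
Proof.
apply: (@const_int _ (fun j => vlam (v i j))) => {}j.
by have [e _ []] := sys_rule sys i j.
Qed.

Lemma vsg_const i j k : vsg (v i j) = vsg (v i k).
Proof.
apply: (@const_int _ (fun j => vsg (v i j))) => {}j.
by have [e _ []] := sys_rule sys i j.
Qed.

Lemma hmu_const i j k : hmu (h i j) = hmu (h k j).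
Proof.
apply: (@const_int _ (fun i => hmu (h i j))) => {}i.
by have [e _ []] := sys_rule sys i j.
Qed.

Lemma htau_const i j k : htau (h i j) = htau (h k j).
Proof.
apply: (@const_int _ (fun i => htau (h i j))) => {}i.
by have [e _ []] := sys_rule sys i j.
Qed.

Lemma sys_Lrow i j (h1 := h (2 * i + 1) (2 * j)) (h2 := h (2 * i + 1 + 1) (2 * j)) :
  (if oddz j then [/\ htau h2 = htau h1, ht h2 = ht h1, hmu h2 = hmu h1,
     hkap h2 = hkap h1 & [/\ hu1 h2 = hu1 h1, hseen h2 = hseen h1
     & hu2 h2 = hu2 h1]] else h2 = h1) /\ (oddz j -> ~~ hg h1 /\ hg h2).
Proof.
have [e [_ p2 p3 _ _] R] := sys_rule sys (2 * i + 1) (2 * j).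
have [oj|oj] := boolP (oddz j); move: oj; rewrite /oddz => oj.
  have ee : e = Li by apply: p2; lia.
  by subst e; case: R => ? ? ? ? [? ? [? ? ?] ? [*]]; do !split.
have ee : e = Lo by apply: p3; lia.
subst e; case: R => ? ? ? ? [? ? [? ? ?] ? [*]]; split=> //.
by apply: hcol_eq.
Qed.

Lemma sys_Gcol i j (v1 := v (2 * i) (2 * j + 1)) (v2 := v (2 * i) (2 * j + 1 + 1)) :
  (if oddz i then [/\ vlam v2 = vlam v1, vsg v2 = vsg v1, vt v2 = vt v1
     & vd1 v2 = vd1 v1] else v2 = v1) /\ (oddz i -> ~~ vg v1 /\ vg v2).
Proof.
have [e [_ _ _ p4 p5] R] := sys_rule sys (2 * i) (2 * j + 1).
have [oj|oj] := boolP (oddz i); move: oj; rewrite /oddz => oj.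
  have ee : e = Gi by apply: p4; lia.
  by subst e; case: R => ? ? ? ? [? ? [? ?] [*]]; do !split.
have ee : e = Go by apply: p5; lia.
subst e; case: R => ? ? ? ? [? ? [? ?] ? [*]]; split=> //.
by apply: vcol_eq.
Qed.

Lemma sys_even i j : exists e,
  rule e false false (h (2 * i) (2 * j)) (v (2 * i) (2 * j))
    (h (2 * i + 1) (2 * j)) (v (2 * i) (2 * j + 1)).
Proof.
have [e _ R] := sys_rule sys (2 * i) (2 * j).
have oi0 : oddz (2 * i) = false by rewrite /oddz; clear; lia.
have oj0 : oddz (2 * j) = false by rewrite /oddz; clear; lia.
by rewrite oi0 oj0 in R; exists e.
Qed.

Lemma sys_even_rule i j e :
  rule e false false (h (2 * i) (2 * j)) (v (2 * i) (2 * j))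
    (h (2 * i + 1) (2 * j)) (v (2 * i) (2 * j + 1)) ->
  [/\ oddz i -> e <> Gi /\ e <> Go, oddz j -> e <> Li /\ e <> Lo &
  rule e (oddz i) (oddz j) (h (2 * i) (2 * j)) (v (2 * i) (2 * j))
    (h (2 * (i + 1)) (2 * j)) (v (2 * i) (2 * (j + 1)))].
Proof.
move=> R.
have [V2 Vo] := sys_Gcol i j; have [H2 Ho] := sys_Lrow i j.
(* The odd rows just below and just above cross this column by [Gi], each raising [vg] from false to
   true. The cell in between must lower it, which neither [Gi] nor [Go] does. *)
have nG : oddz i -> e <> Gi /\ e <> Go.
  move=> oi; have [V1 _] := Vo oi; have [_ /(_ oi)] := sys_Gcol i (j - 1).
  have -> : 2 * (j - 1) + 1 + 1 = 2 * j by clear; lia.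
  move=> [_ V3]; split=> ee; subst e; case: R => ? ? ? ?.
    by case=> _ _ _ [] /negP.
  by case=> _ _ _ _ [] E; rewrite E V3 in V1.
have nL : oddz j -> e <> Li /\ e <> Lo.
  move=> oj; have [V1 _] := Ho oj; have [_ /(_ oj)] := sys_Lrow (i - 1) j.
  have -> : 2 * (i - 1) + 1 + 1 = 2 * i by clear; lia.
  move=> [_ V3]; split=> ee; subst e; case: R => ? ? ? ?.
    by case=> _ _ _ _ [] _ /negP.
  by case=> _ _ _ _ [] _ E; rewrite E V3 in V1.
split=> //.
apply: (rule_aux R _ _ erefl erefl).
- by move=> ee; apply/negP => /nG [? ?]; case: ee.
- by move=> ee; apply/negP => /nL [? ?]; case: ee.
- by have -> : 2 * (j + 1) = 2 * j + 1 + 1 by clear; lia.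
- by have -> : 2 * (i + 1) = 2 * i + 1 + 1 by clear; lia.
Qed.

(** On an odd column of the even lattice no cell has a [G] type, so the clock advances at each cell.
    On an odd row the cell is then [Eq], and the clock is twice [htau], which is constant along the
    row: all these columns have the same phase, known up to 2. *)
Lemma col_clock : exists2 d : int, d = 0 \/ d = 2 & forall i j, oddz i ->
  (vt (v (2 * i) (2 * j)) : nat)%:Z = ((j - 1 + d) %% 4)%Z.
Proof.
pose T (i j : int) := vt (v (2 * i) (2 * j)).
have TS (i j : int) : oddz i -> (T i (j + 1)%R = (T i j).+1 %% 4 :> nat)%N.
  rewrite /T => oi; have [e R0] := sys_even i j; have [nG _ R] := sys_even_rule R0.
  have {nG R0} [nG nGo] := nG oi.
  by case: e nG nGo R => // _ _ [_ _ _ _ []] [[-> E]] *; rewrite E.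
have Todd (i j : int) : oddz i -> oddz j -> T i j = (2 * htau (h 0 (2 * j)%R))%N :> nat.
  rewrite /T => oi oj; have [e R0] := sys_even i j; have [nG nL R] := sys_even_rule R0.
  have {nG R0} [nG nGo] := nG oi; have {nL} [nL nLo] := nL oj.
  rewrite (htau_const 0 (2 * j) (2 * i)).
  by case: e nG nGo nL nLo R => // _ _ _ _ [_ _ _ _ []] [[-> _]].
have tE (i j : int) : oddz i ->
    (T i j : nat)%:Z = ((j - 1 + (T i 1 : nat)%:Z) %% 4)%Z.
  move=> oi; apply: (@clock_int (fun j => T i j)) => // k; last exact: TS.
exists (T 1 1 : nat)%:Z; first by rewrite Todd //; case: htau; [right|left].
by move=> i j oi; rewrite -/(T i j) tE // (Todd i 1) // (Todd 1 1).
Qed.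

Lemma row_clock : exists2 d : int, d = 0 \/ d = 2 & forall i j, oddz j ->
  (ht (h (2 * i) (2 * j)) : nat)%:Z = ((i - 1 + d) %% 4)%Z.
Proof.
pose T (i j : int) := ht (h (2 * i) (2 * j)).
have TS (i j : int) : oddz j -> (T (i + 1)%R j = (T i j).+1 %% 4 :> nat)%N.
  rewrite /T => oj; have [e R0] := sys_even i j; have [_ nL R] := sys_even_rule R0.
  have {nL R0} [nL nLo] := nL oj.
  case: e nL nLo R => // _ _ [_ _ _ _ []]; [move=> _ [[a E]]|move=> [[a E]]..].
  - by rewrite a E.
  - by rewrite a E.
  - by rewrite a E.
have Todd (i j : int) : oddz i -> oddz j -> T i j = (2 * vsg (v (2 * i)%R 0))%N :> nat.
  rewrite /T => oi oj; have [e R0] := sys_even i j; have [nG nL R] := sys_even_rule R0.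
  have {nG R0} [nG nGo] := nG oi; have {nL} [nL nLo] := nL oj.
  rewrite (vsg_const (2 * i) 0 (2 * j)).
  by case: e nG nGo nL nLo R => // _ _ _ _ [_ _ _ _ []] _ [[-> _]].
have tE (i j : int) : oddz j ->
    (T i j : nat)%:Z = ((i - 1 + (T 1 j : nat)%:Z) %% 4)%Z.
  move=> oj; apply: (@clock_int (fun i => T i j)) => // k; last exact: TS.
exists (T 1 1 : nat)%:Z; first by rewrite Todd //; case: vsg; [right|left].
by move=> i j oi; rewrite -/(T i j) tE // (Todd 1 j) // (Todd 1 1).
Qed.

(** The two clocks fix the types on the odd lines of the even lattice, except that the residues 1
    and 3, or 0 and 2, modulo 4 may be exchanged; the translation by [dx] and [dy] repairs this. *)
Lemma sys_derive : exists dx dy : int, [/\ dx = 0 \/ dx = 2, dy = 0 \/ dy = 2,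
  Sys (fun i j => h (2 * (i + dx)) (2 * (j + dy)))
      (fun i j => v (2 * (i + dx)) (2 * (j + dy))) &
  forall (i j : int) e, let I := 2 * (i + dx) in let J := 2 * (j + dy) in
   rule e false false (h I J) (v I J) (h (I + 1) J) (v I (J + 1)) ->
   phase e i j /\ rule e (oddz i) (oddz j) (h I J) (v I J)
     (h (2 * (i + 1 + dx)) J) (v I (2 * (j + 1 + dy)))].
Proof.
have [dy Ddy cv] := col_clock; have [dx Ddx ch] := row_clock.
have oD i d : d = 0 \/ d = 2 -> oddz (i + d) = oddz i.
  by case=> ->; rewrite /oddz; lia.
have cv' i j : oddz i -> (vt (v (2 * (i + dx)) (2 * (j + dy))) : nat)%:Z =
    ((j - 1) %% 4)%Z by move=> oi; rewrite cv ?oD //; case: Ddy => ->; lia.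
have ch' i j : oddz j -> (ht (h (2 * (i + dx)) (2 * (j + dy))) : nat)%:Z =
    ((i - 1) %% 4)%Z by move=> oi; rewrite ch ?oD //; case: Ddx => ->; lia.
have E i d : 2 * (i + 1 + d) = 2 * (i + d + 1) :> int by lia.
have key i j e : rule e false false
    (h (2 * (i + dx)) (2 * (j + dy))) (v (2 * (i + dx)) (2 * (j + dy)))
    (h (2 * (i + dx) + 1) (2 * (j + dy))) (v (2 * (i + dx)) (2 * (j + dy) + 1)) ->
    phase e i j /\ rule e (oddz i) (oddz j)
    (h (2 * (i + dx)) (2 * (j + dy))) (v (2 * (i + dx)) (2 * (j + dy)))
    (h (2 * (i + 1 + dx)) (2 * (j + dy))) (v (2 * (i + dx)) (2 * (j + 1 + dy))).
  move=> R0; have [nG nL R] := sys_even_rule R0.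
  rewrite !oD // in R nG nL; split; last by rewrite !E.
  clear R0.
  have cvi := cv' i j; have chi := ch' i j.
  have oZ k : (k %% 4 = 0)%Z -> (oddz k = false) by rewrite /oddz; lia.
  have oZ2 k : (k %% 4 = 2)%Z -> (oddz k = false) by rewrite /oddz; lia.
  split=> [/eqP oi /eqP oj|/eqP oi oj|/eqP oi oj|oi /eqP oj|oi /eqP oj].
  - have [n1 n2] := nG oi; have [n3 n4] := nL oj.
    by case: e R nG nL n1 n2 n3 n4.
  - have [n1 n2] := nG oi; have {}cvi := cvi oi.
    case: e R nG nL n1 n2 => // -[_ _ _ _ []] [[]] tE *; exfalso.
      by move: cvi oj; rewrite tE; case: htau; clear; lia.
    by move: cvi oj; rewrite tE; clear; lia.
  - have [n1 n2] := nG oi; have {}cvi := cvi oi.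
    case: e R nG nL n1 n2 => // -[_ _ _ _ []] [[]] tE *; exfalso.
      by move: cvi oj; rewrite tE; case: htau; clear; lia.
    by move: cvi oj; rewrite tE; clear; lia.
  - have [n1 n2] := nL oj; have {}chi := chi oj.
    case: e R nG nL n1 n2 => // -[_ _ _ _ []].
      by move=> _ [[tE]] *; exfalso; move: chi oi; rewrite tE; case: vsg; clear; lia.
    by move=> [[tE]] *; exfalso; move: chi oi; rewrite tE; clear; lia.
  - have [n1 n2] := nL oj; have {}chi := chi oj.
    case: e R nG nL n1 n2 => // -[_ _ _ _ []].
      by move=> _ [[tE]] *; exfalso; move: chi oi; rewrite tE; case: vsg; clear; lia.
    by move=> [[tE]] *; exfalso; move: chi oi; rewrite tE; clear; lia.
have key' i j : exists2 e, phase e i j & rule e (oddz i) (oddz j)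
    (h (2 * (i + dx)) (2 * (j + dy))) (v (2 * (i + dx)) (2 * (j + dy)))
    (h (2 * (i + 1 + dx)) (2 * (j + dy))) (v (2 * (i + dx)) (2 * (j + 1 + dy))).
  by have [e /key[]] := sys_even (i + dx) (j + dy); exists e.
exists dx, dy; split=> //; split=> // i j o.
  rewrite (vsg_const _ _ (2 * (1 + dy))).
  have [e [p1 _ _ _ _]] := key' i 1.
  have -> : e = Eq by apply: p1 => //; apply/eqP.
  move=> [_ _ _ _ []] _ [[tE _] _] _; have := ch' i 1 erefl.
  by rewrite tE; move: o; rewrite /oddz; case: vsg => /=; clear; lia.
rewrite (htau_const _ _ (2 * (1 + dx))).
have [e [p1 _ _ _ _]] := key' 1 j.
have -> : e = Eq by apply: p1 => //; apply/eqP.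
move=> [_ _ _ _ []] [[tE _] _ _] _ _; have := cv' 1 j erefl.
by rewrite tE; move: o; rewrite /oddz; case: htau => /=; clear; lia.
Qed.
End Derive.

End Tiles.

(** * Transport of labels and diagonals within one level *)

Section Plane.
Variable S : tape_sys.
Variables (h : int -> int -> hcol S) (v : int -> int -> vcol S).
Hypothesis sys : Sys h v.

(** [Lam] and [Mu] number the columns and the rows of the lowest level, [Lam'] the columns of the
    next one. [diag] is the bit that enters an [Eq] cell, [diag'] the bit that leaves a [Gi] cell
    upwards. *)
Definition Lam (p : int) : lab S := vlam (v (2 * p + 1) 0).
Definition Lam' (p : int) : lab S := vlam (v (4 * p + 2) 0).
Definition Mu (q : int) : lab S := hmu (h 0 (2 * q + 1)).
Definition diag (p q : int) : bool := hu1 (h (2 * p + 1) (2 * q + 1)).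
Definition diag' (p q : int) : bool := vd2 (v (4 * p + 2) (2 * q + 1 + 1)).

Lemma sys_Eq (p q : int) :
  rule Eq true true (h (2 * p + 1) (2 * q + 1)) (v (2 * p + 1) (2 * q + 1))
   (h (2 * p + 1 + 1) (2 * q + 1)) (v (2 * p + 1) (2 * q + 1 + 1)).
Proof.
have [e [p1 _ _ _ _]] := sys_rule sys (2 * p + 1) (2 * q + 1).
have -> : oddz (2 * p + 1) = true by rewrite /oddz; clear; lia.
have -> : oddz (2 * q + 1) = true by rewrite /oddz; clear; lia.
by rewrite p1 //; clear; lia.
Qed.

Lemma sys_G (p q : int) (h0 := h (2 * p + 1 + 1) (2 * q + 1))
  (h1 := h (2 * p + 1 + 1 + 1) (2 * q + 1)) :
  rowpass h0 h1 /\ hu2 h1 = if oddz p then hu2 h0 else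
                    vd2 (v (2 * p + 1 + 1) (2 * q + 1)).
Proof.
have [e [_ _ _ p4 p5]] := sys_rule sys (2 * p + 1 + 1) (2 * q + 1).
have [] := boolP (oddz p); rewrite /oddz => o.
  have -> : e = Go by apply: p5; clear -o; lia.
  by case=> _ _ _ _ [].
have -> : e = Gi by apply: p4; clear -o; lia.
by case=> _ _ _ _ [_ ? _ []].
Qed.

Lemma row_step (p q : int) (h0 := h (2 * p + 1) (2 * q + 1))
  (h1 := h (2 * (p + 1) + 1) (2 * q + 1)) :
  [/\ nb (Lam p) (Lam (p + 1)), lz (Lam p) -> (p %% 2 = 0)%Z,
      hseen h1 = diag p q || (~~ lz (Lam p) && hseen h0),
      lz (Lam p) -> hseen h0 &
      [/\ diag p q -> lz (Mu q) = lz (Lam p) /\ lth (Mu q) = lth (Lam p),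
          hu1 h1 = vd1 (v (2 * p + 1) (2 * q + 1)) &
          hu2 h1 = if oddz p then hu2 h0
                   else vd2 (v (2 * p + 1 + 1) (2 * q + 1))]].
Proof.
rewrite /h1; have -> : 2 * (p + 1) + 1 = 2 * p + 1 + 1 + 1 by clear; lia.
have [_ _ _ _ [_ _ E]] := sys_Eq p q; have [[k u s] u2] := sys_G p q.
rewrite u s u2 /diag -/h0; have [E1 E2 E3 E4 E5 E6 E7 E8 E9] := E.
have L : Lam p = vlam (v (2 * p + 1) (2 * q + 1)) by exact: (vlam_const sys).
rewrite L E6; split=> //.
- rewrite -E1 -k; have [_ _ _ _ [_ _ [_ + _ _ _ _ _ _ _]]] := sys_Eq (p + 1) q.
  rewrite (vlam_const sys _ _ 0) -/(Lam _).
  by have -> : 2 * (p + 1) + 1 = 2 * p + 1 + 1 + 1 by clear; lia.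
- move=> /E3; rewrite (sys_sg sys); last by rewrite /oddz; clear; lia.
  clear; lia.
- split; [|by []|by rewrite E9].
  by move=> /E8[<- <-]; rewrite /Mu (hmu_const sys 0 _ (2 * p + 1)).
Qed.

(** The bit leaves the [Eq] cell upwards, crosses a cell of type [Li] or [Lo], which keeps it, and
    turns right at the next [Eq] cell of the column. *)
Lemma diagS (p q : int) : diag (p + 1) (q + 1) = diag p q.
Proof.
rewrite /diag; have [_ _ _ _ [_ -> _]] := row_step p (q + 1).
have -> : 2 * (q + 1) + 1 = 2 * q + 1 + 1 + 1 by clear; lia.
have [_ _ _ _ [_ _ [_ _ _ <- _ _ _ _ _]]] := sys_Eq p q.
have [e [_ p2 p3 _ _]] := sys_rule sys (2 * p + 1) (2 * q + 1 + 1).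
have [] := boolP (oddz q); rewrite /oddz => o.
  have -> : e = Lo by apply: p3; clear -o; lia.
  by case=> _ _ _ _ [].
have -> : e = Li by apply: p2; clear -o; lia.
by case=> _ _ _ _ [].
Qed.

Lemma Gi_step (p q : int) :
  [/\ lz (Lam' p) = lz (Lam (2 * p)) && (lzeta (Lam (2 * p)) == 0 :> nat)%N,
      ts_stp (lg (Lam (2 * p))) (lg (Lam' p)),
      diag' (p + 1) (q + 1) = if lz (Mu (q + 1)) then lz (Lam' (p + 1)) else diag' p q &
      diag' p q -> ts_nxt (lth (Mu q)) (lth (Lam' p))].
Proof.
have Gi_at (p' q' : int) :
    girule (h (4 * p' + 2) (2 * q' + 1)) (v (4 * p' + 2) (2 * q' + 1))
      (h (4 * p' + 2 + 1) (2 * q' + 1)) (v (4 * p' + 2) (2 * q' + 1 + 1)).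
  have [e [_ _ _ p4 _]] := sys_rule sys (4 * p' + 2) (2 * q' + 1).
  have -> : e = Gi by apply: p4; clear; lia.
  by case=> _ _ _ _ [].
have kap (p' q' : int) : hkap (h (4 * p' + 2) (2 * q' + 1)) = Lam (2 * p').
  have [_ _ _ _ [_ _ [E _ _ _ _ _ _ _ _]]] := sys_Eq (2 * p') q'.
  have -> : 4 * p' + 2 = 2 * (2 * p') + 1 + 1 by clear; lia.
  by rewrite E; exact: (vlam_const sys).
have LE (p' q' : int) : vlam (v (4 * p' + 2) q') = Lam' p' by exact: (vlam_const sys).
have ME (p' q' : int) : hmu (h p' (2 * q' + 1)) = Mu q' by exact: (hmu_const sys).
have [g1 g2 g3 g4 g5 g6 g7] := Gi_at p q.
rewrite kap LE ?ME in g3 g4 g7; split=> //.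
have [_ _ _ _ + _ _] := Gi_at (p + 1) (q + 1).
rewrite LE ME /diag' => ->; case: ifP => // _.
(* The bit is followed backwards: along the row through [Eq], [Go] and [Eq] to the previous [Gi]
   cell, then down the column through an even cell, which has no [G] type and so keeps [vd2]. *)
have -> : 4 * (p + 1) + 2 = 2 * (2 * p + 1 + 1) + 1 + 1 by clear; lia.
have [_ _ _ _ [_ _ [_ _ _ _ _ _ _ _ ->]]] := sys_Eq (2 * p + 1 + 1) (q + 1).
have [_ _ _ _ [_ _ ->]] := row_step (2 * p + 1) (q + 1).
have -> : oddz (2 * p + 1) = true by rewrite /oddz; clear; lia.
have [_ _ _ _ [_ _ ->]] := row_step (2 * p) (q + 1).
have -> : oddz (2 * p) = false by rewrite /oddz; clear; lia.
have -> : 2 * (2 * p) + 1 + 1 = 2 * (2 * p + 1) by clear; lia.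
have -> : 4 * p + 2 = 2 * (2 * p + 1) by clear; lia.
have -> : 2 * q + 1 + 1 = 2 * (q + 1) by clear; lia.
have [e R] := sys_even sys (2 * p + 1) (q + 1).
have [nG _ _] := sys_even_rule sys R.
have {nG} [nG nGo] : e <> Gi /\ e <> Go by apply: nG; rewrite /oddz; clear; lia.
by case: e nG nGo R => // _ _ [_ _ _ _ []] [_ _ d2] *; rewrite d2.
Qed.

End Plane.

(* [reach g l w]: the tape [w] of length [2 ^ l.+1] can occur at level [l] when
   [g] is the sequence of global states. *)
Definition locv (S : tape_sys) (g : glob S) (n : nat) (w : nat -> cell S) : Prop :=
  ts_bord g (w 0%N) /\ forall r, (r.+1 < n)%N -> ts_adj g (w r) (w r.+1).

Fixpoint reach (S : tape_sys) (g : nat -> glob S) (l : nat) (w : nat -> cell S) : Prop :=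
  match l with
  | 0 => locv (g 0%N) 2 w /\ forall r, (r < 2)%N -> ts_ini0 (w r)
  | k.+1 => locv (g k.+1) (2 ^ k.+2) w /\
    exists2 w0, reach g k w0 & forall r, (r < 2 ^ k.+1)%N -> ts_nxt (w0 r) (w r)
  end.

Section Zones.
Variable S : tape_sys.
Variables (h : int -> int -> hcol S) (v : int -> int -> vcol S).
Hypothesis sys : Sys h v.
Local Notation Lam := (Lam v).
Local Notation Lam' := (Lam' v).
Local Notation Mu := (Mu h).
Variables (l : nat) (p0 : int).
Local Notation N := (2 ^ l.+1)%N.
Hypothesis zoneP : forall p, lz (Lam p) = ((p - p0) %% N%:Z == 0)%Z.

Lemma N_gt0 : (0 < N)%N. Proof. by rewrite expn_gt0. Qed.

Lemma N_pred : N.-1%:Z = N%:Z - 1.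
Proof. by have := N_gt0; move: N => n; lia. Qed.

Lemma zone_start (k : int) : lz (Lam (p0 + k * N%:Z)).
Proof. rewrite zoneP (_ : _ - _ = k * N%:Z) ?modzMl //; ring. Qed.

Lemma zone_inside (k : int) r :
  (0 < r < N)%N -> lz (Lam (p0 + k * N%:Z + r%:Z)) = false.
Proof.
move=> /andP[r0 rN]; rewrite zoneP; apply/eqP.
have -> : p0 + k * N%:Z + r%:Z - p0 = k * N%:Z + r%:Z.
  by ring.
by rewrite modzMDl modz_small ?ltz_nat ?rN //; case: r r0 {rN}.
Qed.

Lemma zeta_start (k : int) : (lzeta (Lam (p0 + k * N%:Z)) : nat)%:Z =
  ((k + (lzeta (Lam p0) : nat)%:Z) %% 4)%Z.
Proof.
have H : forall k, lzeta (Lam (p0 + (k + 1) * N%:Z)) =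
   ((lzeta (Lam (p0 + k * N%:Z))).+1 %% 4)%N :> nat.
  move=> {}k.
  have ins r : (r < N)%N ->
      lzeta (Lam (p0 + k * N%:Z + r%:Z)) = lzeta (Lam (p0 + k * N%:Z)).
    elim: r => [|r IH] rN; first by rewrite addr0.
    rewrite -IH ?(ltnW rN) // intS [1 + _]addrC addrA.
    have [+ _ _ _ _] := row_step sys (p0 + k * N%:Z + r%:Z) 0.
    have := @zone_inside k r.+1 rN; rewrite intS [1 + _]addrC addrA => E.
    by case=> _; rewrite E => -[].
  have N1 : (N.-1 < N)%N by rewrite ltn_predL N_gt0.
  have [+ _ _ _ _] := row_step sys (p0 + k * N%:Z + N.-1%:Z) 0.
  have E : p0 + k * N%:Z + N.-1%:Z + 1 = p0 + (k + 1) * N%:Z.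
    by rewrite N_pred; ring.
  by rewrite E => -[_]; rewrite zone_start => -[-> _]; rewrite ins.
have := @clock_int (fun k => lzeta (Lam (p0 + k * N%:Z))) _ H k 0.
by rewrite mul0r addr0 subr0 => ->.
Qed.

Lemma diag_exists : exists p, diag h p 0.
Proof.
suff [r [_ dr]] : exists r, (r < N)%N /\ diag h (p0 + r%:Z) 0.
  by exists (p0 + r%:Z).
have st r : (r < N)%N -> hseen (h (2 * (p0 + r%:Z + 1) + 1) (2 * 0 + 1)) ->
   exists r, (r < N)%N /\ diag h (p0 + r%:Z) 0.
  elim: r => [|r IH] rN.
    have [_ _ -> _ _] := row_step sys (p0 + 0%N%:Z) 0.
    have -> : lz (Lam (p0 + 0%N%:Z)) by have := zone_start 0; rewrite mul0r.
    by rewrite orbF => d; exists 0%N; split.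
  have [_ _ -> _ _] := row_step sys (p0 + r.+1%:Z) 0.
  have [d _|_] := boolP (diag h _ _); first by exists r.+1.
  rewrite orFb => /andP[_]; have -> : p0 + r.+1%:Z = p0 + r%:Z + 1.
    by rewrite intS; ring.
  exact: IH (ltnW rN).
apply: (st N.-1); first by rewrite ltn_predL N_gt0.
have [_ _ _ + _] := row_step sys (p0 + N%:Z) 0.
have -> : p0 + N.-1%:Z + 1 = p0 + N%:Z.
  by rewrite N_pred; ring.
by apply; have := zone_start 1; rewrite mul1r.
Qed.

(** Along a diagonal, which never ends, the labels of the row and of the column agree. The rows thus
    carry a copy of the tape written on the columns, and this copy meets the columns of the next
    level, where the two tapes can be compared. *)
Lemma Mu_shift : exists c, forall k,
  lz (Mu k) = lz (Lam (c + k)) /\ lth (Mu k) = lth (Lam (c + k)).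
Proof.
have [c dc] := diag_exists; exists c => k.
have d : diag h (c + k) k.
  have E : forall k, diag h (c + (k + 1)) (k + 1) = diag h (c + k) k.
    by move=> {}k; rewrite addrA (diagS sys).
  have := @const_int _ (fun k => diag h (c + k) k) E k 0.
  by rewrite addr0 dc.
by have [_ _ _ _ [/(_ d)]] := row_step sys (c + k) k.
Qed.

Lemma zone_next : exists p0', forall p,
  lz (Lam' p) = ((p - p0') %% (2 ^ l.+2)%N%:Z == 0)%Z.
Proof.
have e0 : (p0 %% 2 = 0)%Z.
  by have [_ + _ _ _] := row_step sys p0 0; apply; rewrite zoneP subrr mod0z.
have [c pc] : exists c, p0 = 2 * c by exists (p0 %/ 2)%Z; move: e0; clear; lia.
set z0 := (lzeta (Lam p0) : nat)%:Z; pose M := (2 ^ l)%N%:Z.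
have NM : N%:Z = 2 * M by rewrite expnS PoszM.
have M0 : M != 0 by rewrite /M eqz_nat -lt0n expn_gt0.
(* The zone number [- z0] has [lzeta] equal to 0. It starts at the column [p0 - z0 * N], whose index
   is halved at the next level. *)
exists (c - z0 * M) => p.
have -> : (2 ^ l.+2)%N%:Z = 4 * M by rewrite 2!expnS mulnA PoszM.
have [-> _ _ _] := Gi_step sys p 0; rewrite zoneP.
apply/andP/idP => [[/eqP d0 z00]|/eqP d0].
  pose k := ((2 * p - p0) %/ N%:Z)%Z.
  have E : 2 * p = p0 + k * N%:Z.
    have := divz_eq (2 * p - p0) N%:Z; rewrite d0 addr0 -/k => <-.
    by rewrite addrC subrK.
  have := zeta_start k; rewrite -E (eqP z00) -/z0 => /esym kz.
  have -> : p - (c - z0 * M) = (k + z0) * M.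
    have : 2 * p = 2 * (c + k * M) by rewrite E pc NM; ring.
    by rewrite [(k + z0) * M]mulrDl; move: (k * M) (z0 * M); clear; lia.
  have := divz_eq (k + z0) 4; rewrite kz addr0 => ->.
  by rewrite -mulrA modzMl.
pose t := ((p - (c - z0 * M)) %/ (4 * M))%Z.
have tE : p - (c - z0 * M) = t * (4 * M).
  by have := divz_eq (p - (c - z0 * M)) (4 * M); rewrite d0 addr0.
have E : 2 * p = p0 + (4 * t - z0) * N%:Z.
  have -> : p = c - z0 * M + t * (4 * M) by rewrite -tE addrC subrK.
  by rewrite pc NM; ring.
split.
  by rewrite E (_ : _ - _ = (4 * t - z0) * N%:Z) ?modzMl //; ring.
have := zeta_start (4 * t - z0); rewrite -E subrK => zz.
by apply/eqP; move: zz; case: (lzeta _) => /= m _; clear; lia.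
Qed.

Lemma reach_next (g : nat -> glob S) :
  (forall p, lz (Lam p) -> reach g l (fun r => lth (Lam (p + r%:Z)))) ->
  (forall p, nb (Lam' p) (Lam' (p + 1))) ->
  (forall p, lg (Lam' p) = g l.+1) ->
  forall p, lz (Lam' p) -> reach g l.+1 (fun r => lth (Lam' (p + r%:Z))).
Proof.
move=> R nbL gE p zp; have [p0' zP'] := zone_next; split.
  split.
    have := nbL (p - 1); rewrite subrK => -[_]; rewrite zp gE => -[_].
    by rewrite addr0.
  move=> r rN; have := nbL (p + r%:Z).
  have -> : p + r%:Z + 1 = p + r.+1%:Z by rewrite intS; ring.
  case=> _; suff -> : lz (Lam' (p + r.+1%:Z)) = false by rewrite gE => -[].
  move: zp; rewrite !zP' => /eqP zp.
  have -> : p + r.+1%:Z - p0' = p - p0' + r.+1%:Z by ring.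
  by rewrite -modzDml zp add0r modz_small ?ltz_nat ?rN.
have [c Mc] := Mu_shift.
exists (fun r => lth (Lam (p0 + r%:Z))).
  by apply: R; have := zone_start 0; rewrite mul0r addr0.
have MuE r : lz (Mu (p0 - c + r%:Z)) = lz (Lam (p0 + r%:Z)) /\
    lth (Mu (p0 - c + r%:Z)) = lth (Lam (p0 + r%:Z)).
  by have -> : p0 + r%:Z = c + (p0 - c + r%:Z) by ring.
(* The second diagonal starts where a zone of rows and a zone of columns start together, and it
   lasts as long as the zone of rows, that is for half of the next tape. *)
have d r : (r < N)%N -> diag' v (p + r%:Z) (p0 - c + r%:Z).
  elim: r => [|r IH] rN.
    rewrite !addr0; have [_ _ + _] := Gi_step sys (p - 1) (p0 - c - 1).
    rewrite !subrK => ->; have [+ _] := MuE 0%N; rewrite addr0 => ->.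
    by have := zone_start 0; rewrite mul0r !addr0 => ->.
  have [_ _ + _] := Gi_step sys (p + r%:Z) (p0 - c + r%:Z).
  have E (a : int) : a + r%:Z + 1 = a + r.+1%:Z by rewrite intS; ring.
  rewrite !E (MuE _).1 => ->; have := @zone_inside 0 r.+1 rN.
  by rewrite mul0r addr0 => ->; apply: IH (ltnW rN).
move=> r rN; have [_ _ _] := Gi_step sys (p + r%:Z) (p0 - c + r%:Z).
by rewrite (MuE _).2; apply; apply: d.
Qed.
End Zones.

(** * Hierarchical structure of the tilings *)

Lemma dep_choice (T : Type) (P : nat -> T -> Prop) (R : nat -> T -> T -> Prop) x0 :
  P 0%N x0 -> (forall n x, P n x -> exists2 y, P n.+1 y & R n x y) ->
  exists f : nat -> T, forall n, P n (f n) /\ R n (f n) (f n.+1).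
Proof.
move=> P0 PS.
have /choice[F FP] : forall nx : nat * T, exists y,
    P nx.1 nx.2 -> P nx.1.+1 y /\ R nx.1 nx.2 y.
  move=> [n x] /=; have [Px|nPx] := pselect (P n x); last by exists x0.
  by have [y Py Ry] := PS n x Px; exists y.
pose f := fix f n := if n is m.+1 then F (m, f m) else x0.
have fP n : P n (f n) by elim: n => //= n /(FP (n, f n))[].
by exists f => n; split=> //; have /= [] := FP (n, f n) (fP n).
Qed.

Lemma phase_mod e i j i' j' : (i %% 4 = i' %% 4)%Z -> (j %% 4 = j' %% 4)%Z ->
  phase e i j -> phase e i' j'.
Proof.
move=> Ei Ej [p1 p2 p3 p4 p5]; split=> ii jj.
- by apply: p1; move: Ei Ej ii jj; clear; lia.
- by apply: p2; move: Ei Ej ii jj; clear; lia.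
- by apply: p3; move: Ei Ej ii jj; clear; lia.
- by apply: p4; move: Ei Ej ii jj; clear; lia.
- by apply: p5; move: Ei Ej ii jj; clear; lia.
Qed.

Section Tower.
Variable S : tape_sys.
Variable z : int -> int -> tile S.
Hypothesis tz : tiling z.

Definition cell_rule (e : ctype) (x y : int) : Prop :=
  phase e (ta (z x y) : nat) (tb (z x y) : nat) /\
  rule e (odd (ta (z x y))) (odd (tb (z x y)))
    (th (z x y)) (tv (z x y)) (th (z (x + 1) y)) (tv (z x (y + 1))).

Lemma cell_rule_ex x y : exists e, cell_rule e x y.
Proof. by have [_ _ _ _ [e ? [? _]] _ _] := tz x y; exists e. Qed.

Definition lpos (l : nat) (a i : int) : int := (2 ^ l)%N%:Z * i + a.

Lemma phys_coord : exists a b : int, forall x y,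
  ((ta (z x y) : nat)%:Z = (x - a) %% 4)%Z /\
  ((tb (z x y) : nat)%:Z = (y - b) %% 4)%Z.
Proof.
exists (- (ta (z 0 0) : nat)%:Z), (- (tb (z 0 0) : nat)%:Z) => x y; split.
  have -> : ta (z x y) = ta (z x 0).
    by apply: (@const_int _ (fun y => ta (z x y))) => j; have [_ _ ->] := tz x j.
  have -> := @clock_int (fun x => ta (z x 0)) _ _ x 0.
  - by congr (_ %% _)%Z; ring.
  - by move=> j; apply: ltn_ord.
  - by move=> j; have [-> _ _ _ _ _ _] := tz j 0.
have -> : tb (z x y) = tb (z 0 y).
  by apply: (@const_int _ (fun x => tb (z x y))) => i; have [_ ->] := tz i y.
have -> := @clock_int (fun y => tb (z 0 y)) _ _ y 0.
- by congr (_ %% _)%Z; ring.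
- by move=> j; apply: ltn_ord.
- by move=> j; have [_ _ _ -> _ _ _] := tz 0 j.
Qed.

Lemma vlam_up x y y' : vlam (tv (z x y)) = vlam (tv (z x y')).
Proof.
apply: (@const_int _ (fun y => vlam (tv (z x y)))) => j.
by have [_ _ _ _ [e _ [[]]]] := tz x j.
Qed.

(** The second clause follows the types themselves and not only the edges: two tilings with the same
    origins must have the same types in order to be compared. *)
Definition lvl (l : nat) (ab : int * int) : Prop :=
  let X := lpos l ab.1 in let Y := lpos l ab.2 in
  Sys (fun i j : int => th (z (X i) (Y j))) (fun i j : int => tv (z (X i) (Y j))) /\
  forall i j e, cell_rule e (X i) (Y j) -> phase e i j /\
    rule e (oddz i) (oddz j) (th (z (X i) (Y j))) (tv (z (X i) (Y j)))
      (th (z (X (i + 1)) (Y j))) (tv (z (X i) (Y (j + 1)))).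

Lemma lvl0 : exists2 ab, lvl 0 ab & [/\ forall (x y : int),
  oddz (x - ab.1) -> lz (vlam (tv (z x y))) = ((x - ab.1) %% 4 == 1)%Z,
  forall (x y : int), oddz (x - ab.1) -> ts_ini (lg (vlam (tv (z x y)))) &
  forall (x y : int), oddz (x - ab.1) -> ts_ini0 (lth (vlam (tv (z x y))))].
Proof.
have [a [b ab]] := phys_coord; exists (a, b); last first.
  have K x y : oddz (x - a) -> odd (ta (z x y)).
    have [+ _] := ab x y; rewrite /oddz.
    by move: (ta _ : nat) (x - a); clear; lia.
  split=> x y o; have [_ _ _ _ _ + _] := tz x y => /(_ (K _ _ o))[] // _ -> _ _.
  have [+ _] := ab x y.
  by move: (ta _ : nat) (x - _); clear; lia.
have key i j e : cell_rule e (lpos 0 a i) (lpos 0 b j) -> phase e i j /\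
    rule e (oddz i) (oddz j) (th (z (lpos 0 a i) (lpos 0 b j)))
    (tv (z (lpos 0 a i) (lpos 0 b j))) (th (z (lpos 0 a (i + 1)) (lpos 0 b j)))
    (tv (z (lpos 0 a i) (lpos 0 b (j + 1)))).
  rewrite /lpos !mul1r [i + 1 + a]addrAC [j + 1 + b]addrAC.
  have [tax tbx] := ab (i + a) (j + b); rewrite !addrK in tax tbx.
  have -> : oddz i = odd (ta (z (i + a) (j + b))).
    by move: tax; rewrite /oddz; move: (ta _ : nat); clear; lia.
  have -> : oddz j = odd (tb (z (i + a) (j + b))).
    by move: tbx; rewrite /oddz; move: (tb _ : nat); clear; lia.
  move=> [ph R]; split=> //; apply: phase_mod ph.
    by rewrite tax; clear; lia.
  by rewrite tbx; clear; lia.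
split=> //; split.
- move=> i j; have [e /key[ph R]] := cell_rule_ex (lpos 0 a i) (lpos 0 b j).
  by exists e.
- move=> i j o; have [tax _] := ab (lpos 0 a i) (lpos 0 b j).
  rewrite /lpos mul1r addrK in tax *.
  have [_ _ _ _ _ + _] := tz (i + a) (1 * j + b).
  case.
    by move: o tax; rewrite /oddz; move: (ta _ : nat); clear; lia.
  move=> -> _ _ _; move: tax; move: (ta _ : nat); clear; lia.
- move=> i j o; have [_ tbx] := ab (lpos 0 a i) (lpos 0 b j).
  rewrite /lpos !mul1r addrK in tbx *.
  have [_ _ _ _ _ _ ->] := tz (i + a) (j + b).
    by move: tbx; move: (tb _ : nat); clear; lia.
  by move: o tbx; rewrite /oddz; move: (tb _ : nat); clear; lia.
Qed.

Lemma lpos_derive l a d i :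
  lpos l.+1 (a + (2 ^ l.+1)%N%:Z * d) i = lpos l a (2 * (i + d)).
Proof. by rewrite /lpos expnS PoszM; ring. Qed.

Definition shift_ok (l : nat) (a a' : int) : Prop :=
  exists2 c, c = 0 \/ c = 1 & a' = a + (2 ^ l.+2)%N%:Z * c.

Lemma lvlS l ab : lvl l ab -> exists2 ab', lvl l.+1 ab' &
  shift_ok l ab.1 ab'.1 /\ shift_ok l ab.2 ab'.2.
Proof.
move=> [sys lR]; have [dx [dy [Ddx Ddy sys' D]]] := sys_derive sys.
exists (ab.1 + (2 ^ l.+1)%N%:Z * dx, ab.2 + (2 ^ l.+1)%N%:Z * dy); last first.
  have E : (2 ^ l.+2)%N%:Z = 2 * (2 ^ l.+1)%N%:Z by rewrite expnS PoszM.
  split; rewrite /shift_ok /= E.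
    case: Ddx => ->; first by exists 0; [left|rewrite !mulr0].
    by exists 1; [right|rewrite mulr1 mulrC].
  case: Ddy => ->; first by exists 0; [left|rewrite !mulr0].
  by exists 1; [right|rewrite mulr1 mulrC].
split=> /=.
  suff [-> ->] :
    (fun i j : int => th (z (lpos l.+1 (ab.1 + (2 ^ l.+1)%N%:Z * dx) i)
                      (lpos l.+1 (ab.2 + (2 ^ l.+1)%N%:Z * dy) j))) =
    (fun i j : int => th (z (lpos l ab.1 (2 * (i + dx))) (lpos l ab.2 (2 * (j + dy))))) /\
    (fun i j : int => tv (z (lpos l.+1 (ab.1 + (2 ^ l.+1)%N%:Z * dx) i)
                      (lpos l.+1 (ab.2 + (2 ^ l.+1)%N%:Z * dy) j))) =
    (fun i j : int => tv (z (lpos l ab.1 (2 * (i + dx))) (lpos l ab.2 (2 * (j + dy))))).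
    by [].
  by split; apply/funext => i; apply/funext => j; rewrite !lpos_derive.
move=> i j e; rewrite !lpos_derive => /lR[_ R]; apply: D.
have oE k d : oddz (2 * (k + d)) = false by rewrite /oddz; clear; lia.
by rewrite !oE in R.
Qed.

Theorem tiling_tower : exists (a b : nat -> int) (g : nat -> glob S),
  [/\ forall l, shift_ok l (a l) (a l.+1) /\ shift_ok l (b l) (b l.+1),
      forall l i j e, cell_rule e (lpos l (a l) i) (lpos l (b l) j) -> phase e i j,
      ts_ini (g 0%N) /\ forall l, ts_stp (g l) (g l.+1),
      forall l, exists w, reach g l w &
      forall l p y, lg (vlam (tv (z (lpos l (a l) (2 * p + 1)) y))) = g l].
Proof.
have [ab0 L0 [zi gi ti]] := lvl0.
have stp l ab : lvl l ab /\ (l = 0%N -> ab = ab0) -> exists2 ab',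
    lvl l.+1 ab' /\ (l.+1 = 0%N -> ab' = ab0) &
    shift_ok l ab.1 ab'.1 /\ shift_ok l ab.2 ab'.2.
  by move=> [/lvlS[ab' Lab' sh] _]; exists ab'.
have [f fP] := dep_choice (conj L0 (fun=> erefl)) stp.
pose a l := (f l).1; pose b l := (f l).2.
have f0 : f 0%N = ab0 by have [[_ ->]] := fP 0%N.
pose v l (i j : int) := tv (z (lpos l (a l) i) (lpos l (b l) j)).
pose h l (i j : int) := th (z (lpos l (a l) i) (lpos l (b l) j)).
have sys l : Sys (h l) (v l) by have [[[]]] := fP l.
pose g l := lg (Lam (v l) 0).
have nbL l p : nb (Lam (v l) p) (Lam (v l) (p + 1)).
  by have [] := row_step (sys l) p 0.
have gE l p : lg (Lam (v l) p) = g l.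
  apply: (@const_int _ (fun p => lg (Lam (v l) p))) => q.
  by have [] := nbL l q.
(* [Lam'] at level [l] and [Lam] at level [l.+1] number the same columns from two origins. *)
have LE l : exists c, forall p, Lam' (v l) p = Lam (v l.+1) (p + c).
  have [_ [[c _ ac] _]] := fP l; exists (- c) => p.
  rewrite /Lam /Lam' /v; rewrite (vlam_up _ _ 0) [RHS](vlam_up _ _ 0).
  congr (vlam (tv (z _ _))); rewrite /a ac /lpos !expnS !PoszM; ring.
have gE' l p : lg (Lam' (v l) p) = g l.+1 by have [c ->] := LE l; rewrite gE.
have nbL' l p : nb (Lam' (v l) p) (Lam' (v l) (p + 1)).
  by have [c Lc] := LE l; rewrite !Lc addrAC; apply: nbL.
have od (i : int) : oddz (2 * i + 1) by rewrite /oddz; clear; lia.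
have x0 p : lpos 0 (a 0%N) (2 * p + 1) - ab0.1 = 2 * p + 1.
  by rewrite /a f0 /lpos mul1r addrK.
have Z l : (exists p0, forall p, lz (Lam (v l) p) = ((p - p0) %% (2 ^ l.+1)%N%:Z == 0)%Z)
    /\ (forall p, lz (Lam (v l) p) -> reach g l (fun r => lth (Lam (v l) (p + r%:Z)))).
  elim: l => [|l [[p0 zP] R]].
    have zE p : lz (Lam (v 0%N) p) = ((p - 0) %% (2 ^ 1)%N%:Z == 0)%Z.
      by rewrite /Lam /v zi x0 ?od // subr0; clear; lia.
    split; first by exists 0.
    move=> p zp; split; last first.
      by move=> r _; apply: ti; rewrite x0.
    split.
      have := nbL 0%N (p - 1); rewrite subrK => -[_]; rewrite zp gE => -[_].
      by rewrite addr0.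
    move=> [|//] _; have := nbL 0%N p; rewrite addr0 => -[_].
    suff -> : lz (Lam (v 0%N) (p + 1)) = false by rewrite gE => -[].
    by move: zp; rewrite !zE; clear; lia.
  have [c Lc] := LE l.
  have [p0' zP'] := zone_next (sys l) zP.
  split.
    exists (p0' + c) => p; have := zP' (p - c); rewrite Lc subrK => ->.
    by congr (_ %% _ == _)%Z; ring.
  move=> p; have := reach_next (sys l) zP R (nbL' l) (gE' l) (p := p - c).
  rewrite Lc subrK => + zp => /(_ zp) [H1 H2].
  have E r : Lam' (v l) (p - c + r%:Z) = Lam (v l.+1) (p + r%:Z).
    by rewrite Lc; congr Lam; ring.
  by have -> : (fun r => lth (Lam (v l.+1) (p + r%:Z))) =
    (fun r => lth (Lam' (v l) (p - c + r%:Z))) by apply/funext => r; rewrite E.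
exists a, b, g; split.
- by move=> l; have [] := fP l.
- by move=> l i j e; have [[[_ H] _] _] := fP l; move=> /H[].
- split=> [|l].
    by rewrite /g /Lam /v; apply: gi; have := x0 0; rewrite /= => ->; apply: od.
  by have [_ + _ _] := Gi_step (sys l) 0 0; rewrite !gE gE'.
- move=> l; have [[p0 zP] R] := Z l.
  by exists (fun r => lth (Lam (v l) (p0 + r%:Z))); apply: R; rewrite zP subrr mod0z.
- move=> l p y; rewrite -(gE l p) /Lam /v; congr (lg _); exact: vlam_up.
Qed.
End Tower.

(** * Tilings of a square are determined by linearly many data *)

Definition ctype_ord (e : ctype) : 'I_5 :=
  match e with Eq => inord 0 | Gi => inord 1 | Go => inord 2 | Li => inord 3
             | Lo => inord 4 end.
Definition ord_ctype (k : 'I_5) : ctype :=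
  match val k with 0 => Eq | 1 => Gi | 2 => Go | 3 => Li | _ => Lo end.
Lemma ctype_ordK : cancel ctype_ord ord_ctype.
Proof. by case; rewrite /ord_ctype /= inordK. Qed.

Lemma phase_inj e e' i j : phase e i j -> phase e' i j -> oddz i || oddz j ->
  e = e'.
Proof.
move=> [a b c d f] [a' b' c' d' f'] o.
have : ((i %% 2 = 1 /\ j %% 2 = 1) \/ (i %% 2 = 1 /\ j %% 4 = 2) \/
  (i %% 2 = 1 /\ j %% 4 = 0) \/ (i %% 4 = 2 /\ j %% 2 = 1) \/
  (i %% 4 = 0 /\ j %% 2 = 1))%Z by move: o; rewrite /oddz; clear; lia.
case=> [[x y]|[[x y]|[[x y]|[[x y]|[x y]]]]].
- by rewrite a // a'.
- by rewrite b // b'.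
- by rewrite c // c'.
- by rewrite d // d'.
- by rewrite f // f'.
Qed.

Section Levels.
Variables (a : nat -> int).
Hypothesis aS : forall l, shift_ok l (a l) (a l.+1).

Lemma lpos_even l i : exists i', lpos l (a l) (2 * i) = lpos l.+1 (a l.+1) i'.
Proof.
have [c _ ->] := aS l; exists (i - 2 * c).
by rewrite /lpos !expnS !PoszM; ring.
Qed.

Lemma lpos_odd_or L x : (exists l p, (l < L)%N /\ x = lpos l (a l) (2 * p + 1)) \/
  exists i, x = lpos L (a L) i.
Proof.
elim: L => [|L [[l [p [lL ->]]]|[i ->]]].
- by right; exists (x - a 0%N); rewrite /lpos mul1r subrK.
- by left; exists l, p; split=> //; apply: ltnW.
have [od|od] := boolP (oddz i).
  left; exists L, (i %/ 2)%Z; split=> //; congr lpos.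
  by move: od; rewrite /oddz; clear; lia.
right; have [i' E] := lpos_even L (i %/ 2)%Z; exists i'; rewrite -E; congr lpos.
by move: od; rewrite /oddz; clear; lia.
Qed.

Lemma level_shift l L : (l <= L)%N -> exists c, a L = a l + (2 ^ l.+2)%N%:Z * c.
Proof.
elim: L => [|L IH]; first by rewrite leqn0 => /eqP ->; exists 0; rewrite mulr0 addr0.
rewrite leq_eqVlt => /predU1P[->|]; first by exists 0; rewrite mulr0 addr0.
rewrite ltnS => lL; have [c E] := IH lL; have [d _ ->] := aS L.
exists (c + (2 ^ (L - l))%N%:Z * d); rewrite E -addrA mulrDr; congr (_ + (_ + _)).
by rewrite mulrA -PoszM -expnD !addSn subnKC.
Qed.
End Levels.

Lemma lpos_two (a b : nat -> int) :
  (forall l, shift_ok l (a l) (a l.+1)) -> (forall l, shift_ok l (b l) (b l.+1)) ->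
  forall L x y, (exists l i j, [/\ (l < L)%N, x = lpos l (a l) i, y = lpos l (b l) j
     & oddz i || oddz j]) \/
   (exists i j, x = lpos L (a L) i /\ y = lpos L (b L) j).
Proof.
move=> aS bS; elim=> [|L IH] x y.
  right; exists (x - a 0%N), (y - b 0%N); split; by rewrite /lpos mul1r subrK.
have [[l [i [j [lL ? ? ?]]]]|[i [j [-> ->]]]] := IH x y.
  by left; exists l, i, j; split=> //; apply: ltnW.
have [od|] := boolP (oddz i || oddz j); first by left; exists L, i, j; split.
rewrite negb_or => /andP[oi oj]; right.
have [i' Ei] := lpos_even aS L (i %/ 2)%Z; have [j' Ej] := lpos_even bS L (j %/ 2)%Z.
exists i', j'; rewrite -Ei -Ej; split; congr lpos.
  by move: oi; rewrite /oddz; clear; lia.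
by move: oj; rewrite /oddz; clear; lia.
Qed.

(** After level [l] the origins move by multiples of [2 ^ l.+2], so the origin of level [L] modulo
    [2 ^ L.+1] determines the residues modulo 4 at all the lower levels. *)
Lemma lpos_mod4 (a a' : nat -> int) l L i :
  (forall l, shift_ok l (a l) (a l.+1)) -> (forall l, shift_ok l (a' l) (a' l.+1)) ->
  (l < L)%N -> (a L = a' L %[mod (2 ^ L.+1)%N%:Z])%Z ->
  exists2 i', lpos l (a l) i = lpos l (a' l) i' & (i %% 4 = i' %% 4)%Z.
Proof.
move=> aS a'S lL E; have [c Ec] := level_shift aS (ltnW lL).
have [c' Ec'] := level_shift a'S (ltnW lL).
have [d Ed] : exists d, a L - a' L = d * (2 ^ L.+1)%N%:Z.
  exists ((a L - a' L) %/ (2 ^ L.+1)%N%:Z)%Z.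
  by rewrite divzK // -eqz_mod_dvd; apply/eqP.
have LE : (2 ^ L.+1)%N%:Z = (2 ^ l.+2)%N%:Z * (2 ^ (L - l.+1))%N%:Z.
  by rewrite -PoszM -expnD addSn subnKC.
have P4 : (2 ^ l.+2)%N%:Z = 4 * (2 ^ l)%N%:Z by rewrite 2!expnS mulnA PoszM.
exists (i + 4 * (c' - c + d * (2 ^ (L - l.+1))%N%:Z)); last first.
  by move: (c' - c + _); clear; lia.
have : a l = a' l + (2 ^ l.+2)%N%:Z * (c' - c + d * (2 ^ (L - l.+1))%N%:Z).
  have -> : a l = a L - (2 ^ l.+2)%N%:Z * c by rewrite Ec addrK.
  have -> : a' l = a' L - (2 ^ l.+2)%N%:Z * c' by rewrite Ec' addrK.
  have -> : a L = a' L + d * (2 ^ L.+1)%N%:Z by rewrite -Ed addrC subrK.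
  by rewrite LE; ring.
by move=> ->; rewrite /lpos P4; ring.
Qed.

Section Code.
Variables (S : tape_sys).

Definition full_rule (z : int -> int -> tile S) (e : ctype) (x y : int) : Prop :=
  cell_rule z e x y /\
    match e with
    | Eq => [/\ ~~ vg (tv (z x (y + 1))), vd2 (tv (z x (y + 1))) = vd2 (tv (z x y))
              & ~~ hg (th (z (x + 1) y))]
    | Gi | Go => ~~ hg (th (z (x + 1) y))
    | Li | Lo => ~~ vg (tv (z x (y + 1))) /\ vd2 (tv (z x (y + 1))) = vd2 (tv (z x y))
    end.

Lemma full_rule_ex z x y : tiling z -> exists e, full_rule z e x y.
Proof. by move=> tz; have [_ _ _ _ [e ? []]] := tz x y; exists e. Qed.

Lemma adv4_inj t t1 t2 k k' : adv4 t t1 k -> adv4 t t2 k' -> t1 = t2.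
Proof. by move=> [e a] [e2 b]; apply: val_inj; rewrite /= a b -e -e2. Qed.

Lemma full_rule_det z z' e x y : full_rule z e x y -> full_rule z' e x y ->
  z x y = z' x y ->
  th (z (x + 1) y) = th (z' (x + 1) y) /\ tv (z x (y + 1)) = tv (z' x (y + 1)).
Proof.
rewrite /full_rule /cell_rule => -[[_ [a1 a2 a3 a4 R]] D] [[_ [b1 b2 b3 b4 Q]] F] E.
rewrite -E in b1 b2 b3 b4 Q F.
have nE (b c : bool) : ~~ b -> ~~ c -> b = c by case: b c => -[].
case: e R D Q F => -[].
- move=> [t _ _] [t' _] [? ? ? ? ? ? ? ? ?] [? ? ?] [[s _ _] [s' _] [? ? ? ? ? ? ? ? ?]] [? ? ?].
  split; [apply: hcol_eq|apply: vcol_eq]; rewrite ?(adv4_inj t s) ?(adv4_inj t' s') //; try exact: nE; congruence.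
- move=> [t' _] [? ? ?] [? ?] [? ? ? ? ? ? ?] ? [[s' _] [? ? ?] [? ?] [? ? ? ? ? ? ?]] ?.
  split; [apply: hcol_eq|apply: vcol_eq]; rewrite ?(adv4_inj t' s') //; try exact: nE; congruence.
- move=> [t' _] [? ? ?] [? ?] ? [? ?] ? [[s' _] [? ? ?] [? ?] ? [? ?]] ?.
  split; [apply: hcol_eq|apply: vcol_eq]; rewrite ?(adv4_inj t' s') //; try exact: nE; congruence.
- move=> [t _ _] ? [? ? ?] ? [? ? ?] [? ?] [[s _ _] ? [? ? ?] ? [? ? ?]] [? ?].
  split; [apply: hcol_eq|apply: vcol_eq]; rewrite ?(adv4_inj t s) //; try exact: nE; congruence.
- move=> [t _ _] ? [? ? ?] ? [? ?] [? ?] [[s _ _] ? [? ? ?] ? [? ?]] [? ?].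
  split; [apply: hcol_eq|apply: vcol_eq]; rewrite ?(adv4_inj t s) //; try exact: nE; congruence.
Qed.

Definition tcode n1 n2 L := ('I_(2 ^ L.+1) * 'I_(2 ^ L.+1) * 'I_5 *
   {ffun 'I_n1 -> tile S} * {ffun 'I_n2 -> tile S})%type.

(** When the sides are at most [2 ^ L], at most one cell has both coordinates of level at least [L],
    and its type is recorded apart. The other types follow from the two origins; then the bottom row
    and the left column determine all the tiles. *)
Definition has_code n1 n2 L (z : int -> int -> tile S) (c : tcode n1 n2 L) : Prop :=
  exists a b : nat -> int,
  [/\ forall l, shift_ok l (a l) (a l.+1) /\ shift_ok l (b l) (b l.+1),
      forall l i j e, cell_rule z e (lpos l (a l) i) (lpos l (b l) j) -> phase e i j,
      (a L %% (2 ^ L.+1)%N%:Z)%Z = (c.1.1.1.1 : nat)%:Z /\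
      (b L %% (2 ^ L.+1)%N%:Z)%Z = (c.1.1.1.2 : nat)%:Z,
      forall x y : nat, (x < n1)%N -> (y < n2)%N ->
        (exists i, x%:Z = lpos L (a L) i) -> (exists j, y%:Z = lpos L (b L) j) ->
        full_rule z (ord_ctype c.1.1.2) x y &
      (forall i : 'I_n1, c.1.2 i = z (i : nat)%:Z 0) /\
      (forall j : 'I_n2, c.2 j = z 0 (j : nat)%:Z)].

Lemma modz_ord (m : int) n : (0 < n)%N -> exists k : 'I_n, (m %% n%:Z)%Z = (k : nat)%:Z.
Proof.
move=> n0; have lt : (`|(m %% n%:Z)%Z|%N < n)%N.
  by rewrite -ltz_nat gez0_abs ?modz_ge0 ?ltz_pmod // eqz_nat -lt0n.
by exists (Ordinal lt); rewrite /= gez0_abs ?modz_ge0 // eqz_nat -lt0n.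
Qed.

Lemma eqmod_half L (x y : int) : (x = y %[mod (2 ^ L.+1)%N%:Z])%Z ->
  (x = y %[mod (2 ^ L)%N%:Z])%Z.
Proof.
move=> /eqP; rewrite eqz_mod_dvd => d; apply/eqP; rewrite eqz_mod_dvd.
by apply: dvdz_trans d; rewrite expnS PoszM dvdz_mull.
Qed.

Lemma lpos_small L a (x x' : nat) i i' : (x < 2 ^ L)%N -> (x' < 2 ^ L)%N ->
  x%:Z = lpos L a i -> x'%:Z = lpos L a i' -> x = x'.
Proof.
move=> x1 x2 e1 e2; apply/eqP; rewrite -eqz_nat.
have E (y : nat) : (y < 2 ^ L)%N -> y%:Z = (y%:Z %% (2 ^ L)%N%:Z)%Z.
  by move=> yL; rewrite modz_small ?ltz_nat ?yL.
by rewrite (E x) // (E x') // e1 e2 /lpos ![(2 ^ L)%N%:Z * _]mulrC !modzMDl.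
Qed.

Lemma has_code_ex n1 n2 L z : (n1 <= 2 ^ L)%N -> (n2 <= 2 ^ L)%N -> tiling z ->
  exists c : tcode n1 n2 L, has_code z c.
Proof.
move=> n1L n2L tz; have [a [b [g [ab ph _ _ _]]]] := tiling_tower tz.
have [A EA] := modz_ord (a L) (expn_gt0 2 L.+1).
have [B EB] := modz_ord (b L) (expn_gt0 2 L.+1).
pose exc (x y : nat) := [/\ (x < n1)%N, (y < n2)%N, exists i, x%:Z = lpos L (a L) i
   & exists j, y%:Z = lpos L (b L) j].
have [e He] : exists e, forall x y : nat, exc x y -> full_rule z e x y.
  have [[x [y [x1 y1 [i xi] [j yj]]]]|no] := pselect (exists x y, exc x y).
    have [e fe] := full_rule_ex x%:Z y%:Z tz; exists e => x' y' [x1' y1' [i' xi'] [j' yj']].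
    have -> : x' = x.
      by apply: (lpos_small _ _ xi' xi); [exact: leq_trans x1' n1L|exact: leq_trans x1 n1L].
    have -> : y' = y.
      by apply: (lpos_small _ _ yj' yj); [exact: leq_trans y1' n2L|exact: leq_trans y1 n2L].
    exact: fe.
  by exists Eq => x y xy; case: no; exists x, y.
exists (A, B, ctype_ord e, [ffun i : 'I_n1 => z (i : nat)%:Z 0],
   [ffun j : 'I_n2 => z 0 (j : nat)%:Z]).
exists a, b; split=> //=.
  by move=> x y ? ? ? ?; rewrite ctype_ordK; apply: He.
by split=> i; rewrite ffunE.
Qed.

Lemma has_code_inj n1 n2 L z z' (c : tcode n1 n2 L) : tiling z -> tiling z' ->
  has_code z c -> has_code z' c ->
  forall x y : nat, (x < n1)%N -> (y < n2)%N -> z x%:Z y%:Z = z' x%:Z y%:Z.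
Proof.
move=> tz tz' [a [b [ab ph [cA cB] ex [rr cc]]]] [a' [b' [ab' ph' [cA' cB'] ex' [rr' cc']]]].
have aS l := (ab l).1; have bS l := (ab l).2.
have aS' l := (ab' l).1; have bS' l := (ab' l).2.
have ty (x y : nat) : (x < n1)%N -> (y < n2)%N ->
    exists e, full_rule z e x y /\ full_rule z' e x y.
  move=> xn yn; have [[l [i [j [lL xi yj o]]]]|[i [j [xi yj]]]] := lpos_two aS bS L x%:Z y%:Z.
    have [e fe] := full_rule_ex x%:Z y%:Z tz; have [e' fe'] := full_rule_ex x%:Z y%:Z tz'.
    exists e; split=> //; suff -> : e = e' by [].
    have [i' Ei mi] : exists2 i', lpos l (a l) i = lpos l (a' l) i' & (i %% 4 = i' %% 4)%Z.
      by apply: (lpos_mod4 _ aS aS' lL); rewrite cA cA'.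
    have [j' Ej mj] : exists2 i', lpos l (b l) j = lpos l (b' l) i' & (j %% 4 = i' %% 4)%Z.
      by apply: (lpos_mod4 _ bS bS' lL); rewrite cB cB'.
    apply: phase_inj o; first by apply: (ph l); rewrite -xi -yj; case: fe.
    apply: (@phase_mod _ i' j'); [by []|by []|].
    by apply: (ph' l); rewrite -Ei -Ej -xi -yj; case: fe'.
  exists (ord_ctype c.1.1.2); split; first by apply: ex => //; [exists i|exists j].
  apply: ex' => //.
    have : (a L = a' L %[mod (2 ^ L)%N%:Z])%Z.
      by apply: eqmod_half; rewrite cA cA'.
    move=> E; exists (i + ((a L - a' L)%R %/ (2 ^ L)%N%:Z)%Z).
    move/eqP: E; rewrite eqz_mod_dvd => /divzK E.
    by rewrite xi /lpos mulrDr [_ * (_ %/ _)%Z]mulrC E; ring.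
  have : (b L = b' L %[mod (2 ^ L)%N%:Z])%Z.
    by apply: eqmod_half; rewrite cB cB'.
  move=> E; exists (j + ((b L - b' L)%R %/ (2 ^ L)%N%:Z)%Z).
  move/eqP: E; rewrite eqz_mod_dvd => /divzK E.
  by rewrite yj /lpos mulrDr [_ * (_ %/ _)%Z]mulrC E; ring.
move=> x y; elim: y x => [|y IHy] x xn yn.
  by rewrite -(rr (Ordinal xn)) -(rr' (Ordinal xn)).
elim: x xn => [|x IHx] xn; first by rewrite -(cc (Ordinal yn)) -(cc' (Ordinal yn)).
have [e [f1 f1']] := ty x y.+1 (ltnW xn) yn.
have [e' [f2 f2']] := ty x.+1 y xn (ltnW yn).
have E1 := IHx (ltnW xn); have E2 := IHy x.+1 xn (ltnW yn).
have [H1 _] := full_rule_det f1 f1' E1; have [_ H2] := full_rule_det f2 f2' E2.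
have Ex : x%:Z + 1 = x.+1%:Z by rewrite intS addrC.
have Ey : y%:Z + 1 = y.+1%:Z by rewrite intS addrC.
rewrite Ex in H1; rewrite Ey in H2.
have [A1 B1 _ _ _ _ _] := tz x%:Z y.+1%:Z; have [A2 B2 _ _ _ _ _] := tz' x%:Z y.+1%:Z.
rewrite Ex in A1 B1 A2 B2.
have HA : ta (z x.+1%:Z y.+1%:Z) = ta (z' x.+1%:Z y.+1%:Z).
  by apply: val_inj; rewrite /= A1 A2 E1.
have HB : tb (z x.+1%:Z y.+1%:Z) = tb (z' x.+1%:Z y.+1%:Z) by rewrite B1 B2 E1.
move: H1 H2 HA HB; case: (z _ _) => [[[? ?] ?] ?]; case: (z' _ _) => [[[? ?] ?] ?].
by rewrite /th /tv /ta /tb /= => -> -> -> ->.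
Qed.
End Code.

Lemma card_mod_le n m (c : int) : (0 < m)%N ->
  (#|[set i : 'I_n | (((i : nat)%:Z - c) %% m%:Z == 0)%Z]%SET| <= n %/ m + 1)%N.
Proof.
move=> m0; have lt (i : 'I_n) : (i %/ m < n %/ m + 1)%N.
  by rewrite addn1 ltnS leq_div2r // ltnW.
rewrite -[X in (_ <= X)%N]card_ord.
rewrite -(@card_in_imset _ _ (fun i => Ordinal (lt i))); first exact: max_card.
move=> i j; rewrite !inE => ic jc /(congr1 val) /= E; apply/val_inj.
rewrite /= (divn_eq i m) (divn_eq j m) E; congr (_ + _)%N.
have : (((i : nat)%:Z - (j : nat)%:Z) %% m%:Z == 0)%Z.
  have -> : (i : nat)%:Z - (j : nat)%:Z = (i : nat)%:Z - c - ((j : nat)%:Z - c) by ring.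
  have /eqP ic' := ic; have /eqP jc' := jc.
  by rewrite -modzDm -modzNm ic' jc' oppr0 mod0z addr0 mod0z.
by move=> /eqP/dvdz_mod0P; rewrite -eqz_mod_dvd !modz_nat eqz_nat => /eqP.
Qed.

Lemma card_mod_ge n m (c : int) : (0 < m)%N ->
  (n %/ m <= #|[set i : 'I_n | (((i : nat)%:Z - c) %% m%:Z == 0)%Z]%SET|)%N.
Proof.
move=> m0; have [r Er] : exists r : 'I_m, (c %% m%:Z)%Z = (r : nat)%:Z.
  exact: modz_ord.
have lt (k : 'I_(n %/ m)) : (k * m + r < n)%N.
  apply: leq_trans (leq_trunc_div n m); apply: (@leq_trans (k.+1 * m)).
    by rewrite mulSn addnC ltn_add2r.
  by rewrite leq_mul2r ltn_ord orbT.
rewrite -[X in (X <= _)%N]card_ord -cardsT.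
rewrite -(@card_in_imset _ _ (fun k => Ordinal (lt k))).
  apply/fintype.subset_leq_card/fintype.subsetP => _ /imsetP[k _ ->]; rewrite inE /=.
  rewrite PoszD PoszM {1}(divz_eq c m%:Z) Er.
  rewrite (_ : _ - _ = ((k : nat)%:Z - (c %/ m%:Z)%Z) * m%:Z) ?modzMl //; ring.
move=> i j _ _ /(congr1 val) /= /addIn /eqP.
by rewrite eqn_mul2r gtn_eqF //= => /eqP /val_inj.
Qed.

(** The columns of level [l] form a progression of difference [2 ^ l.+1]. Those of level at least
    [L] are all counted, whether selected or not. *)
Lemma sel_count (S : tape_sys) (z : int -> int -> tile S) (sel : glob S -> bool)
    (a : nat -> int) (g : nat -> glob S) y n L :
  (forall l, shift_ok l (a l) (a l.+1)) ->
  (forall l p y, lg (vlam (tv (z (lpos l (a l) (2 * p + 1)) y))) = g l) ->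
  (#|[set i : 'I_n | sel (lg (vlam (tv (z (i : nat)%:Z y))))]%SET| <=
    \sum_(l < L) sel (g l) * (n %/ 2 ^ l.+1 + 1) + (n %/ 2 ^ L + 1))%N.
Proof.
move=> aS gl; pose s (i : 'I_n) := sel (lg (vlam (tv (z (i : nat)%:Z y)))).
pose at_ l (i : 'I_n) := exists p, (i : nat)%:Z = lpos l (a l) (2 * p + 1).
pose Q L := [set i : 'I_n | s i && `[<exists l, (l < L)%N /\ at_ l i>]]%SET.
have QL : (#|Q L| <= \sum_(l < L) sel (g l) * (n %/ 2 ^ l.+1 + 1))%N.
  elim: L => [|L IH].
    rewrite big_ord0 leqn0 cards_eq0; apply/eqP/setP => i; rewrite !inE.
    by apply/negP => /andP[_ /asboolP[l []]].
  rewrite big_ord_recr /=.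
  pose B := if sel (g L) then
    [set i : 'I_n | (((i : nat)%:Z - ((2 ^ L)%N%:Z + a L)) %% (2 ^ L.+1)%N%:Z == 0)%Z]%SET
    else finset.set0.
  apply: (@leq_trans #|Q L :|: B|).
    apply/fintype.subset_leq_card/fintype.subsetP => i; rewrite !inE => /andP[si /asboolP[l [lL [p ip]]]].
    move: lL; rewrite ltnS leq_eqVlt => /predU1P[E|lL].
      apply/orP; right; move: si; rewrite /s ip E gl /B => ->; rewrite inE ip E /lpos.
      have -> : (2 ^ L)%N%:Z * (2 * p + 1) + a L - ((2 ^ L)%N%:Z + a L) =
        p * (2 ^ L.+1)%N%:Z by rewrite expnS PoszM; ring.
      by rewrite modzMl.
    by apply/orP; left; rewrite si; apply/asboolP; exists l; split=> //; exists p.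
  rewrite (leq_trans (leq_card_setU _ _)) // leq_add // /B.
  case: (sel _); rewrite ?cards0 // mul1n card_mod_le // expn_gt0 //.
pose B := [set i : 'I_n | (((i : nat)%:Z - a L) %% (2 ^ L)%N%:Z == 0)%Z]%SET.
apply: (@leq_trans #|Q L :|: B|).
  apply/fintype.subset_leq_card/fintype.subsetP => i; rewrite !inE -/(s i) => si; rewrite si /=.
  have [[l [p [lL E]]]|[p E]] := lpos_odd_or aS L (i : nat)%:Z.
    by apply/orP; left; apply/asboolP; exists l; split=> //; exists p.
  by rewrite E /lpos addrK mulrC modzMl eqxx orbT.
rewrite (leq_trans (leq_card_setU _ _)) // leq_add // card_mod_le // expn_gt0 //.
Qed.

(** * Existence of tilings *)

Definition pw (k : nat) : int := (2 ^ k)%N%:Z.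
Lemma pw_neq0 k : pw k != 0. Proof. by rewrite eqz_nat -lt0n expn_gt0. Qed.
Lemma pw_gt0 k : 0 < pw k. Proof. by rewrite ltz_nat expn_gt0. Qed.
Lemma pwS k : pw k.+1 = 2 * pw k. Proof. by rewrite /pw expnS PoszM. Qed.
Lemma pwD k l : pw (k + l) = pw k * pw l. Proof. by rewrite /pw expnD PoszM. Qed.

Definition lev (i : int) : nat := logn 2 `|i|%N.

Lemma lev_spec i : i != 0 -> exists2 o, i = o * pw (lev i) & oddz o.
Proof.
move=> i0; have a0 : (0 < `|i|)%N by rewrite absz_gt0.
have [m cm E] := pfactor_coprime (isT : prime 2) a0.
exists (sgz i * m%:Z).
  by rewrite [LHS]intEsg -mulrA /pw /lev -PoszM -E.
rewrite coprime2n in cm; rewrite /oddz; move: i0 cm; case: sgzP => // _ _; clear; lia.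
Qed.

Lemma odd_not_dvd o k : oddz o -> ~~ (pw k.+1 %| o * pw k)%Z.
Proof.
rewrite pwS dvdz_mul2r ?pw_neq0 // /oddz => od; apply/negP => /dvdz_mod0P.
by move: od; clear; lia.
Qed.

Lemma not_dvd_pw o k m : oddz o -> (k < m)%N -> ~~ (pw m %| o * pw k)%Z.
Proof.
move=> od km; apply: contra (odd_not_dvd k od) => d.
by apply: dvdz_trans d; rewrite -(subnKC km) pwD dvdz_mulr.
Qed.

Lemma lev_uniq i o k : i = o * pw k -> oddz o -> i != 0 /\ lev i = k.
Proof.
move=> E od; have o0 : o != 0 by apply: contraL od => /eqP ->.
have i0 : i != 0 by rewrite E mulf_neq0 // pw_neq0.
split=> //; have [c E' od'] := lev_spec i0.
case: (ltngtP (lev i) k) => // lt.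
  by have := not_dvd_pw od' lt; rewrite -E' E dvdz_mull.
by have := not_dvd_pw od lt; rewrite -E [X in (_ %| X)%Z]E' dvdz_mull.
Qed.

Definition dv (k : nat) (x : int) : int := (x %/ pw k)%Z.

Lemma dv_mul k e : dv k (e * pw k) = e.
Proof. by rewrite /dv mulzK // pw_neq0. Qed.

Lemma dv_mul_pred k e : dv k (e * pw k - 1) = e - 1.
Proof.
have -> : e * pw k - 1 = (e - 1) * pw k + (pw k - 1) by ring.
rewrite /dv divzMDl ?pw_neq0 // divz_small ?addr0 //.
by have := pw_gt0 k; move: (pw k) => p; lia.
Qed.

Lemma dv_pred k x : ~~ (pw k %| x)%Z -> dv k (x - 1) = dv k x.
Proof.
move=> nd; rewrite /dv {1}(divz_eq x (pw k)) -addrA divzMDl ?pw_neq0 //.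
rewrite [X in _ + X]divz_small ?addr0 //.
have := modz_ge0 x (pw_neq0 k); have := ltz_pmod x (pw_gt0 k).
have : (x %% pw k)%Z != 0 by apply: contra nd => /eqP d; apply/dvdz_mod0P.
by move: (x %% pw k)%Z (pw k) => a b; lia.
Qed.

(** The columns of level [k] are the [(2 p + 1) 2 ^ k]; this is the number [p] of the last one that
    does not exceed [x]. *)
Definition pidx (k : nat) (x : int) : int := ((dv k x - 1) %/ 2)%Z.

Definition m4 (x : int) : 'I_4 := inord `|(x %% 4)%Z|%N.

Lemma m4E x : (m4 x : nat)%:Z = (x %% 4)%Z.
Proof. by rewrite /m4 inordK; lia. Qed.

Lemma m4_nat x (k : nat) : (x %% 4)%Z = k%:Z -> m4 x = k :> nat.
Proof. by move=> E; apply/eqP; rewrite -eqz_nat m4E E. Qed.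

Lemma m4S x : (m4 (x + 1)%R = (m4 x).+1 %% 4 :> nat)%N.
Proof.
by apply/eqP; rewrite -eqz_nat m4E; have := m4E x; move: (m4 x : nat); lia.
Qed.

Lemma adv4_m4 x y (k : nat) : (x %% 4)%Z = k%:Z -> y = x + 1 -> adv4 (m4 x) (m4 y) k.
Proof. by move=> E ->; split; [exact: m4_nat|rewrite m4S (m4_nat E)]. Qed.

Section Exist.
Variable S : tape_sys.
Variables (g : nat -> glob S) (W : nat -> nat -> cell S).
Hypothesis g_ini : ts_ini (g 0%N).
Hypothesis g_stp : forall l, ts_stp (g l) (g l.+1).
Hypothesis W_bord : forall l, ts_bord (g l) (W l 0%N).
Hypothesis W_adj : forall l r, ts_adj (g l) (W l r) (W l r.+1).
Hypothesis W_nxt : forall l r, ts_nxt (W l r) (W l.+1 r).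
Hypothesis W_ini : forall r, ts_ini0 (W 0%N r).

Local Notation N k := (pw k.+1).

Definition labf (k : nat) (p : int) : lab S :=
  Lab (p %% N k == 0)%Z (m4 (p %/ N k)%Z) (g k) (W k `|(p %% N k)%Z|%N).

(** The bottom edge of the cell [(i, j)] summarises the rows up to [j - 1], whence the argument
    [j - 1]. Column 0 has infinite level: it meets only [Go] and may carry any constant. *)
Definition vc (i j : int) : vcol S :=
  if i == 0 then Vcol false ord0 (labf 0 0) false false false else
  let k := lev i in let p := pidx k i in
  Vcol (dv k i %% 4 == 3)%Z (m4 (dv k (j - 1))) (labf k p)
    ((p - pidx k (j - 1)) %% N k == 0)%Z
    ((0 < k)%N && oddz (dv k.-1 (j - 1)))
    ((0 < k)%N && ((p %% N k)%Z == (pidx k.-1 (j - 1) %% N k.-1)%Z)).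

(** Row 0 has infinite level and meets only [Lo], except at the origin, which is given the type
    [Go]. The latter moves the clock from 3 to 0 and lowers the guard, whence the change of values
    after [i = 0]. *)
Definition hc (i j : int) : hcol S :=
  if j == 0 then Hcol false (if i <= 0 then inord 3 else ord0)
    (labf 0 0) (labf 0 0) false false false (i <= 0) else
  let k := lev j in let q := pidx k j in let p := pidx k (i - 1) in
  Hcol (dv k j %% 4 == 3)%Z (m4 (dv k (i - 1))) (labf k q) (labf k p)
    ((p - (q - 1)) %% N k == 0)%Z ((q %% N k)%Z <= (p %% N k)%Z)
    ((pidx k.+1 (i - 1) %% N k.+1)%Z == ((q - 1) %% N k)%Z)
    ((0 < k)%N && oddz (dv k.-1 (i - 1))).

Lemma modz_pred a n : 0 < n ->
  ((a - 1) %% n)%Z = if (a %% n == 0)%Z then n - 1 else (a %% n)%Z - 1.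
Proof.
move=> n0; have nn : n != 0 by rewrite gt_eqF.
have r0 := modz_ge0 a nn; have r1 := ltz_pmod a n0.
rewrite {1}(divz_eq a n); case: ifPn => [/eqP ->|r2].
  have -> : (a %/ n)%Z * n + 0 - 1 = ((a %/ n)%Z - 1) * n + (n - 1) by ring.
  by rewrite modzMDl modz_small //; move: n0; clear; lia.
rewrite -addrA modzMDl modz_small //.
by move: r0 r1 r2; move: (a %% n)%Z; clear; lia.
Qed.

Lemma eqmod_sub a b n : ((a - b) %% n == 0)%Z = ((a %% n)%Z == (b %% n)%Z).
Proof. by rewrite eqz_mod_dvd; apply/eqP/idP => /dvdz_mod0P. Qed.

Lemma nb_labf k p : nb (labf k (p - 1)) (labf k p).
Proof.
split=> //=; have n0 := pw_gt0 k.+1; have nn := pw_neq0 k.+1.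
case: ifPn => [/eqP z|z]; rewrite /labf /=.
  split; last by rewrite z; apply: W_bord.
  have -> : (p %/ N k)%Z = ((p - 1) %/ N k)%Z + 1; last exact: m4S.
  have E : p = (p %/ N k)%Z * N k by rewrite {1}(divz_eq p (N k)) z addr0.
  rewrite {2}E (_ : _ - 1 = ((p %/ N k)%Z - 1) * N k + (N k - 1)); last by ring.
  rewrite divzMDl // [X in _ + X + 1]divz_small; first by ring.
  by move: n0; move: (N k); clear; lia.
have r0 := modz_ge0 p nn; have r1 := ltz_pmod p n0.
have E : (p - 1) = (p %/ N k)%Z * N k + ((p %% N k)%Z - 1).
  by rewrite {1}(divz_eq p (N k)); ring.
have sm : 0 <= (p %% N k)%Z - 1 < N k.
  by move: r0 r1 z; move: (p %% N k)%Z; clear; lia.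
split.
  congr m4; rewrite E divzMDl // [X in _ = _ + X]divz_small ?addr0 //.
rewrite E modzMDl modz_small //.
have -> : `|(p %% N k)%Z|%N = `|((p %% N k)%Z - 1)%R|%N.+1; last exact: W_adj.
by move: sm; move: (p %% N k)%Z; clear; lia.
Qed.

Lemma half_odd e : oddz e -> ((e - 1) %/ 2)%Z * 2 = e - 1 /\
  ((e - 1 - 1) %/ 2)%Z = ((e - 1) %/ 2)%Z - 1.
Proof. by rewrite /oddz; split; lia. Qed.

(** The quotients by [2 ^ k] of [j - 1] and [j] differ only when [2 ^ k] divides [j]; this lemma
    treats that case and [col_off] the other one. *)
Lemma col_on i j (k := lev i) e : i != 0 -> j = e * pw k ->
  [/\ adv4 (vt (vc i j)) (vt (vc i (j + 1))) `|((e - 1) %% 4)%Z|%N,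
      (0 < k)%N -> vg (vc i j) /\ ~~ vg (vc i (j + 1)),
      k = 0%N -> ~~ vg (vc i (j + 1)),
      vd2 (vc i (j + 1)) = vd2 (vc i j) &
      ~~ oddz e -> vd1 (vc i (j + 1)) = vd1 (vc i j)].
Proof.
move=> i0 jE; rewrite /vc (negPf i0) -/k /= addrK.
have F : dv k j = e by rewrite jE dv_mul.
have Fp : dv k (j - 1) = e - 1 by rewrite jE dv_mul_pred.
have ee k' : k = k'.+1 -> dv k' j = 2 * e /\ dv k' (j - 1) = 2 * e - 1.
  move=> kE; have -> : j = 2 * e * pw k' by rewrite jE kE pwS; ring.
  by rewrite dv_mul dv_mul_pred.
split.
- by rewrite F Fp; apply: adv4_m4; [clear; lia|rewrite subrK].
- by case kE : k ee => [//|k'] /(_ _ erefl) [F1 F2] _ /=; rewrite F1 F2 /oddz; clear; lia.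
- by move=> ->.
- case kE : k ee => [//|k'] /(_ _ erefl) [F1 F2] /=; rewrite /pidx F1 F2.
  by congr (_ == (_ %% _)%Z); clear; lia.
- move=> ne; rewrite /pidx F Fp.
  have -> // : ((e - 1) %/ 2)%Z = ((e - 1 - 1) %/ 2)%Z.
  by move: ne; rewrite /oddz; clear; lia.
Qed.

Lemma col_off i j (k := lev i) : i != 0 -> ~~ (pw k %| j)%Z ->
  colpass (vc i j) (vc i (j + 1)) /\
  (~~ (pw k.-1 %| j)%Z -> vg (vc i (j + 1)) = vg (vc i j) /\
     vd2 (vc i (j + 1)) = vd2 (vc i j)).
Proof.
move=> i0 nd; rewrite /vc (negPf i0) -/k /= addrK.
split; first by rewrite /colpass /= /pidx dv_pred.
by move=> nd'; rewrite /= /pidx dv_pred.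
Qed.

Lemma row_on i j (k := lev j) e : j != 0 -> i = e * pw k ->
  [/\ adv4 (ht (hc i j)) (ht (hc (i + 1) j)) `|((e - 1) %% 4)%Z|%N,
      (0 < k)%N -> hg (hc i j) /\ ~~ hg (hc (i + 1) j),
      k = 0%N -> ~~ hg (hc (i + 1) j),
      ((e %% 4 != 2)%Z -> hu2 (hc (i + 1) j) = hu2 (hc i j)) &
      ~~ oddz e -> rowpass (hc i j) (hc (i + 1) j)].
Proof.
move=> j0 iE; rewrite /hc (negPf j0) -/k /= addrK.
have F : dv k i = e by rewrite iE dv_mul.
have Fp : dv k (i - 1) = e - 1 by rewrite iE dv_mul_pred.
have ee k' : k = k'.+1 -> dv k' i = 2 * e /\ dv k' (i - 1) = 2 * e - 1.
  move=> kE; have -> : i = 2 * e * pw k' by rewrite iE kE pwS; ring.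
  by rewrite dv_mul dv_mul_pred.
split.
- by rewrite F Fp; apply: adv4_m4; [clear; lia|rewrite subrK].
- by case kE : k ee => [//|k'] /(_ _ erefl) [F1 F2] _ /=; rewrite F1 F2 /oddz; clear; lia.
- by move=> ->.
- move=> e2; rewrite /pidx; have [od|ne] := boolP (oddz e).
    by rewrite [dv _ (i - 1)]dv_pred // iE odd_not_dvd.
  have iE' : i = (e %/ 2)%Z * pw k.+1.
    have ee2 : e = (e %/ 2)%Z * 2 by move: ne; rewrite /oddz; clear; lia.
    by rewrite iE pwS {1}ee2; ring.
  rewrite iE' dv_mul dv_mul_pred; congr ((_ %% _)%Z == _).
  by move: ne e2; rewrite /oddz; clear; lia.
- move=> ne; rewrite /rowpass /= /pidx F Fp.
  have -> // : ((e - 1) %/ 2)%Z = ((e - 1 - 1) %/ 2)%Z.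
  by move: ne; rewrite /oddz; clear; lia.
Qed.

Lemma row_off i j (k := lev j) : j != 0 -> ~~ (pw k %| i)%Z ->
  [/\ rowpass (hc i j) (hc (i + 1) j), ht (hc (i + 1) j) = ht (hc i j),
      hu2 (hc (i + 1) j) = hu2 (hc i j) &
   ~~ (pw k.-1 %| i)%Z -> hg (hc (i + 1) j) = hg (hc i j)].
Proof.
move=> j0 nd; rewrite /hc (negPf j0) -/k /= addrK.
have nd' : ~~ (pw k.+1 %| i)%Z.
  by apply: contra nd => d; apply: dvdz_trans d; rewrite pwS dvdz_mull.
split; rewrite ?/rowpass /= /pidx ?(dv_pred nd) ?(dv_pred nd') //.
by move=> nd2; rewrite dv_pred.
Qed.

End Exist.

Section Exist2.
Variable S : tape_sys.
Variables (g : nat -> glob S) (W : nat -> nat -> cell S).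
Hypothesis g_ini : ts_ini (g 0%N).
Hypothesis g_stp : forall l, ts_stp (g l) (g l.+1).
Hypothesis W_bord : forall l, ts_bord (g l) (W l 0%N).
Hypothesis W_adj : forall l r, ts_adj (g l) (W l r) (W l r.+1).
Hypothesis W_nxt : forall l r, ts_nxt (W l r) (W l.+1 r).
Hypothesis W_ini : forall r, ts_ini0 (W 0%N r).
Local Notation N k := (pw k.+1).
Local Notation vc := (vc g W).
Local Notation hc := (hc g W).
Local Notation labf := (labf g W).

Lemma oddz_lev i : i != 0 -> oddz i = (lev i == 0%N).
Proof.
move=> i0; have [c E od] := lev_spec i0; rewrite {1}E.
case: (lev i) => [|k]; first by rewrite /pw mulr1 od.
by rewrite pwS mulrCA /oddz; move: (c * _); clear; lia.
Qed.

Definition strong (e : ctype) (v : vcol S) (h' : hcol S) (v' : vcol S) : Prop :=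
  match e with
  | Eq => [/\ ~~ vg v', vd2 v' = vd2 v & ~~ hg h']
  | Gi | Go => ~~ hg h'
  | Li | Lo => ~~ vg v' /\ vd2 v' = vd2 v
  end.

Definition cell_ok (i j : int) : Prop := exists2 e, phase e i j &
  rule e (oddz i) (oddz j) (hc i j) (vc i j) (hc (i + 1) j) (vc i (j + 1)) /\
  strong e (vc i j) (hc (i + 1) j) (vc i (j + 1)).

Lemma rule_const i j :
  [/\ vlam (vc i (j + 1)) = vlam (vc i j), vsg (vc i (j + 1)) = vsg (vc i j),
      hmu (hc (i + 1) j) = hmu (hc i j) & htau (hc (i + 1) j) = htau (hc i j)].
Proof. by rewrite /vc /hc; case: (i == 0); case: (j == 0). Qed.

Lemma colev_on i j e (n : nat) : i != 0 -> j = e * pw (lev i) ->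
  ((e - 1) %% 4)%Z = n%:Z ->
  [/\ colev (oddz i) (vc i j) (vc i (j + 1)) n, ~~ vg (vc i (j + 1)),
   vd2 (vc i (j + 1)) = vd2 (vc i j) &
   ~~ oddz e -> vd1 (vc i (j + 1)) = vd1 (vc i j)].
Proof.
move=> i0 jE en; have [t gg g0 d2 d1] := col_on g W i0 jE.
have ng : ~~ vg (vc i (j + 1)).
  by case: (posnP (lev i)) => [/g0|/gg[]].
split=> //; split=> //; first by move: t; rewrite en absz_nat.
by rewrite oddz_lev // -lt0n => /gg[].
Qed.

Lemma rowev_on i j e (n : nat) : j != 0 -> i = e * pw (lev j) ->
  ((e - 1) %% 4)%Z = n%:Z ->
  [/\ rowev (oddz j) (hc i j) (hc (i + 1) j) n, ~~ hg (hc (i + 1) j),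
   (e %% 4 != 2)%Z -> hu2 (hc (i + 1) j) = hu2 (hc i j) &
   ~~ oddz e -> rowpass (hc i j) (hc (i + 1) j)].
Proof.
move=> j0 iE en; have [t gg g0 u2 rp] := row_on g W j0 iE.
have ng : ~~ hg (hc (i + 1) j).
  by case: (posnP (lev j)) => [/g0|/gg[]].
split=> //; split=> //; first by move: t; rewrite en absz_nat.
by rewrite oddz_lev // -lt0n => /gg[].
Qed.

Lemma phase_low e i j : ~~ oddz i -> ~~ oddz j -> phase e i j.
Proof. by rewrite /oddz => oi oj; split; move: oi oj; clear; lia. Qed.

Lemma cell_Eq i j : i != 0 -> j != 0 -> lev i = lev j -> cell_ok i j.
Proof.
move=> i0 j0 E; have [a ia oa] := lev_spec i0; have [b jb ob] := lev_spec j0.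
set k := lev i in ia E; rewrite -E in jb.
exists Eq.
  have oi := oddz_lev i0; have oj := oddz_lev j0; rewrite -/k in oi; rewrite -E -oi in oj.
  split=> // ii jj; exfalso; move: oj; rewrite /oddz; move: ii jj; clear; lia.
pose ta := (a %% 4 == 3)%Z; pose tb := (b %% 4 == 3)%Z.
have Fi : dv k i = a by rewrite ia dv_mul.
have Fi1 : dv k (i - 1) = a - 1 by rewrite ia dv_mul_pred.
have Fj : dv k j = b by rewrite jb dv_mul.
have Fj1 : dv k (j - 1) = b - 1 by rewrite jb dv_mul_pred.
have tE : htau (hc i j) = tb by rewrite /hc (negPf j0) /= -E Fj.
have sE : vsg (vc i j) = ta by rewrite /vc (negPf i0) /= -/k Fi.
have [ce cg cd _] : [/\ colev (oddz i) (vc i j) (vc i (j + 1)) (2 * tb),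
   ~~ vg (vc i (j + 1)), vd2 (vc i (j + 1)) = vd2 (vc i j) &
   ~~ oddz b -> vd1 (vc i (j + 1)) = vd1 (vc i j)].
  by apply: colev_on => //; move: ob; rewrite /oddz /tb; clear; lia.
have [re rg ru _] : [/\ rowev (oddz j) (hc i j) (hc (i + 1) j) (2 * ta),
   ~~ hg (hc (i + 1) j), (a %% 4 != 2)%Z -> hu2 (hc (i + 1) j) = hu2 (hc i j) &
   ~~ oddz a -> rowpass (hc i j) (hc (i + 1) j)].
  by apply: rowev_on; rewrite -?E //; move: oa; rewrite /oddz /ta; clear; lia.
split; last by [].
have [c1 c2 c3 c4] := rule_const i j.
split=> //; split; rewrite ?tE ?sE //.
have [p2 p1] := half_odd oa; have [q2 q1] := half_odd ob.
set p := ((a - 1) %/ 2)%Z in p2 p1; set q := ((b - 1) %/ 2)%Z in q2 q1.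
have n0 := pw_gt0 k.+1; have nn := pw_neq0 k.+1.
have L : vlam (vc i j) = labf k p by rewrite /vc (negPf i0) /= -/k /pidx Fi.
have K : hkap (hc i j) = labf k (p - 1) by rewrite /hc (negPf j0) /= -E /pidx Fi1 p1.
have U : hu1 (hc i j) = ((p - q) %% N k == 0)%Z.
  rewrite /hc (negPf j0) /= -E /pidx Fi1 Fj p1 -/q.
  by rewrite (_ : p - 1 - (q - 1) = p - q) //; ring.
split.
- by rewrite L /hc (negPf j0) /= -E addrK /pidx Fi.
- by rewrite K L; apply: nb_labf.
- rewrite L sE /= /ta => /eqP z; apply/negP => /eqP a3.
  have [c pc] : exists c, p = c * (2 * pw k).
    by exists (p %/ N k)%Z; rewrite -pwS {1}(divz_eq p (N k)) z addr0.
  move: p2; rewrite pc mulrCA; move: (c * pw k) => m.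
  by move: a3; clear; lia.
- by rewrite U /vc (negPf i0) /= -/k addrK /pidx Fi Fj -/p -/q.
- rewrite /vc /hc (negPf i0) (negPf j0) /= -/k -E addrK /pidx Fi Fj Fj1 -/p -/q.
  by rewrite q1.
- rewrite L U /hc (negPf j0) /= -E addrK /pidx Fi Fi1 Fj -/p -/q p1.
  rewrite eqmod_sub modz_pred //.
  have := modz_ge0 p nn; have := ltz_pmod p n0; have := modz_ge0 q nn.
  move: (p %% N k)%Z (q %% N k)%Z (N k) => x y m.
  by case: ifPn => /=; clear; lia.
- rewrite L /= /hc (negPf j0) /= -E /pidx Fi1 p1 Fj -/q modz_pred // => ->.
  by have := ltz_pmod q n0; move: (q %% N k)%Z (N k) => x y; clear; lia.
- rewrite U L /hc (negPf j0) /= -E /pidx Fj -/q eqmod_sub => /eqP pq.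
  by rewrite pq.
- by apply: ru; move: oa; rewrite /oddz; clear; lia.
Qed.

(** With [m] the level of the row and [i = f * 2 ^ m.+1], the type is [Gi] or [Go] according to the
    parity of [f]: it is [Gi] exactly when the two levels are consecutive. *)
Lemma cell_G i j : j != 0 -> (i == 0) || (lev j < lev i)%N -> cell_ok i j.
Proof.
move=> j0 lt; have [b jb ob] := lev_spec j0; set m := lev j in lt jb.
have [f iE] : exists f, i = f * pw m.+1.
  case/predU1P: lt => [->|lt]; first by exists 0; rewrite mul0r.
  have [i0|i0] := eqVneq i 0; first by rewrite i0; exists 0; rewrite mul0r.
  have [a ia _] := lev_spec i0; exists (a * pw (lev i - m.+1)).
  by rewrite -mulrA -pwD subnK.
have iE2 : i = 2 * f * pw m by rewrite iE pwS; ring.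
have oi : ~~ oddz i by rewrite iE pwS mulrCA /oddz; move: (f * _); clear; lia.
have Fj : dv m j = b by rewrite jb dv_mul.
have [c1 c2 c3 c4] := rule_const i j.
have o2 : ~~ oddz (2 * f) by rewrite /oddz; clear; lia.
have cp : colpass (vc i j) (vc i (j + 1)).
  have [i0|i0] := eqVneq i 0; first by rewrite /vc i0.
  rewrite (negPf i0) /= in lt.
  by have [] := col_off g W i0 (_ : ~~ (pw (lev i) %| j)%Z); rewrite // jb not_dvd_pw.
have ojm : oddz j = (m == 0%N) by rewrite oddz_lev.
have i4 : m = 0%N -> i = 2 * f by rewrite iE2 => ->; rewrite mulr1.
have [of_|ef] := boolP (oddz f).
  have [i0 li] := lev_uniq iE of_.
  exists Gi.
    have [oj|oj] := boolP (oddz j); last exact: phase_low.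
    move: oj; rewrite ojm => /eqP/i4 {}iE; split=> ii jj //; exfalso;
      move: oi ii of_; rewrite iE /oddz; clear; lia.
  have [re rg _ /(_ o2) rp] : [/\ rowev (oddz j) (hc i j) (hc (i + 1) j) 1,
     ~~ hg (hc (i + 1) j), (2 * f %% 4 != 2)%Z -> hu2 (hc (i + 1) j) = hu2 (hc i j) &
     ~~ oddz (2 * f) -> rowpass (hc i j) (hc (i + 1) j)].
    by apply: rowev_on => //; move: of_; rewrite /oddz; clear; lia.
  split; last by [].
  split=> //; split=> //.
  have [p2 p1] := half_odd of_; have [q2 q1] := half_odd ob.
  set p := ((f - 1) %/ 2)%Z in p2 p1; set q := ((b - 1) %/ 2)%Z in q2 q1.
  have Fi : dv m.+1 i = f by rewrite iE dv_mul.
  have Fi1 : dv m.+1 (i - 1) = f - 1 by rewrite iE dv_mul_pred.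
  have Fi0 : dv m (i - 1) = 2 * f - 1 by rewrite iE2 dv_mul_pred.
  have Fj1 : dv m (j - 1) = b - 1 by rewrite jb dv_mul_pred.
  have L : vlam (vc i j) = labf m.+1 p by rewrite /vc (negPf i0) /= li /pidx Fi.
  have K : hkap (hc i j) = labf m (2 * p).
    rewrite /hc (negPf j0) /= -/m /pidx Fi0; congr labf.
    by move: p2; clear; lia.
  have M : hmu (hc i j) = labf m q by rewrite /hc (negPf j0) /= -/m /pidx Fj.
  have D' : vd2 (vc i (j + 1)) = ((p %% N m.+1)%Z == (q %% N m)%Z).
    by rewrite /vc (negPf i0) /= li addrK /= /pidx Fi Fj -/p -/q.
  have n0 := pw_gt0 m.+1; have nn := pw_neq0 m.+1.
  have n1 := pw_gt0 m.+2; have nn1 := pw_neq0 m.+2.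
  split.
  - rewrite /vc (negPf i0) /= li /= Fj1; move: ob; rewrite /oddz; clear; lia.
  - by rewrite /vc (negPf i0) /= li /= addrK Fj.
  - rewrite L K /labf /=.
    have -> : N m = 2 * pw m by rewrite pwS.
    have -> : N m.+1 = 2 * (2 * pw m) by rewrite !pwS.
    have w0 := pw_gt0 m; have wn := pw_neq0 m.
    have -> : (2 * p %% (2 * pw m))%Z = 2 * (p %% pw m)%Z by rewrite -mulz_modr.
    have -> : (2 * p %/ (2 * pw m))%Z = (p %/ pw m)%Z by rewrite divzMpl.
    have := m4E (p %/ pw m)%Z; move: (m4 _ : nat) => t tE.
    have -> : (t == 0%N) = ((p %/ pw m)%Z %% 4 == 0)%Z by rewrite -tE eqz_nat.
    rewrite mulrA -[2 * 2]/(4 : int); apply/eqP/andP => [z|[/eqP z /eqP z4]].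
      have E : p = (p %/ (4 * pw m))%Z * 4 * pw m + 0.
        by rewrite {1}(divz_eq p (4 * pw m)) z; ring.
      rewrite E modzMDl divzMDl // mod0z div0z mulr0 addr0 modzMl; by split.
    have zz : (p %% pw m)%Z = 0 by move: z; move: (p %% pw m)%Z; clear; lia.
    have E : p = ((p %/ pw m)%Z %/ 4)%Z * (4 * pw m).
      rewrite {1}(divz_eq p (pw m)) zz addr0 {1}(divz_eq (p %/ pw m)%Z 4) z4 addr0.
      by ring.
    by rewrite E modzMl.
  - by rewrite K L /=; apply: g_stp.
  - rewrite D' M L /= /hc (negPf j0) /= -/m /pidx Fi1 Fj p1 -/q.
    rewrite (modz_pred p n1) (modz_pred q n0).
    have := modz_ge0 p nn1; have := ltz_pmod p n1; have := modz_ge0 q nn.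
    have := ltz_pmod q n0; have : N m.+1 = 2 * N m by rewrite pwS.
    move: (p %% N m.+1)%Z (q %% N m)%Z => x y; move: (N m.+1) (N m) => u w.
    by case: (x =P 0); case: (y =P 0) => /=; clear; lia.
  - rewrite /hc /vc (negPf i0) (negPf j0) /= li -/m addrK /= /pidx Fi Fj Fj1 -/p.
    by rewrite q1 -/q.
  - rewrite D' M L /= => /eqP ->; exact: W_nxt.
exists Go.
  have [oj|oj] := boolP (oddz j); last exact: phase_low.
  move: oj; rewrite ojm => /eqP/i4 {}iE; split=> ii jj //; exfalso;
      move: oi ii ef; rewrite iE /oddz; clear; lia.
have [re rg ru /(_ o2) rp] : [/\ rowev (oddz j) (hc i j) (hc (i + 1) j) 3,
   ~~ hg (hc (i + 1) j), (2 * f %% 4 != 2)%Z -> hu2 (hc (i + 1) j) = hu2 (hc i j) &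
   ~~ oddz (2 * f) -> rowpass (hc i j) (hc (i + 1) j)].
  by apply: rowev_on => //; move: ef; rewrite /oddz; clear; lia.
split; last by [].
split=> //; split=> //.
  by apply: ru; move: ef; rewrite /oddz; clear; lia.
have [i0|i0] := eqVneq i 0; first by rewrite /vc i0.
rewrite (negPf i0) /= in lt.
have nd : ~~ (pw (lev i) %| j)%Z by rewrite jb not_dvd_pw.
have [_] := col_off g W i0 nd; apply; rewrite jb not_dvd_pw //.
suff : (m.+1 < lev i)%N by case: (lev i).
rewrite ltn_neqAle lt andbT.
apply: contra ef => /eqP E; have [a ia oa] := lev_spec i0.
have : f * pw m.+1 = a * pw m.+1 by rewrite -iE E.
by move/(mulIf (pw_neq0 _)) ->.
Qed.

Lemma cell_L i j : i != 0 -> (j == 0) || (lev i < lev j)%N -> cell_ok i j.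
Proof.
move=> i0 lt; have [b ib ob] := lev_spec i0; set m := lev i in lt ib.
have [f jE] : exists f, j = f * pw m.+1.
  case/predU1P: lt => [->|lt]; first by exists 0; rewrite mul0r.
  have [j0|j0] := eqVneq j 0; first by rewrite j0; exists 0; rewrite mul0r.
  have [a ja _] := lev_spec j0; exists (a * pw (lev j - m.+1)).
  by rewrite -mulrA -pwD subnK.
have jE2 : j = 2 * f * pw m by rewrite jE pwS; ring.
have oj : ~~ oddz j by rewrite jE pwS mulrCA /oddz; move: (f * _); clear; lia.
have [c1 c2 c3 c4] := rule_const i j.
have o2 : ~~ oddz (2 * f) by rewrite /oddz; clear; lia.
have oim : oddz i = (m == 0%N) by rewrite oddz_lev.
have j4 : m = 0%N -> j = 2 * f by rewrite jE2 => ->; rewrite mulr1.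
have [rp rt ru] : [/\ rowpass (hc i j) (hc (i + 1) j), ht (hc (i + 1) j) = ht (hc i j)
    & hu2 (hc (i + 1) j) = hu2 (hc i j)].
  have [j0|j0] := eqVneq j 0.
    have := i0; rewrite /hc j0 /= => i0'.
    by have -> : (i + 1 <= 0) = (i <= 0) by move: i0'; clear; lia.
  rewrite (negPf j0) /= in lt.
  by have [] := row_off g W j0 (_ : ~~ (pw (lev j) %| i)%Z); rewrite // ib not_dvd_pw.
have [of_|ef] := boolP (oddz f).
  have [j0 lj] := lev_uniq jE of_.
  exists Li.
    have [oi|oi] := boolP (oddz i); last exact: phase_low.
    move: oi; rewrite oim => /eqP/j4 {}jE; split=> ii jj //; exfalso;
      move: oj jj of_; rewrite jE /oddz; clear; lia.
  have [ce cg cd /(_ o2) cd1] : [/\ colev (oddz i) (vc i j) (vc i (j + 1)) 1,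
    ~~ vg (vc i (j + 1)), vd2 (vc i (j + 1)) = vd2 (vc i j) &
    ~~ oddz (2 * f) -> vd1 (vc i (j + 1)) = vd1 (vc i j)].
    by apply: colev_on => //; move: of_; rewrite /oddz; clear; lia.
  split; last by [].
  have Fi : dv m i = b by rewrite ib dv_mul.
  have Fi1 : dv m (i - 1) = b - 1 by rewrite ib dv_mul_pred.
  split=> //; split=> //; split=> //; rewrite /hc (negPf j0) /= lj /= ?addrK ?Fi ?Fi1 //.
  by move: ob; rewrite /oddz; clear; lia.
exists Lo.
  have [oi|oi] := boolP (oddz i); last exact: phase_low.
  move: oi; rewrite oim => /eqP/j4 {}jE; split=> ii jj //; exfalso;
      move: oj jj ef; rewrite jE /oddz; clear; lia.
have [ce cg cd /(_ o2) cd1] : [/\ colev (oddz i) (vc i j) (vc i (j + 1)) 3,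
  ~~ vg (vc i (j + 1)), vd2 (vc i (j + 1)) = vd2 (vc i j) &
  ~~ oddz (2 * f) -> vd1 (vc i (j + 1)) = vd1 (vc i j)].
  by apply: colev_on => //; move: ef; rewrite /oddz; clear; lia.
split; last by [].
split=> //; split=> //; split=> //.
have [j0|j0] := eqVneq j 0.
  have := i0; rewrite /hc j0 /= => i0'.
  by have -> : (i + 1 <= 0) = (i <= 0) by move: i0'; clear; lia.
rewrite (negPf j0) /= in lt.
have nd : ~~ (pw (lev j) %| i)%Z by rewrite ib not_dvd_pw.
have [_ _ _] := row_off g W j0 nd; apply; rewrite ib not_dvd_pw //.
suff : (m.+1 < lev j)%N by case: (lev j).
rewrite ltn_neqAle lt andbT.
apply: contra ef => /eqP E; have [a ja oa] := lev_spec j0.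
have : f * pw m.+1 = a * pw m.+1 by rewrite -jE E.
by move/(mulIf (pw_neq0 _)) ->.
Qed.

Lemma cell_0 : cell_ok 0 0.
Proof.
exists Go; first exact: phase_low.
by rewrite /hc /vc /=; do !split => //=; rewrite inordK.
Qed.

Definition zc (i j : int) : tile S := (hc i j, vc i j, m4 i, m4 j).

Lemma zc_tiling : tiling zc.
Proof.
move=> i j; split=> //=.
- exact: m4S.
- exact: m4S.
- have [e ph R] : cell_ok i j.
    have [->|j0] := eqVneq j 0.
      have [->|i0] := eqVneq i 0; first exact: cell_0.
      by apply: cell_L => //; rewrite eqxx.
    have [->|i0] := eqVneq i 0; first by apply: cell_G; rewrite ?eqxx.
    have [lt|lt|E] := ltngtP (lev i) (lev j).
    + by apply: cell_L; rewrite // lt orbT.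
    + by apply: cell_G; rewrite // lt orbT.
    + exact: cell_Eq.
  exists e; first by apply: phase_mod ph; rewrite m4E; clear; lia.
  have oE x : odd (m4 x) = oddz x.
    by have := m4E x; rewrite /oddz; move: (m4 x : nat); clear; lia.
  by rewrite /ta /tb /= !oE.
- rewrite /ta /tv /= => od.
  have oi : oddz i by have := m4E i; move: od; rewrite /oddz; move: (m4 i : nat); clear; lia.
  have i0 : i != 0 by apply: contraL oi => /eqP ->.
  have := oddz_lev i0; rewrite oi => /esym/eqP li.
  have d0 : dv 0 i = i by rewrite /dv divz1.
  have := m4E i; move: (m4 i : nat) => t tE.
  rewrite /vc (negPf i0) /= li d0 /pidx d0; split=> //.
  + by move: tE; clear; lia.
  + by move: tE oi; rewrite /oddz pwS /pw; clear; lia.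
- rewrite /tb /th /= => od.
  have oj : oddz j by have := m4E j; move: od; rewrite /oddz; move: (m4 j : nat); clear; lia.
  have j0 : j != 0 by apply: contraL oj => /eqP ->.
  have := oddz_lev j0; rewrite oj => /esym/eqP lj.
  have d0 : dv 0 j = j by rewrite /dv divz1.
  have := m4E j; move: (m4 j : nat) => t tE.
  by rewrite /hc (negPf j0) /= lj d0; move: tE; clear; lia.
Qed.

Lemma zc_count (sel : glob S -> bool) y n L :
  (\sum_(l < L) sel (g l) * (n %/ 2 ^ l.+1) <=
   #|[set i : 'I_n | sel (lg (vlam (tv (zc (i : nat)%:Z y))))]%SET|)%N.
Proof.
pose s (i : 'I_n) := sel (lg (vlam (tv (zc (i : nat)%:Z y)))).
pose Q L := [set i : 'I_n | [&& s i, (i : nat) != 0%N & (lev (i : nat)%:Z < L)%N]]%SET.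
apply: (@leq_trans #|Q L|); last first.
  by apply/fintype.subset_leq_card/fintype.subsetP => i; rewrite !inE => /andP[].
elim: L => [|L IH]; first by rewrite big_ord0.
rewrite big_ord_recr /=.
pose B := if sel (g L) then
    [set i : 'I_n | (((i : nat)%:Z - (2 ^ L)%N%:Z) %% (2 ^ L.+1)%N%:Z == 0)%Z]%SET
    else finset.set0.
have BP i : i \in B -> [/\ (i : nat)%:Z != 0, lev (i : nat)%:Z = L & sel (g L)].
  rewrite /B; case: ifP => [sg|_]; rewrite inE // => /eqP ii.
  have [c Ec] : exists c, (i : nat)%:Z - pw L = c * pw L.+1.
    by exists (((i : nat)%:Z - pw L) %/ pw L.+1)%Z; rewrite {1}(divz_eq (_ - _) (pw L.+1)) ii addr0.
  have [] // := @lev_uniq (i : nat)%:Z (2 * c + 1) L.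
    by rewrite -[LHS](subrK (pw L)) Ec pwS; ring.
  by rewrite /oddz; clear; lia.
apply: (@leq_trans #|Q L :|: B|).
  rewrite cardsU (_ : Q L :&: B = finset.set0) ?cards0 ?subn0; last first.
    apply/setP => i; rewrite !inE; apply/negP => /andP[/and3P[_ _ lt] /BP[_ E _]].
    by rewrite E ltnn in lt.
  rewrite leq_add // /B; case: (sel _); rewrite ?mul0n // mul1n.
  by rewrite card_mod_ge // expn_gt0.
apply/fintype.subset_leq_card/fintype.subsetP => i; rewrite inE => /orP[].
  by rewrite !inE => /and3P[-> -> lt]; rewrite ltnS (ltnW lt).
move=> /BP[i0 li sg]; rewrite !inE -eqz_nat i0 li ltnSn andbT.
by rewrite /s /zc /tv /= /vc (negPf i0) /= li sg.
Qed.
End Exist2.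

(** * Counter machines driven by a binary sequence *)

(* The second boolean argument of [m_nx] is the digit of the input sequence at the
   position held by the counter [m_cnt]. *)
Record machine := Machine {
  mQ : finType; mK : nat; m_init : mQ; m_cnt : mQ -> 'I_mK;
  m_op : mQ -> option bool; m_nx : mQ -> bool -> bool -> mQ; m_bad : pred mQ }.

Definition do_op (op : option bool) (c : nat) : nat :=
  match op with Some true => c.+1 | Some false => c.-1 | None => c end.

Definition mstep (M : machine) (b : nat -> bool) (s : mQ M * ('I_(mK M) -> nat)) :=
  let a := m_cnt s.1 in
  (m_nx s.1 (s.2 a == 0%N) (b (s.2 a)),
   fun c => if c == a then do_op (m_op s.1) (s.2 c) else s.2 c).

Definition mrun (M : machine) (b : nat -> bool) (n : nat) :=
  iter n (mstep b) (m_init M, fun=> 0%N).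

Definition never_bad (M : machine) (b : nat -> bool) : Prop :=
  forall n, ~~ m_bad (mrun M b n).1.

(** * Simulation of a machine by the tower of tapes *)

Section MachineTape.
Variable M : machine.
Local Notation C := (option 'I_(mK M)).

(* The additional counter [None] holds the time. *)
Definition opc (q : mQ M) (c : C) : option bool :=
  match c with
  | None => Some true
  | Some c' => if c' == m_cnt q then m_op q else None
  end.

(* A counter of value [n] is written in unary: [cx t c] holds in the cells of index
   [< n]; [cx'] is its value after the step and [cD] the input digit at the index. *)
Definition mglob := (mQ M * bool * bool * bool)%type.
Definition mcell := ({ffun C -> bool} * {ffun C -> bool} * bool)%type.
Implicit Types (g : mglob) (t : mcell).
Definition gq g := g.1.1.1.
Definition gdig g := g.1.1.2.
Definition gzero g := g.1.2.
Definition gread g := g.2.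
Definition gc g : C := Some (m_cnt (gq g)).
Definition cx t := t.1.1.
Definition cx' t := t.1.2.
Definition cD t := t.2.

(** An increment shifts the unary word by one cell to the right, the border cell being filled; a
    decrement shifts it to the left. The digit read by the machine lies in the first empty cell of
    its counter, and the new digit of the level in the first empty cell of the time. *)
Definition mbord g t : Prop :=
  [/\ ~~ m_bad (gq g), gzero g = ~~ cx t (gc g),
      ~~ cx t (gc g) -> cD t = gread g, ~~ cx t None -> cD t = gdig g &
      forall c, match opc (gq g) c return Prop with
        | Some true => cx' t c | Some false => True | None => cx' t c = cx t c end].

Definition madj g t1 t2 : Prop :=
  [/\ cx t1 (gc g) -> ~~ cx t2 (gc g) -> cD t2 = gread g,
      cx t1 None -> ~~ cx t2 None -> cD t2 = gdig g,
      forall c, cx t2 c -> cx t1 c, forall c, cx' t2 c -> cx' t1 c &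
      forall c, match opc (gq g) c return Prop with
        | Some true => cx' t2 c = cx t1 c | Some false => cx' t1 c = cx t2 c
        | None => cx' t2 c = cx t2 c end].

Definition mtape : tape_sys := @TapeSys mglob mcell
  (fun g => gq g = m_init M) (fun t => forall c, cx t c = false)
  mbord madj (fun t t' => cx t' = cx' t /\ cD t' = cD t)
  (fun g g' => gq g' = m_nx (gq g) (gzero g) (gread g)).

Definition counters (b : nat -> bool) (l : nat) (c : C) : nat :=
  match c with None => l | Some c' => (mrun M b l).2 c' end.

Lemma countersS b l c :
  counters b l.+1 c = do_op (opc (mrun M b l).1 c) (counters b l c).
Proof.
case: c => [c|//]; rewrite /counters /mrun iterS.
by move: (iter l _ _) => s; rewrite /mstep /=; case: eqP.
Qed.

Lemma counters_le b l c : (counters b l c <= l)%N.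
Proof.
elim: l => [|l IH]; first by case: c.
by rewrite countersS; case: (opc _ _) => [[]|] /=; lia.
Qed.

(** At time [l] the counters are at most [l], below the length [2 ^ l.+1] of the tape: unary words
    never overflow, and the digit that is read, of index at most [l], is already on the tape. The
    second half of a tape is not inherited, but it is empty because a unary word never starts
    again. *)
Lemma reach_machine (g : nat -> mglob) (b := fun l => gdig (g l)) :
  gq (g 0%N) = m_init M ->
  (forall l, gq (g l.+1) = m_nx (gq (g l)) (gzero (g l)) (gread (g l))) ->
  (forall l, exists w, @reach mtape g l w) -> never_bad M b.
Proof.
move=> g0 gS rw.
have Nl l : (l.+1 < 2 ^ l.+1)%N by apply: ltn_expl.
have key l : gq (g l) = (mrun M b l).1 /\ forall w, @reach mtape g l w ->
    (forall c r, (r < 2 ^ l.+1)%N -> cx (w r) c = (r < counters b l c)%N) /\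
    (forall r, (r < l)%N -> cD (w r) = b r).
  elim: l => [|l [IHq IHw]].
    by split=> // w [_ w0]; split=> // c r rN; rewrite w0 //; case: c.
  have loc w : @reach mtape g l w -> @locv mtape (g l) (2 ^ l.+1) w.
    by case: (l) => [|?] [].
  have dig w : @reach mtape g l w -> forall r, (r <= l)%N -> cD (w r) = b r.
    move=> Rw r; rewrite leq_eqVlt => /predU1P[->|]; last exact: (IHw w Rw).2.
    have [[_ _ _ d0 _] A] := loc w Rw; have [X _] := IHw w Rw.
    case: (l) (Nl l) X A d0 => [|k] lN X A d0; first by apply: d0; rewrite X.
    have k2 := ltnW lN; have [_ dA _ _ _] := A k k2; apply: dA.
      by rewrite (X _ _ (ltnW k2)) /=.
    by rewrite (X _ _ k2) /= ltnn.
  have [w0 Rw0] := rw l.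
  have [[nb0 z0 rd0 _ _] A] := loc w0 Rw0; have [X _] := IHw w0 Rw0.
  have zE : gzero (g l) = (counters b l (gc (g l)) == 0%N).
    by rewrite z0 X ?expn_gt0 // -eqn0Ngt.
  have rE : gread (g l) = b (counters b l (gc (g l))).
    have := counters_le b l (gc (g l)); case E : (counters _ _ _) => [|k] kl.
      by rewrite -rd0 ?X ?E ?expn_gt0 // dig.
    have kN : (k.+1 < 2 ^ l.+1)%N by apply: leq_ltn_trans kl (ltnW (Nl l)).
    have [+ _ _ _ _] := A k kN; rewrite !X ?E ?(ltnW kN) // ltnn ltnSn => <- //.
    exact: dig.
  split.
    rewrite gS zE rE IHq /mrun iterS -/(mrun M b l).
    by rewrite /mstep /= /gc IHq.
  have X' w : @reach mtape g l w -> forall c r, (r < 2 ^ l.+1)%N ->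
      cx' (w r) c = (r < counters b l.+1 c)%N.
    move=> Rw c r rN; have [[_ _ _ _ B] {}A] := loc w Rw; have [{}X _] := IHw w Rw.
    rewrite countersS -IHq; have := B c; have cl := counters_le b l c.
    have Al k kN := let: And5 _ _ _ _ a := A k kN in a c.
    have Am k kN := let: And5 _ _ _ a _ := A k kN in a c.
    case: (opc _ c) Al => [[]|] Al Bc /=.
    + by case: r rN => [|r] rN; rewrite ?Bc // Al // X // ltnW.
    + have [lt|ge] := ltnP r.+1 (2 ^ l.+1).
        by rewrite Al // X //; case: (counters _ _ _).
      have -> : (r < (counters b l c).-1)%N = false.
        by have := Nl l; move: cl ge rN; move: (counters _ _ _) (2 ^ l.+1)%N; clear; lia.
      case: r rN ge => [|r] rN ge; first by have := Nl l; move: ge; clear; lia.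
      apply/negP => /(Am r rN); rewrite Al // X // => lt.
      by have := Nl l; move: cl ge lt; move: (counters _ _ _) (2 ^ l.+1)%N; clear; lia.
    + by case: r rN => [|r] rN; rewrite ?Bc ?Al // X.
  move=> w /= [[_ A'] [w1 Rw1 nx]]; split.
    move=> c r rN; have [lt|ge] := ltnP r (2 ^ l.+1).
      by have [-> _] := nx r lt; apply: X'.
    have cl := counters_le b l.+1 c; have := Nl l => lN.
    have -> : (r < counters b l.+1 c)%N = false.
      by move: lN cl ge; move: (counters _ _ _) (2 ^ l.+1)%N; clear; lia.
    have base : cx (w (2 ^ l.+1).-1) c = false.
      have lt : ((2 ^ l.+1).-1 < 2 ^ l.+1)%N by rewrite ltn_predL expn_gt0.
      have [-> _] := nx _ lt; rewrite X' //.
      by move: lN cl; move: (counters _ _ _) (2 ^ l.+1)%N; clear; lia.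
    elim: r ge rN => [|r IH] ge rN; first by move: ge lN; clear; lia.
    have [E|ge'] := eqVneq (2 ^ l.+1)%N r.+1.
      have [_ _ m _ _] := A' r rN; apply/negP => /m.
      by move: base; rewrite E /= => ->.
    have [_ _ m _ _] := A' r rN; apply/negP => /m.
    by rewrite IH // ?(ltnW rN) // -ltnS ltn_neqAle ge' ge.
  move=> r; rewrite ltnS => rl.
  have lt : (r < 2 ^ l.+1)%N by apply: leq_ltn_trans rl (ltnW (Nl l)).
  by have [_ ->] := nx r lt; apply: dig.
move=> l; have [qE _] := key l; have [w Rw] := rw l.
have : @locv mtape (g l) (2 ^ l.+1) w by case: (l) Rw => [|?] [].
by move=> [[+ _ _ _ _] _]; rewrite qE.
Qed.

Definition mg (b : nat -> bool) (l : nat) : mglob :=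
  let s := mrun M b l in let c := s.2 (m_cnt s.1) in (s.1, b l, c == 0%N, b c).

Definition mW (b : nat -> bool) (l r : nat) : mcell :=
  ([ffun c => (r < counters b l c)%N], [ffun c => (r < counters b l.+1 c)%N], b r).

Lemma machine_reach b : never_bad M b ->
  [/\ ts_ini (t := mtape) (mg b 0), forall l, ts_stp (t := mtape) (mg b l) (mg b l.+1),
    forall l, ts_bord (t := mtape) (mg b l) (mW b l 0%N),
    forall l r, ts_adj (t := mtape) (mg b l) (mW b l r) (mW b l r.+1) &
    (forall l r, ts_nxt (t := mtape) (mW b l r) (mW b l.+1 r)) /\
    (forall r, ts_ini0 (t := mtape) (mW b 0 r))].
Proof.
move=> nb; split=> //=.
- move=> l; split=> //=.
  + exact: nb.
  + by rewrite ffunE /= -eqn0Ngt.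
  + by rewrite ffunE /= -eqn0Ngt /gread /= => /eqP ->.
  + by rewrite ffunE /= -eqn0Ngt /gdig /= => /eqP ->.
  + move=> c; rewrite /gq /= !ffunE countersS.
    by case: (opc _ c) => [[]|].
- move=> l r; split; rewrite /cx /cx' /= ?ffunE.
  + rewrite ?ffunE /gread /= => r1 r2; congr b.
    by apply/eqP; rewrite eqn_leq r1 leqNgt.
  + by rewrite ?ffunE /gdig /= => r1 r2; congr b; apply/eqP; rewrite eqn_leq r1 leqNgt.
  + by move=> c; rewrite !ffunE; apply: ltnW.
  + by move=> c; rewrite !ffunE; apply: ltnW.
  + move=> c; rewrite !ffunE /gq /= countersS.
    by case: (opc _ c) => [[]|] //=; lia.
split=> [l r|r c]; rewrite /cx /cx' /cD /=; last by rewrite ffunE; case: c.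
by split.
Qed.
End MachineTape.

(** * A structured language compiled to counter machines *)

Inductive cmd :=
| CInc (r : nat) | CDec (r : nat) | CSeq (c1 c2 : cmd)
| CLoop (r : nat) (c : cmd) | CIfd (r : nat) (c : cmd).

Definition upd (s : nat -> nat) (r v : nat) : nat -> nat :=
  fun x => if x == r then v else s x.

Section Exec.
Variable b : nat -> bool.

Inductive exec : cmd -> (nat -> nat) -> (nat -> nat) -> Prop :=
| EInc r s : exec (CInc r) s (upd s r (s r).+1)
| EDec r s : exec (CDec r) s (upd s r (s r).-1)
| ESeq c1 c2 s s1 s2 : exec c1 s s1 -> exec c2 s1 s2 -> exec (CSeq c1 c2) s s2
| ELoop0 r c s : s r = 0%N -> exec (CLoop r c) s s
| ELoopS r c s s1 s2 : s r <> 0%N -> exec c s s1 -> exec (CLoop r c) s1 s2 ->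
    exec (CLoop r c) s s2
| EIf0 r c s : b (s r) = false -> exec (CIfd r c) s s
| EIf1 r c s s1 : b (s r) -> exec c s s1 -> exec (CIfd r c) s s1.
End Exec.

Inductive instr :=
| IInc (r : nat) | IDec (r : nat) | IJz (r k : nat) | IJd (r k : nat) | IJmp (k : nat).

Fixpoint clen (c : cmd) : nat :=
  match c with
  | CInc _ | CDec _ => 1 | CSeq c1 c2 => clen c1 + clen c2
  | CLoop _ c => (clen c).+2 | CIfd _ c => (clen c).+1
  end.

Fixpoint ccode (c : cmd) (p : nat) : seq instr :=
  match c with
  | CInc r => [:: IInc r] | CDec r => [:: IDec r]
  | CSeq c1 c2 => ccode c1 p ++ ccode c2 (p + clen c1)
  | CLoop r c => IJz r (p + (clen c).+2) :: rcons (ccode c p.+1) (IJmp p)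
  | CIfd r c => IJd r (p + (clen c).+1) :: ccode c p.+1
  end.

Fixpoint maxreg (c : cmd) : nat :=
  match c with
  | CInc r | CDec r => r | CSeq c1 c2 => maxn (maxreg c1) (maxreg c2)
  | CLoop r c | CIfd r c => maxn r (maxreg c)
  end.

Lemma size_ccode c p : size (ccode c p) = clen c.
Proof.
elim: c p => //= [c1 IH1 c2 IH2|r c IH|r c IH] p; rewrite ?size_cat ?IH1 ?IH2 //.
  by rewrite size_rcons IH.
by rewrite IH.
Qed.

Section Compile.
Variable prog : cmd.
Local Notation P := (ccode prog 0).
Local Notation L := (clen prog).

Definition instr_reg (i : instr) : nat :=
  match i with IInc r | IDec r | IJz r _ | IJd r _ => r | IJmp _ => 0 end.

Definition instr_op (i : instr) : option bool :=
  match i with IInc _ => Some true | IDec _ => Some false | _ => None end.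

Definition instr_nx (i : instr) (p : nat) (zero digit : bool) : nat :=
  match i with
  | IInc _ | IDec _ => p.+1
  | IJz _ k => if zero then k else p.+1
  | IJd _ k => if digit then p.+1 else k
  | IJmp k => k
  end.

Definition pc_instr (q : 'I_L.+1) := nth (IJmp L) P q.

(** The state is the program counter and the only bad state is the end of the code, so that bad
    means halted. Past the end, the default instruction jumps to the end again. *)
Definition prog_machine : machine :=
  @Machine 'I_L.+1 (maxreg prog).+1 ord0 (fun q => inord (instr_reg (pc_instr q)))
    (fun q => instr_op (pc_instr q))
    (fun q zero digit => inord (instr_nx (pc_instr q) q zero digit))
    (fun q => q == ord_max).

Variable b : nat -> bool.
Notation st := (mQ prog_machine * ('I_(mK prog_machine) -> nat))%type.
Let step : st -> st := @mstep prog_machine b.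

Definition rel_st (x : st) (p : nat) (s : nat -> nat) : Prop :=
  (x.1 : nat) = p /\ forall r : 'I_(maxreg prog).+1, x.2 r = s r.

Definition at_code (c : cmd) (p : nat) : Prop :=
  [/\ (maxreg c <= maxreg prog)%N, (p + clen c <= L)%N &
      forall k, (k < clen c)%N -> nth (IJmp L) P (p + k) = nth (IJmp L) (ccode c p) k].

Lemma step_instr x p s i : rel_st x p s -> (p < L)%N -> nth (IJmp L) P p = i ->
  (instr_reg i <= maxreg prog)%N ->
  (instr_nx i p (s (instr_reg i) == 0%N) (b (s (instr_reg i))) <= L)%N ->
  rel_st (step x) (instr_nx i p (s (instr_reg i) == 0%N) (b (s (instr_reg i))))
    (upd s (instr_reg i) (do_op (instr_op i) (s (instr_reg i)))).
Proof.
case: x => q c [/= qp cs] pL iE rR nL.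
have qi : pc_instr q = i by rewrite /pc_instr qp.
have cE : c (inord (instr_reg i)) = s (instr_reg i) by rewrite cs inordK.
split; rewrite /step /mstep /= qi; first by rewrite cE inordK ?qp.
move=> r; rewrite /upd -[r == _](inj_eq val_inj) /= inordK // !cs.
by case: eqP => // ->.
Qed.


Lemma at_seq1 c1 c2 p : at_code (CSeq c1 c2) p -> at_code c1 p.
Proof.
move=> [/= mr le E]; split; [lia|lia|] => k kl.
by rewrite E ?nth_cat ?size_ccode ?kl //; lia.
Qed.

Lemma at_seq2 c1 c2 p : at_code (CSeq c1 c2) p -> at_code c2 (p + clen c1).
Proof.
move=> [/= mr le E]; split; [lia|lia|] => k kl.
rewrite -addnA E; last by lia.
by rewrite nth_cat size_ccode ltnNge leq_addr /= addKn.
Qed.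

Lemma at_loop r c p : at_code (CLoop r c) p ->
  [/\ at_code c p.+1, nth (IJmp L) P p = IJz r (p + (clen c).+2) &
      nth (IJmp L) P (p.+1 + clen c) = IJmp p].
Proof.
move=> [/= mr le E]; split.
- split; [lia|lia|] => k kl; rewrite addSnnS E; last by lia.
  by rewrite /= nth_rcons size_ccode kl.
- by have := E 0%N isT; rewrite addn0.
- rewrite addSnnS E; last by lia.
  by rewrite /= nth_rcons size_ccode ltnn eqxx.
Qed.

Lemma at_ifd r c p : at_code (CIfd r c) p ->
  at_code c p.+1 /\ nth (IJmp L) P p = IJd r (p + (clen c).+1).
Proof.
move=> [/= mr le E]; split; last by have := E 0%N isT; rewrite addn0.
by split; [lia|lia|] => k kl; rewrite addSnnS E.
Qed.

Lemma updE s r : upd s r (s r) =1 s.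
Proof. by move=> x; rewrite /upd; case: eqP => // ->. Qed.

Lemma rel_ext x p s s' : rel_st x p s -> s =1 s' -> rel_st x p s'.
Proof. by move=> [a c] E; split=> // r; rewrite c E. Qed.

Lemma exec_machine c s s' : exec b c s s' -> forall p x, at_code c p ->
  rel_st x p s -> exists n, rel_st (iter n step x) (p + clen c) s'.
Proof.
elim=> {c s s'}.
- move=> r s p x [/= mr le E] R; exists 1%N; rewrite addn1.
  have i1 : nth (IJmp L) P p = IInc r by have := E 0%N isT; rewrite addn0.
  by have := step_instr R _ i1; rewrite /= => H; apply: H; lia.
- move=> r s p x [/= mr le E] R; exists 1%N; rewrite addn1.
  have i1 : nth (IJmp L) P p = IDec r by have := E 0%N isT; rewrite addn0.
  by have := step_instr R _ i1; rewrite /= => H; apply: H; lia.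
- move=> c1 c2 s s1 s2 _ IH1 _ IH2 p x at_ R.
  have [n Rn] := IH1 p x (at_seq1 at_) R.
  have [m Rm] := IH2 _ _ (at_seq2 at_) Rn.
  by exists (m + n)%N; rewrite iterD /= addnA.
- move=> r c s s0 p x at_ R; have [_ i1 _] := at_loop at_; have [/= mr le _] := at_.
  exists 1%N; have := step_instr R _ i1; rewrite /= s0 eqxx => H.
  by apply: (rel_ext (H _ _ _)); [lia|lia|lia|rewrite -s0; apply: updE].
- move=> r c s s1 s2 s0 _ IH1 _ IH2 p x at_ R; have [at_c i1 i2] := at_loop at_.
  have [/= mr le _] := at_.
  have R1 : rel_st (step x) p.+1 s.
    have := step_instr R _ i1; rewrite /= (negPf (introN eqP s0)) => H.
    by apply: (rel_ext (H _ _ _)); [lia|lia|lia|apply: updE].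
  have [n Rn] := IH1 _ _ at_c R1.
  have R2 : rel_st (step (iter n step (step x))) p s1.
    have := step_instr Rn _ i2; rewrite /= => H.
    by apply: (rel_ext (H _ _ _)); [lia|lia|lia|apply: updE].
  have [m Rm] := IH2 _ _ at_ R2.
  by exists (m + (n.+1 + 1))%N; rewrite !iterD.
- move=> r c s b0 p x at_ R; have [_ i1] := at_ifd at_; have [/= mr le _] := at_.
  exists 1%N; have := step_instr R _ i1; rewrite /= b0 => H.
  by apply: (rel_ext (H _ _ _)); [lia|lia|lia|apply: updE].
- move=> r c s s1 b1 _ IH p x at_ R; have [at_c i1] := at_ifd at_.
  have [/= mr le _] := at_.
  have R1 : rel_st (step x) p.+1 s.
    have := step_instr R _ i1; rewrite /= b1 => H.
    by apply: (rel_ext (H _ _ _)); [lia|lia|lia|apply: updE].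
  have [n Rn] := IH _ _ at_c R1.
  by exists (n + 1)%N; rewrite iterD /= addnS -addSn.
Qed.

Lemma at_prog : at_code prog 0.
Proof. by split; rewrite ?add0n. Qed.

Lemma rel_init : rel_st (m_init prog_machine, fun=> 0%N) 0 (fun=> 0%N).
Proof. by []. Qed.

Lemma halts_bad s' : exec b prog (fun=> 0%N) s' -> ~ never_bad prog_machine b.
Proof.
move=> E nb; have [n [Rn _]] := exec_machine E at_prog rel_init.
have := nb n; rewrite /= => /negP; apply; apply/eqP/val_inj.
by rewrite /= Rn.
Qed.

Lemma bad_absorbing n m : (n <= m)%N ->
  m_bad (mrun prog_machine b n).1 -> m_bad (mrun prog_machine b m).1.
Proof.
move=> /subnK <-; elim: (m - n)%N => [//|k IH] bad.
rewrite addSn /mrun iterS -/(mrun _ _ _); have /eqP := IH bad.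
case: (mrun _ _ _) => q c /= ->; apply/eqP/val_inj => /=.
by rewrite /pc_instr nth_default ?size_ccode //= inordK.
Qed.
End Compile.

(** The head of the loop is reached at arbitrarily late times. Since halting is absorbing, no
    earlier time can be bad. *)
Lemma diverges_never_bad one body b (s : nat -> nat -> nat) :
  exec b (CInc one) (fun=> 0%N) (s 0%N) ->
  (forall n, s n one <> 0%N /\ exec b body (s n) (s n.+1)) ->
  never_bad (prog_machine (CSeq (CInc one) (CLoop one body))) b.
Proof.
set prog := CSeq _ _ => e0 eS; pose step := @mstep (prog_machine prog) b.
have at_ := at_prog prog; have at1 := at_seq1 at_; have at2 := at_seq2 at_.
have [at_c i1 i2] := at_loop at2; have [/= mr le _] := at2.
have heads n : exists2 t, (n <= t)%N & rel_st (mrun (prog_machine prog) b t) 1 (s n).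
  elim: n => [|n [t nt R]].
    by have [k Rk] := exec_machine e0 at1 (rel_init prog); exists k.
  have [s0 en] := eS n.
  have R1 : rel_st (step (mrun (prog_machine prog) b t)) 2 (s n).
    have := step_instr (b := b) R _ i1; rewrite /= (negPf (introN eqP s0)) => H.
    by apply: (rel_ext (H _ _ _)); [lia|lia|lia|apply: updE].
  have [k Rk] := exec_machine en at_c R1.
  exists (k.+1 + t.+1)%N; first by lia.
  rewrite /mrun iterD -/(mrun _ _ _) [mrun _ _ t.+1]/= iterS -/step.
  have := step_instr (b := b) Rk _ i2; rewrite /= => H.
  by apply: (rel_ext (H _ _ _)); [lia|lia|lia|apply: updE].
move=> n; apply/negP => bad; have [t nt [R _]] := heads n.
have := bad_absorbing nt bad; rewrite /= => /eqP E.
by move: R; rewrite E.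
Qed.

(** * Computable predicates checked by counter machines *)

Section Runs.
Variable b : nat -> bool.
Implicit Types (s : nat -> nat).

(** Total correctness in continuation style: the postcondition of a command is the obligation about
    the next one, and programs are verified by backward chaining. *)
Definition runs (c : cmd) s (Q : (nat -> nat) -> Prop) : Prop :=
  exists2 s', exec b c s s' & Q s'.

Lemma runs_seq c1 c2 s Q : runs c1 s (fun s1 => runs c2 s1 Q) -> runs (CSeq c1 c2) s Q.
Proof. by move=> [s1 e1 [s2 e2 q]]; exists s2 => //; apply: ESeq e1 e2. Qed.


Lemma runs_inc r s (Q : _ -> Prop) : Q (upd s r (s r).+1) -> runs (CInc r) s Q.
Proof. by move=> q; exists (upd s r (s r).+1) => //; apply: EInc. Qed.

Lemma runs_dec r s (Q : _ -> Prop) : Q (upd s r (s r).-1) -> runs (CDec r) s Q.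
Proof. by move=> q; exists (upd s r (s r).-1) => //; apply: EDec. Qed.

Lemma runs_loop (Inv : nat -> (nat -> nat) -> Prop) r c (Q : _ -> Prop) k s :
  (forall k s, Inv k.+1 s -> s r <> 0%N /\ runs c s (Inv k)) ->
  (forall s, Inv 0%N s -> s r = 0%N /\ Q s) ->
  Inv k s -> runs (CLoop r c) s Q.
Proof.
move=> IS I0; elim: k s => [|k IH] s I.
  by have [s0 q] := I0 s I; exists s => //; apply: ELoop0.
have [s0 [s1 e1 I1]] := IS k s I; have [s2 e2 q] := IH s1 I1.
by exists s2 => //; apply: ELoopS e2.
Qed.

Definition c_clear r := CLoop r (CDec r).

Lemma runs_clear r s (Q : _ -> Prop) :
  (forall s', s' r = 0%N -> (forall x, x <> r -> s' x = s x) -> Q s') ->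
  runs (c_clear r) s Q.
Proof.
move=> q; apply: (runs_loop (Inv := fun k s' => s' r = k /\
  forall x, x <> r -> s' x = s x) (k := s r)) => [k s1 [s1r s1x]|s1 [s1r s1x]|//].
  split; first by rewrite s1r.
  apply: runs_dec; rewrite /upd eqxx s1r; split=> // x xr.
  by have /eqP/negPf -> := xr; apply: s1x.
by split=> //; apply: q.
Qed.

Definition c_copy a t o :=
  CSeq (c_clear o) (CSeq (c_clear t) (CSeq (CLoop a (CSeq (CDec a) (CInc t)))
    (CLoop t (CSeq (CDec t) (CSeq (CInc a) (CInc o)))))).

Lemma upd_same s r v : upd s r v r = v. Proof. by rewrite /upd eqxx. Qed.
Lemma upd_diff s r v x : x <> r -> upd s r v x = s x.
Proof. by move=> /eqP/negPf xr; rewrite /upd xr. Qed.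

Lemma runs_copy a t o s (Q : _ -> Prop) : a <> t -> a <> o -> t <> o ->
  (forall s', s' o = s a -> (forall x, x <> o -> x <> t -> s' x = s x) -> Q s') ->
  runs (c_copy a t o) s Q.
Proof.
move=> at_ ao to q; apply/runs_seq/runs_clear => s1 s1o s1x.
apply/runs_seq/runs_clear => s2 s2t s2x.
have s2a : s2 a = s a by rewrite s2x // s1x.
have s2o : s2 o = 0%N by rewrite s2x // => /esym.
have s2y x : x <> o -> x <> t -> s2 x = s x by move=> *; rewrite s2x // s1x.
apply/runs_seq; apply: (runs_loop (Inv := fun k s' =>
    [/\ s' a = k, (s' t + k = s a)%N, s' o = 0%N &
    forall x, x <> a -> x <> t -> x <> o -> s' x = s x]) (k := s a)).
- move=> k s' [s'a s't s'o s'x]; split; first by rewrite s'a.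
  apply/runs_seq/runs_dec/runs_inc.
  have n1 : t <> a by move/esym.
  have n2 : o <> a by move/esym.
  have n3 : o <> t by move/esym.
  split.
  + by rewrite (upd_diff _ _ at_) upd_same s'a.
  + by rewrite upd_same (upd_diff _ _ n1) addSnnS.
  + by rewrite (upd_diff _ _ n3) (upd_diff _ _ n2).
  + by move=> x *; rewrite !upd_diff // s'x.
- move=> s' [s'a s't s'o s'x]; split=> //; rewrite addn0 in s't.
  apply: (runs_loop (Inv := fun k s' =>
    [/\ s' t = k, (s' a + k = s a)%N, (s' o + k = s a)%N &
    forall x, x <> a -> x <> t -> x <> o -> s' x = s x]) (k := s a)).
  + move=> k s3 [s3t s3a s3o s3x]; split; first by rewrite s3t.
    apply/runs_seq/runs_dec/runs_seq/runs_inc/runs_inc.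
    have n1 : t <> a by move/esym.
    have n2 : o <> a by move/esym.
    have n3 : o <> t by move/esym.
    split.
    * by rewrite (upd_diff _ _ to) (upd_diff _ _ n1) upd_same s3t.
    * by rewrite (upd_diff _ _ ao) upd_same (upd_diff _ _ at_) addSnnS.
    * by rewrite upd_same (upd_diff _ _ n2) (upd_diff _ _ n3) addSnnS.
    * by move=> x *; rewrite !upd_diff // s3x.
  + move=> s3 [s3t s3a s3o s3x]; split=> //; rewrite !addn0 in s3a s3o.
    apply: q => // x xo xt; have [->|xa] := eqVneq x a; first by [].
    by rewrite s3x //; apply/eqP.
  + by split; rewrite // ?s'a ?s'o.
- by split=> // [|x xa xt xo]; [rewrite s2t|rewrite s2y].
Qed.

(** Registers from [base] on are scratch space; below, only [out] changes. In [Rcomp], clearing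
    [out] ends the fold as a harmless command, since [out] is assigned afterwards. In [Rprim],
    [base] counts down, [base.+1] holds the current value, [base + 2] the index and [base + 3] the
    next value. *)
Fixpoint rec_cmd n (c : recfun n) : n.-tuple nat -> nat -> nat -> cmd :=
  match c in recfun n return n.-tuple nat -> nat -> nat -> cmd with
  | Rzero _ => fun ins out base => c_clear out
  | Rsucc => fun ins out base => CSeq (c_copy (thead ins) base out) (CInc out)
  | Rproj _ i => fun ins out base => c_copy (tnth ins i) base out
  | Rcomp m _ f g => fun ins out base =>
      CSeq (foldr (fun i c => CSeq (rec_cmd (g i) ins (base + i) (base + m)) c)
             (c_clear out) (enum 'I_m))
           (rec_cmd f [tuple base + i | i < m] out (base + m))
  | Rprim _ f g => fun ins out base =>
      CSeq (c_copy (thead ins) (base + 4) base)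
      (CSeq (rec_cmd f [tuple of behead ins] base.+1 (base + 4))
      (CSeq (c_clear (base + 2))
      (CSeq (CLoop base (CSeq (CDec base)
        (CSeq (rec_cmd g [tuple of base + 2 :: base.+1 :: behead ins] (base + 3) (base + 4))
        (CSeq (c_copy (base + 3) (base + 4) base.+1) (CInc (base + 2))))))
      (c_copy base.+1 (base + 4) out))))
  | Rmin _ f => fun ins out base =>
      CSeq (c_clear base)
      (CSeq (rec_cmd f [tuple of base :: ins] base.+1 (base + 2))
      (CSeq (CLoop base.+1 (CSeq (CInc base)
              (rec_cmd f [tuple of base :: ins] base.+1 (base + 2))))
       (c_copy base (base + 2) out)))
  end%N.

Definition fits n (ins : n.-tuple nat) (out base : nat) : Prop :=
  (forall i, (tnth ins i < base)%N /\ tnth ins i <> out) /\ (out < base)%N.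

Definition rec_ok n (c : recfun n) := forall (ins v : n.-tuple nat) out base y s
  (Q : _ -> Prop), fits ins out base -> reval c v y ->
  (forall i, s (tnth ins i) = tnth v i) ->
  (forall s', s' out = y -> (forall x, (x < base)%N -> x <> out -> s' x = s x) -> Q s') ->
  runs (rec_cmd c ins out base) s Q.

Lemma tnth_behead_S n (T : Type) (t : n.+1.-tuple T) (i : 'I_n) :
  tnth [tuple of behead t] i = tnth t (lift ord0 i).
Proof.
by case: t => [[//|x t] /= st]; rewrite !(tnth_nth x).
Qed.

Lemma tnth_cons0 n (T : Type) (x : T) (t : n.-tuple T) : tnth [tuple of x :: t] ord0 = x.
Proof. by rewrite (tnth_nth x). Qed.

Lemma tnth_consS n (T : Type) (x : T) (t : n.-tuple T) i :
  tnth [tuple of x :: t] (lift ord0 i) = tnth t i.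
Proof. by rewrite !(tnth_nth x). Qed.

Lemma forall_ordS n (P : 'I_n.+1 -> Prop) :
  P ord0 -> (forall i, P (lift ord0 i)) -> forall i, P i.
Proof. by move=> P0 PS i; case: (unliftP ord0 i) => [j ->|->]. Qed.

Lemma fits_below t b1 b2 o : (t < b1)%N -> (b1 <= b2)%N -> (b1 <= o)%N ->
  (t < b2)%N /\ t <> o.
Proof. by move=> *; split; lia. Qed.

Lemma rec_cmd_ok n (c : recfun n) : rec_ok c.
Proof.
elim: c => {n}.
- move=> n ins v out base y s Q [_ ob] /= -> sv q.
  by apply: runs_clear => s' s0 sx; apply: q => // x _ /sx.
- move=> ins v out base y s Q [fi ob] /= -> sv q.
  have [lt ne] := fi ord0; apply/runs_seq/runs_copy => //; rewrite ?/thead; try lia.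
  move=> s' so sx; apply: runs_inc; apply: q; first by rewrite upd_same so sv.
  by move=> x xb xo; rewrite upd_diff // sx //; lia.
- move=> n i ins v out base y s Q [fi ob] /= -> sv q.
  have [lt ne] := fi i; apply: runs_copy => //; try lia.
  move=> s' so sx; apply: q; first by rewrite so sv.
  by move=> x xb xo; rewrite sx //; lia.
- move=> m n f IHf g IHg ins v out base y s Q [fi ob] /= [w [gw fw]] sv q.
  apply: runs_seq.
  suff H : forall l : seq 'I_m, uniq l -> forall s0, (forall x, (x < base)%N -> s0 x = s x) ->
    forall Q : (nat -> nat) -> Prop, (forall s', (forall i, i \in l -> s' (base + i)%N = tnth w i) ->
      (forall i, i \notin l -> s' (base + i)%N = s0 (base + i)%N) ->
      (forall x, (x < base)%N -> x <> out -> s' x = s x) -> Q s') ->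
    runs (foldr (fun i c => CSeq (rec_cmd (g i) ins (base + i) (base + m)) c)
             (c_clear out) l) s0 Q.
    apply: (H _ (enum_uniq _) s) => // s' s'i _ s'x.
    apply: (IHf _ w _ _ y) => //.
    + split; last by lia.
      by move=> i; rewrite tnth_mktuple; have := ltn_ord i; lia.
    + by move=> i; rewrite tnth_mktuple s'i // mem_enum.
    + move=> s2 s2o s2x; apply: q => // x xb xo.
      by rewrite s2x //; [exact: s'x|lia].
  elim=> [|i l IHl] /=.
    move=> _ s0 s0x {}Q {}q; apply: runs_clear => s' s'o s'x; apply: q => //.
      by move=> i _; rewrite s'x //; lia.
    by move=> x xb xo; rewrite s'x // s0x.
  move=> /andP[il ul] s0 s0x {}Q {}q; apply: runs_seq.
  apply: (IHg i _ v _ _ (tnth w i)) => //.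
  + split; last by have := ltn_ord i; lia.
    by move=> j; have [] := fi j; lia.
  + by move=> j; rewrite s0x ?sv //; have [] := fi j.
  + move=> s1 s1i s1x; apply: IHl => //.
      by move=> x xb; rewrite s1x ?s0x //; lia.
    move=> s' s'l s'n s'x; apply: q => //.
      move=> j; rewrite inE => /predU1P[->|/s'l //].
      by rewrite s'n // s1i.
    move=> j; rewrite inE negb_or => /andP[ji /s'n ->].
    rewrite s1x //; first by have := ltn_ord j; lia.
    by move=> E; move: ji; rewrite -val_eqE /=; lia.
- move=> n f IHf g IHg ins v out base y s Q [fi ob] /= [a [fa ga ->]] sv q.
  have [lt0 ne0] := fi ord0.
  have sb (i : 'I_n) : tnth [tuple of behead v] i = s (tnth [tuple of behead ins] i).
    by rewrite !tnth_behead_S sv.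
  have fb (i : 'I_n) : (tnth [tuple of behead ins] i < base)%N /\
     tnth [tuple of behead ins] i <> out by rewrite tnth_behead_S.
  apply/runs_seq/runs_copy; rewrite ?/thead; try lia.
  move=> s1 s1o s1x; rewrite sv in s1o.
  apply: runs_seq; apply: (IHf _ [tuple of behead v] _ _ (a 0%N)) => //.
  + split; last by lia.
    by move=> i; have [h _] := fb i; apply: (fits_below h); lia.
  + by move=> i; have [h _] := fb i; rewrite sb s1x //; move: h; move: (tnth _ i); lia.
  move=> s2 s2o s2x; apply/runs_seq/runs_clear => s3 s3o s3x.
  apply: runs_seq.
  apply: (runs_loop (Inv := fun k s' => [/\ s' base = k,
     (s' (base + 2) + k = thead v)%N, s' base.+1 = a (s' (base + 2)%N)
     & forall x, (x < base)%N -> s' x = s x]) (k := thead v)).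
  + move=> k s' [s'k s'i s'a s'x]; split; first by rewrite s'k.
    apply/runs_seq/runs_dec; apply: runs_seq.
    set s4 := upd _ _ _.
    have s4x x : x <> base -> s4 x = s' x by move=> xb; rewrite /s4 upd_diff.
    apply: (IHg _ [tuple of s' (base + 2) :: a (s' (base + 2)) :: behead v]%N
       _ _ (a (s' (base + 2)%N).+1)).
    * split; last by lia.
      apply: forall_ordS; first by rewrite tnth_cons0; lia.
      apply: forall_ordS; first by rewrite tnth_consS tnth_cons0; lia.
      by move=> i; rewrite !tnth_consS; have [h _] := fb i; apply: (fits_below h); lia.
    * by apply: ga; lia.
    * apply: forall_ordS; first by rewrite !tnth_cons0 s4x //; lia.
      apply: forall_ordS; first by rewrite !tnth_consS !tnth_cons0 s4x //; lia.
      move=> i; have [h _] := fb i; rewrite !tnth_consS sb s4x ?s'x //.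
      by move: h; move: (tnth _ i); lia.
    move=> s5 s5o s5x; apply/runs_seq/runs_copy; try lia.
    move=> s6 s6o s6x; apply: runs_inc; split.
    * rewrite upd_diff ?s6x ?s5x //; try lia.
      by rewrite /s4 upd_same s'k.
    * by rewrite upd_same s6x ?s5x ?s4x //; lia.
    * rewrite upd_same upd_diff; last by lia.
      by rewrite s6o s5o s6x ?s5x ?s4x //; lia.
    * by move=> x xb; rewrite upd_diff ?s6x ?s5x ?s4x ?s'x //; lia.
  + move=> s' [s'0 s'i s'a s'x]; split=> //; rewrite addn0 in s'i.
    apply: runs_copy; try lia.
    move=> s4 s4o s4x; apply: q; first by rewrite s4o s'a s'i.
    by move=> x xb xo; rewrite s4x ?s'x //; lia.
  + split.
    * by rewrite s3x ?s2x ?s1o //; lia.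
    * by rewrite s3o.
    * by rewrite s3x ?s2o ?s3o //; lia.
    * by move=> x xb; rewrite s3x ?s2x ?s1x //; lia.
- move=> n f IHf ins v out base y s Q [fi ob] /= [fy fz] sv q.
  (* [w] lists the values of [f] up to [y], where it first vanishes; beyond [y], where [f] may be
     undefined, it is set to 0. *)
  have /choice[w wP] : forall z, exists k, (z <= y)%N -> reval f [tuple of z :: v] k /\
      (k = 0%N <-> z = y).
    move=> z; have [->|zy] := eqVneq z y; first by exists 0%N.
    have [lt|] := ltnP z y; last by exists 0%N => ?; exfalso; lia.
    by have [k fk] := fz z lt; exists k.+1; split=> //; split=> //; lia.
  apply/runs_seq/runs_clear => s1 s1o s1x.
  have call k s' (R : _ -> Prop) : (k <= y)%N -> s' base = k ->
     (forall x, (x < base)%N -> s' x = s x) ->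
     (forall s2, s2 base = k -> s2 base.+1 = w k ->
       (forall x, (x < base)%N -> s2 x = s x) -> R s2) ->
     runs (rec_cmd f [tuple of base :: ins] base.+1 (base + 2)) s' R.
    move=> ky s'b s'x r; have [fk _] := wP k ky.
    apply: (IHf _ [tuple of k :: v] _ _ (w k)) => //.
    + split; last by lia.
      apply: forall_ordS; first by rewrite tnth_cons0; lia.
      by move=> i; rewrite tnth_consS; have [] := fi i; lia.
    + apply: forall_ordS; first by rewrite !tnth_cons0.
      by move=> i; rewrite !tnth_consS s'x ?sv //; have [] := fi i.
    move=> s2 s2o s2x; apply: r => //.
      by rewrite s2x //; lia.
    by move=> x xb; rewrite s2x ?s'x //; lia.
  apply: runs_seq; apply: (call 0%N) => //.
    by move=> x xb; rewrite s1x //; lia.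
  move=> s2 s2b s2w s2x; apply: runs_seq.
  apply: (runs_loop (Inv := fun k s' => [/\ (s' base + k = y)%N,
     s' base.+1 = w (s' base) & forall x, (x < base)%N -> s' x = s x]) (k := y)).
  + move=> k s' [s'b s'w s'x].
    have le : (s' base <= y)%N by lia.
    have [_ wz] := wP _ le; split; first by rewrite s'w => /wz; lia.
    apply/runs_seq/runs_inc; apply: (call (s' base).+1); rewrite ?upd_same //; first lia.
      by move=> x xb; rewrite upd_diff ?s'x //; lia.
    move=> s3 s3b s3w s3x; split=> //; first by rewrite s3b addSnnS.
    by rewrite s3w s3b.
  + move=> s' [s'b s'w s'x]; rewrite addn0 in s'b.
    have [_ wz] := wP y (leqnn y); split; first by rewrite s'w s'b; apply/wz.
    apply: runs_copy; try lia.
    move=> s3 s3o s3x; apply: q; first by rewrite s3o.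
    by move=> x xb xo; rewrite s3x ?s'x //; lia.
  + by rewrite s2b s2w; split.
Qed.
End Runs.

(** * Closure properties of total computable functions *)

Definition cf n (f : n.-tuple nat -> nat) : Prop :=
  exists c : recfun n, forall v, reval c v (f v).

Definition cfb n (P : n.-tuple nat -> bool) : Prop := cf (fun v => nat_of_bool (P v)).

Definition ttail n (u : n.+1.-tuple nat) : n.-tuple nat := [tuple of behead u].

Lemma cf_ext n (f g : n.-tuple nat -> nat) : f =1 g -> cf f -> cf g.
Proof. by move=> E [c cP]; exists c => v; rewrite -E. Qed.

Lemma cf_proj n (i : 'I_n) : cf (fun v => tnth v i).
Proof. by exists (Rproj i). Qed.

Lemma cf_comp m n (f : m.-tuple nat -> nat) (g : 'I_m -> n.-tuple nat -> nat) :
  cf f -> (forall i, cf (g i)) -> cf (fun v => f [tuple g i v | i < m]).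
Proof.
move=> [c cP] /choice[d dP]; exists (Rcomp c d) => v /=.
exists [tuple g i v | i < m]; split=> // i; rewrite tnth_mktuple; exact: dP.
Qed.

Lemma cf_succ n (f : n.-tuple nat -> nat) : cf f -> cf (fun v => (f v).+1).
Proof.
move=> [c cP]; exists (Rcomp Rsucc (fun=> c)) => v /=.
exists [tuple f v]; split=> // i; rewrite (ord1 i); exact: cP.
Qed.

Lemma cf_const n k : cf (fun v : n.-tuple nat => k).
Proof. by elim: k => [|k /cf_succ //]; exists (Rzero n). Qed.

Lemma cf_computable n (f : nat -> nat) (g : n.-tuple nat -> nat) :
  computable f -> cf g -> cf (fun v => f (g v)).
Proof.
move=> [c cP] [d dP]; exists (Rcomp c (fun=> d)) => v /=.
exists [tuple g v]; split=> // i; rewrite (ord1 i); exact: dP.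
Qed.

Lemma ttailE n (u : n.+1.-tuple nat) i : tnth (ttail u) i = tnth u (lift ord0 i).
Proof. exact: tnth_behead_S. Qed.

Lemma cf_weak n (f : n.-tuple nat -> nat) : cf f -> cf (fun u => f (ttail u)).
Proof.
move=> cff; apply: cf_ext (cf_comp cff (fun i => cf_proj (lift ord0 i))) => u.
by congr f; apply: eq_from_tnth => i; rewrite tnth_mktuple ttailE.
Qed.

Lemma cf_rec n (h f : n.-tuple nat -> nat) (G : nat -> nat -> n.-tuple nat -> nat) :
  cf h -> cf f ->
  cf (fun u : n.+2.-tuple nat => G (thead u) (thead (ttail u)) (ttail (ttail u))) ->
  cf (fun v => nat_rect _ (f v) (fun k r => G k r v) (h v)).
Proof.
move=> [ch hP] [c1 fP] [c2 gP].
exists (Rcomp (Rprim c1 c2) (fun i => if unlift ord0 i is Some j then Rproj j else ch)).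
move=> v; exists [tuple of h v :: v]; split.
  by apply: forall_ordS => [|i]; rewrite ?unlift_none ?liftK ?tnth_cons0 ?tnth_consS.
have E : [tuple of behead [tuple of h v :: v]] = v by apply: val_inj.
exists (fun k => nat_rect (fun=> nat) (f v) (fun k r => G k r v) k); split=> //.
  by rewrite E; apply: fP.
move=> k _ /=; have := gP [tuple of k :: nat_rect (fun=> nat) (f v)
   (fun k r => G k r v) k :: behead [tuple of h v :: v]].
congr reval; rewrite /thead !(tnth_nth 0%N) /=; congr G; exact: val_inj.
Qed.

Lemma cf_recP n (h f : n.-tuple nat -> nat) (G : nat -> nat -> n.-tuple nat -> nat)
  (F : n.-tuple nat -> nat -> nat) : cf h -> cf f ->
  cf (fun u : n.+2.-tuple nat => G (thead u) (thead (ttail u)) (ttail (ttail u))) ->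
  (forall v, F v 0%N = f v) -> (forall v k, F v k.+1 = G k (F v k) v) ->
  cf (fun v => F v (h v)).
Proof.
move=> ch cf_ cG F0 FS; apply: cf_ext (cf_rec ch cf_ cG) => v.
by elim: (h v) => //= k IH; rewrite FS IH.
Qed.

Lemma cf_head n : cf (fun u : n.+1.-tuple nat => thead u).
Proof. exact: cf_proj. Qed.

Lemma cf_head2 n : cf (fun u : n.+2.-tuple nat => thead (ttail u)).
Proof. exact: cf_weak (cf_head n). Qed.

Lemma cf_weak2 n (f : n.-tuple nat -> nat) : cf f -> cf (fun u => f (ttail (ttail u))).
Proof. by move=> cff; apply: cf_weak (cf_weak cff). Qed.

Section Arith.
Variables (n : nat).
Implicit Types f g h : n.-tuple nat -> nat.

Lemma cf_add f g : cf f -> cf g -> cf (fun v => f v + g v)%N.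
Proof.
move=> cf_ cg; apply: (@cf_recP _ f g (fun _ r _ => r.+1) (fun v k => k + g v)%N) => //.
exact: cf_succ (cf_head2 n).
Qed.

Lemma cf_pred f : cf f -> cf (fun v => (f v).-1).
Proof.
move=> cf_; apply: (@cf_recP _ f (fun=> 0%N) (fun k _ _ => k) (fun _ k => k.-1)) => //.
  exact: cf_const.
exact: cf_head.
Qed.

Lemma cf_if f g h : cf f -> cf g -> cf h ->
  cf (fun v => if f v == 0%N then g v else h v).
Proof.
move=> cf_ cg ch; apply: (@cf_recP _ f g (fun _ _ v => h v)
  (fun v k => if k == 0%N then g v else h v)) => //; exact: cf_weak2.
Qed.
End Arith.

Lemma cf_mul n (f g : n.-tuple nat -> nat) : cf f -> cf g -> cf (fun v => f v * g v)%N.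
Proof.
move=> cf_ cg; apply: (@cf_recP _ f (fun=> 0%N) (fun _ r v => g v + r)%N
  (fun v k => k * g v)%N) => //; first exact: cf_const.
exact: cf_add (cf_weak2 cg) (cf_head2 n).
Qed.

Lemma cf_sub n (f g : n.-tuple nat -> nat) : cf f -> cf g -> cf (fun v => f v - g v)%N.
Proof.
move=> cf_ cg; apply: (@cf_recP _ g f (fun _ r v => r.-1) (fun v k => f v - k)%N) => //.
- exact: cf_pred (cf_head2 n).
- by move=> v; rewrite subn0.
- by move=> v k; rewrite subnS.
Qed.

Lemma cf_exp n (f g : n.-tuple nat -> nat) : cf f -> cf g -> cf (fun v => f v ^ g v)%N.
Proof.
move=> cf_ cg; apply: (@cf_recP _ g (fun=> 1%N) (fun _ r v => f v * r)%N
  (fun v k => f v ^ k)%N) => //; first exact: cf_const.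
  exact: cf_mul (cf_weak2 cf_) (cf_head2 n).
by move=> v k; rewrite expnS.
Qed.

Lemma cf_sum n (h : n.-tuple nat -> nat) (F : nat -> n.-tuple nat -> nat) :
  cf h -> cf (fun u : n.+1.-tuple nat => F (thead u) (ttail u)) ->
  cf (fun v => \sum_(k < h v) F k v)%N.
Proof.
move=> ch cF; apply: (@cf_recP _ h (fun=> 0%N) (fun k r v => r + F k v)%N
  (fun v m => \sum_(k < m) F k v)%N) => //; first exact: cf_const.
- apply: cf_add (cf_head2 n) _.
  (* Selects the index and the parameters, and drops the accumulated value, which is the second
     argument. *)
  pose g (i : 'I_n.+1) (v : n.+2.-tuple nat) :=
    if unlift ord0 i is Some j then tnth v (lift ord0 (lift ord0 j)) else tnth v ord0.
  have cg i : cf (g i) by rewrite /g; case: unlift => [j|]; apply: cf_proj.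
  apply: cf_ext (cf_comp cF cg) => u; rewrite /g.
  congr F; first by rewrite /thead tnth_mktuple unlift_none.
  by apply: eq_from_tnth => i; rewrite !ttailE tnth_mktuple liftK.
- by move=> v; rewrite big_ord0.
- by move=> v k; rewrite big_ord_recr.
Qed.

Lemma cfb_leq n (f g : n.-tuple nat -> nat) : cf f -> cf g -> cfb (fun v => f v <= g v)%N.
Proof.
move=> cf_ cg; apply: cf_ext (cf_if (cf_sub cf_ cg) (cf_const n 1) (cf_const n 0)) => v.
by rewrite subn_eq0; case: leqP.
Qed.

Lemma cfb_not n (P : n.-tuple nat -> bool) : cfb P -> cfb (fun v => ~~ P v).
Proof.
by move=> cP; apply: cf_ext (cf_sub (cf_const n 1) cP) => v; case: (P v).
Qed.

Lemma cfb_and n (P Q : n.-tuple nat -> bool) : cfb P -> cfb Q -> cfb (fun v => P v && Q v).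
Proof.
by move=> cP cQ; apply: cf_ext (cf_mul cP cQ) => v; case: (P v); case: (Q v).
Qed.


Lemma cfb_eq n (f g : n.-tuple nat -> nat) : cf f -> cf g -> cfb (fun v => f v == g v).
Proof.
move=> cf_ cg; apply: cf_ext (cfb_and (cfb_leq cf_ cg) (cfb_leq cg cf_)) => v.
by rewrite -eqn_leq.
Qed.

Lemma cfb_all n (T : Type) (l : seq T) (P : T -> n.-tuple nat -> bool) :
  (forall x, cfb (P x)) -> cfb (fun v => all (fun x => P x v) l).
Proof.
move=> cP; elim: l => [|x l IH] /=; first exact: cf_const.
exact: cfb_and.
Qed.

(** The bounded quantifier holds iff the number of counterexamples, a bounded sum, is 0. *)
Lemma cfb_forall n (h : n.-tuple nat -> nat) (P : nat -> n.-tuple nat -> bool) :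
  cf h -> cfb (fun u : n.+1.-tuple nat => P (thead u) (ttail u)) ->
  cfb (fun v => [forall k : 'I_(h v), P k v]).
Proof.
move=> ch cP; have cN := cfb_eq (@cf_sum n h (fun k v => nat_of_bool (~~ P k v)) ch (cfb_not cP)) (cf_const n 0).
apply: cf_ext cN => v; congr nat_of_bool; rewrite sum_nat_eq0.
by apply: eq_forallb => i /=; rewrite eqb0 negbK.
Qed.

Lemma big_nat_eq0 m n (F : nat -> nat) :
  (forall i, (m <= i < n)%N -> F i = 0%N) -> (\sum_(m <= i < n) F i = 0)%N.
Proof. by move=> F0; rewrite (eq_big_nat _ _ F0) sum_nat_const_nat muln0. Qed.

(** The quotient counts the positive multiples of [g v] that are at most [f v]. *)
Lemma cf_div n (f g : n.-tuple nat -> nat) : (forall v, 0 < g v)%N -> cf f -> cf g ->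
  cf (fun v => f v %/ g v)%N.
Proof.
move=> g0 cf_ cg.
have c1 : cf (fun v => \sum_(k < f v) (k.+1 * g v <= f v)%N)%N.
  apply: (@cf_sum n f (fun k v => nat_of_bool (k.+1 * g v <= f v)%N)) => //.
  by apply: cfb_leq; [apply: cf_mul; [apply: cf_succ; apply: cf_head|apply: cf_weak]|apply: cf_weak].
apply: cf_ext c1 => v; have E k : (k.+1 * g v <= f v)%N = (k < f v %/ g v)%N.
  by rewrite leq_divRL.
under eq_bigr do rewrite E.
rewrite -(big_mkord xpredT (fun k => nat_of_bool (k < f v %/ g v)%N)).
rewrite (big_cat_nat (n := f v %/ g v)) ?leq_div //=.
have -> : (\sum_(f v %/ g v <= i < f v) (i < f v %/ g v)%N = 0)%N.
  by apply: big_nat_eq0 => i /andP[le _]; rewrite ltnNge le.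
rewrite addn0 -[RHS]subn0 -[RHS]muln1 -sum_nat_const_nat.
by apply: eq_big_nat => i /andP[_ ->].
Qed.

Lemma cf_mod n (f g : n.-tuple nat -> nat) : (forall v, 0 < g v)%N -> cf f -> cf g ->
  cf (fun v => f v %% g v)%N.
Proof.
move=> g0 cf_ cg; apply: cf_ext (cf_sub cf_ (cf_mul (cf_div g0 cf_ cg) cg)) => v.
by rewrite {1}(divn_eq (f v) (g v)) addKn.
Qed.

Lemma computable_cf (f : nat -> nat) : cf (fun v : 1.-tuple nat => f (thead v)) -> computable f.
Proof. by move=> [c cP]; exists c => n; apply: cP. Qed.

(* [dyadic_num b n / 2 ^ n] is the sum of [b k / 2 ^ k.+1] over [k < n]. *)
Fixpoint dyadic_num (b : nat -> bool) (n : nat) : nat :=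
  if n is k.+1 then (2 * dyadic_num b k + b k)%N else 0%N.

(** * The program that tests all the prefixes of the input *)

Section Checker.
Variable f : 2.-tuple nat -> nat.
Variable c : recfun 2.
Hypothesis cP : forall v, reval c v (f v).

(** Register 0 is 1 until a test fails, 1 holds [n], 2 accumulates [dyadic_num b n], recomputed from
    the digits at each round, 3 is the index of the digit read and 4 the number of digits left, 5
    receives the value of [f]; 6 and 7 are temporary and [rec_cmd] works from 8 on. *)
Definition check_body : cmd :=
  CSeq (c_copy 1 6 4) (CSeq (c_clear 2) (CSeq (c_clear 3)
  (CSeq (CLoop 4 (CSeq (CDec 4) (CSeq (c_copy 2 6 7)
     (CSeq (CLoop 7 (CSeq (CDec 7) (CInc 2))) (CSeq (CIfd 3 (CInc 2)) (CInc 3))))))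
  (CSeq (rec_cmd c [tuple 1; 2] 5 8)
  (CSeq (CLoop 5 (CSeq (c_clear 0) (c_clear 5))) (CInc 1)))))).

Definition check_prog : cmd := CSeq (CInc 0) (CLoop 0 check_body).

Variable b : nat -> bool.
Local Notation V := (dyadic_num b).

Lemma check_body_runs (s : nat -> nat) : s 0%N = 1%N ->
  runs b check_body s (fun s' =>
    (s' 0 = (f [tuple s 1; V (s 1)] == 0)%N) /\ s' 1 = (s 1).+1)%N.
Proof.
move=> s0; apply/runs_seq/runs_copy => // s1 s1o s1x.
apply/runs_seq/runs_clear => s2 s2o s2x; apply/runs_seq/runs_clear => s3 s3o s3x.
apply: runs_seq.
apply: (runs_loop (Inv := fun k s' => [/\ s' 4 = k, (s' 3 + k = s 1)%N,
  s' 2 = V (s' 3), s' 0 = 1 & s' 1 = s 1]%N) (k := s 1%N)).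
- move=> k s' [s'4 s'3 s'2 s'0 s'1]; split; first by rewrite s'4.
  apply/runs_seq/runs_dec; set s4 := upd _ _ _.
  have s4x x : x <> 4%N -> s4 x = s' x by move=> ?; rewrite /s4 upd_diff.
  have s44 : s4 4%N = k by rewrite /s4 upd_same s'4.
  apply/runs_seq/runs_copy => // s5 s5o s5x.
  have s52 : s5 2%N = s' 2%N by rewrite s5x // s4x.
  apply: runs_seq; apply: (runs_loop (Inv := fun j u => [/\ u 7 = j,
     (u 2 + j = 2 * s' 2)%N & forall x, x <> 7 -> x <> 2 -> u x = s5 x]%N) (k := s' 2%N)).
  + move=> j u [u7 u2 ux]; split; first by rewrite u7.
    apply/runs_seq/runs_dec/runs_inc; split.
    * by rewrite /upd /= u7.
    * by rewrite /upd /= addSnnS.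
    * by move=> x *; rewrite !upd_diff // ux.
  + move=> u [u7 u2 ux]; split=> //; rewrite addn0 in u2.
    have u3 : u 3%N = s' 3%N by rewrite ux // s5x // s4x.
    have u4 : u 4%N = k by rewrite ux // s5x.
    have u0 : u 0%N = 1%N by rewrite ux // s5x // s4x.
    have u1 : u 1%N = s 1%N by rewrite ux // s5x // s4x.
    apply: runs_seq; case bE : (b (u 3%N)); last first.
      exists u; first exact: EIf0.
      apply: runs_inc; rewrite /upd /=; split=> //.
        by rewrite u3 addSnnS.
      by rewrite u2 u3 /= -u3 bE addn0 s'2 u3.
    exists (upd u 2 (u 2%N).+1); first by apply: EIf1 => //; apply: EInc.
    apply: runs_inc; rewrite /upd /=; split=> //.
      by rewrite u3 addSnnS.
    by rewrite u2 u3 /= -u3 bE addn1 s'2 u3.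
  + by split=> //; rewrite s52 mul2n addnn.
- move=> s' [s'4 s'3 s'2 s'0 s'1]; split=> //; rewrite addn0 in s'3.
  apply: runs_seq.
  apply: (@rec_cmd_ok b _ c [tuple 1; 2]%N [tuple s 1; V (s 1)]%N 5 8 (f [tuple s 1; V (s 1)]%N)) => //.
  + split=> //; apply: forall_ordS => //; by apply: forall_ordS => //; case.
  + apply: forall_ordS; first by rewrite (tnth_nth 0%N).
    apply: forall_ordS; last by case.
    by rewrite !(tnth_nth 0%N) /= s'2 s'3.
  move=> s4 s4o s4x; apply: runs_seq.
  have s41 : s4 1%N = s 1%N by rewrite s4x.
  have s40 : s4 0%N = 1%N by rewrite s4x.
  have [w0|w0] := eqVneq (s4 5%N) 0%N.
    exists s4; first exact: ELoop0.
    apply: runs_inc; rewrite /upd /= s40 s41; split=> //.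
    by rewrite -s4o w0.
  apply: (@runs_loop b (fun k u => [/\ k = 1%N -> u 5%N <> 0%N,
      k = 0%N -> u 5%N = 0%N /\ u 0%N = 0%N & u 1%N = s 1%N /\ (k < 2)%N]) _ _ _ 1).
  + move=> k u [u5 _ [u1 k1]]; have k0 : k = 0%N by move: k1; clear; lia.
    subst k; split; first exact: u5.
    apply/runs_seq/runs_clear => u2 u2o u2x; apply/runs_clear => u3 u3o u3x.
    by split=> //; [rewrite u3o u3x|rewrite u3x // u2x].
  + move=> u [_ /(_ erefl)[u5 u0] [u1 _]]; split=> //.
    apply: runs_inc; rewrite /upd /= u0 u1; split=> //.
    by rewrite -s4o (negPf w0).
  + by split=> // _; apply/eqP.
- split=> //.
  + by rewrite s3x // s2x.
  + by rewrite s3o.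
  + by rewrite s3x // s2o s3o.
  + by rewrite s3x // s2x // s1x.
  + by rewrite s3x // s2x // s1x.
Qed.

(** A failed test clears register 0, which ends the loop; hence the program halts exactly when some
    test fails. *)
Theorem check_machineP : never_bad (prog_machine check_prog) b <->
  forall n, f [tuple n; V n] = 0%N.
Proof.
have init : exists2 s, exec b (CInc 0) (fun=> 0%N) s & (s 0 = 1 /\ s 1 = 0)%N.
  by exists (upd (fun=> 0%N) 0 1); [exact: (EInc b 0 (fun=> 0%N))|].
have [s es [s0 s1]] := init; split=> [nb n|ok].
  apply/eqP/negPn/negP => fn.
  have H k : forall s, s 0%N = 1%N -> (s 1 + k = n)%N ->
      exists s', exec b (CLoop 0 check_body) s s'.
    elim: k => [|k IH] u u0 un.
      have [u' eu [u'0 _]] := check_body_runs u0.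
      exists u'; apply: ELoopS eu _; first by rewrite u0.
      by apply: ELoop0; rewrite u'0; rewrite addn0 in un; rewrite un (negPf fn).
    have [u' eu [u'0 u'1]] := check_body_runs u0.
    have [fz|fz] := eqVneq (f [tuple u 1; V (u 1)])%N 0%N; rewrite ?fz ?(negPf fz) /= in u'0.
      have [u'' eu'] := IH u' u'0 ltac:(by rewrite u'1 addSnnS).
      by exists u''; apply: ELoopS eu eu'; rewrite u0.
    by exists u'; apply: ELoopS eu _; [rewrite u0|apply: ELoop0].
  have [s' es'] := H n s s0 ltac:(by rewrite s1).
  exact: (halts_bad (ESeq es es') nb).
pose P n (u : nat -> nat) := (u 0 = 1 /\ u 1 = n)%N /\ (n = 0%N -> u = s).
have P0 : P 0%N s by [].
have PS n u : P n u -> exists2 u', P n.+1 u' & exec b check_body u u'.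
  move=> [[u0 u1] _]; have [u' eu [u'0 u'1]] := check_body_runs u0.
  by exists u' => //; split=> //; rewrite u'0 u'1 u1 ok.
have [F FP] := dep_choice P0 PS.
apply: (@diverges_never_bad _ _ _ F).
  by have [[_ ->]] := FP 0%N.
by move=> n; have [[[-> _] _] ?] := FP n.
Qed.
End Checker.

(** * Tilings of prescribed column density *)

Definition tiling_by (B : Type) (T : B -> B -> B -> Prop) (z : int -> int -> B) : Prop :=
  forall i j, T (z i j) (z (i + 1) j) (z i (j + 1)).

(** All that the coding into [H] uses of the tiles. Letting [n] and then [L] grow, both counts tend
    to the number with binary digits [b]; [dt_code] says that the tilings of a square number at most
    an exponential in its side, hence zero entropy. *)
Record density_tiles (f : 2.-tuple nat -> nat) := DensityTiles {
  dt_B : finType;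
  dt_T : dt_B -> dt_B -> dt_B -> Prop;
  dt_sel : dt_B -> bool;
  dt_upper : forall z, tiling_by dt_T z -> exists2 b : nat -> bool,
    forall n, f [tuple n; dyadic_num b n] = 0%N &
    forall y n L, (#|[set i : 'I_n | dt_sel (z (i : nat)%:Z y)]%SET| <=
      \sum_(l < L) b l * (n %/ 2 ^ l.+1 + 1) + (n %/ 2 ^ L + 1))%N;
  dt_lower : forall b : nat -> bool, (forall n, f [tuple n; dyadic_num b n] = 0%N) ->
    exists2 z, tiling_by dt_T z & forall y n L, (\sum_(l < L) b l * (n %/ 2 ^ l.+1) <=
       #|[set i : 'I_n | dt_sel (z (i : nat)%:Z y)]%SET|)%N;
  dt_col : forall z, tiling_by dt_T z -> forall x y y', dt_sel (z x y) = dt_sel (z x y');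
  dt_code : forall n1 n2 L, (n1 <= 2 ^ L)%N -> (n2 <= 2 ^ L)%N ->
    exists (C : finType) (P : (int -> int -> dt_B) -> C -> Prop),
    [/\ #|C| = (2 ^ L.+1 * 2 ^ L.+1 * 5 * #|dt_B| ^ n1 * #|dt_B| ^ n2)%N,
        forall z, tiling_by dt_T z -> exists c, P z c &
        forall z z' c, tiling_by dt_T z -> tiling_by dt_T z' -> P z c -> P z' c ->
          forall x y : nat, (x < n1)%N -> (y < n2)%N -> z x%:Z y%:Z = z' x%:Z y%:Z] }.

Theorem density_tiles_exist (f : 2.-tuple nat -> nat) : cf f -> inhabited (density_tiles f).
Proof.
move=> [c cP]; pose M := prog_machine (check_prog c); pose S := mtape M.
pose sel (z : tile S) := gdig (lg (vlam (tv z))).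
constructor; exists (tile S) (@tile_rule S) sel.
- move=> z tz; have [a [b [g [ab _ [g0 gS] rw gl]]]] := tiling_tower tz.
  exists (fun l => gdig (g l)).
    by apply/(check_machineP cP); apply: reach_machine.
  move=> y n L; apply: (@sel_count S z (@gdig M) a g) => //.
  by move=> l; have [] := ab l.
- move=> b /(check_machineP cP) nb; have [h1 h2 h3 h4 [h5 h6]] := machine_reach nb.
  exists (@zc S (mg M b) (mW M b)); first exact: zc_tiling.
  by move=> y n L; apply: (@zc_count S (mg M b) (mW M b) (@gdig M)).
- by move=> z tz x y y'; rewrite /sel (vlam_up tz x y y').
- move=> n1 n2 L l1 l2; exists (tcode S n1 n2 L), (@has_code S n1 n2 L); split.
  + by rewrite 4!card_prod !card_ffun !card_ord.
  + by move=> z tz; apply: has_code_ex.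
  + by move=> z z' d tz tz' c1 c2; apply: (has_code_inj tz tz' c1 c2).
Qed.

(** * Entropy as an infimum *)

Section Npat.
Variables (G : zmodType) (A : finType).
Implicit Types (X : set (G -> A)).

(** A version of [pattern_count] without translations and with any finite type of indices, which
    suits maps between patterns and codes. *)
Definition npat X (I : finType) (e : I -> G) : nat :=
  #|[set p : {ffun I -> A} | `[< exists2 x, X x & forall i, p i = x (e i) >]]%SET|.

Definition shift_inv X : Prop := forall x t, X x -> X (fun u => x (t + u)).

(** The code of a configuration need not be unique nor computed from its pattern: a relation that
    can be decoded is enough. *)
Lemma npat_le X (I : finType) (e : I -> G) (C : finType) (D : {set C})
    (P : (G -> A) -> C -> Prop) :
  (forall x, X x -> exists2 c, c \in D & P x c) ->
  (forall x y c, X x -> X y -> P x c -> P y c -> forall i, x (e i) = y (e i)) ->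
  (npat X e <= #|D|)%N.
Proof.
move=> ex inj; rewrite /npat; set Sp := [set p | _]%SET.
have H p : p \in Sp -> exists c, c \in D /\ exists x, [/\ X x, P x c & forall i, p i = x (e i)].
  by rewrite inE => /asboolP[x Xx px]; have [c cD Pc] := ex x Xx; exists c; split=> //; exists x.
have [->|/set0Pn[p0 /H[c0 _]]] := eqVneq Sp finset.set0; first by rewrite cards0.
have /choice[F FP] : forall p, exists c, p \in Sp -> c \in D /\ exists x,
    [/\ X x, P x c & forall i, p i = x (e i)].
  move=> p; have [/H[c Hc]|_] := boolP (p \in Sp); first by exists c.
  by exists c0.
rewrite -(@card_in_imset _ _ F).
  by apply/fintype.subset_leq_card/fintype.subsetP => _ /imsetP[p /FP[? _] ->].
move=> p q /FP[_ [x [Xx Px px]]] /FP[_ [y [Xy Py qy]]] E; apply/ffunP => i.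
by rewrite px qy; rewrite E in Px; apply: inj Px Py i.
Qed.

Lemma npat_ge X (I : finType) (e : I -> G) (C : finType) (D : {set C})
    (dec : C -> G -> A) :
  (forall c, c \in D -> X (dec c)) ->
  (forall c c', c \in D -> c' \in D -> (forall i, dec c (e i) = dec c' (e i)) -> c = c') ->
  (#|D| <= npat X e)%N.
Proof.
move=> XD inj; rewrite -(@card_in_imset _ _ (fun c => [ffun i => dec c (e i)])).
  apply/fintype.subset_leq_card/fintype.subsetP => _ /imsetP[c cD ->].
  rewrite inE; apply/asboolP; exists (dec c); first exact: XD.
  by move=> i; rewrite ffunE.
move=> c c' cD c'D /ffunP E; apply: inj => // i.
by have := E i; rewrite !ffunE.
Qed.

Lemma npat_subset X Y (I : finType) (e : I -> G) : X `<=` Y -> (npat X e <= npat Y e)%N.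
Proof.
move=> XY; apply/fintype.subset_leq_card/fintype.subsetP => p.
rewrite inE => /asboolP[x Xx px]; rewrite inE; apply/asboolP.
by exists x; [apply: XY|].
Qed.

Lemma npat_gt0 X (I : finType) (e : I -> G) : X !=set0 -> (0 < npat X e)%N.
Proof.
move=> [x Xx]; apply/card_gt0P; exists [ffun i => x (e i)].
by rewrite inE; apply/asboolP; exists x => // i; rewrite ffunE.
Qed.

Lemma npat_cover X (I J K : finType) (e : I -> G) (eK : K -> G) (t : J -> G) :
  shift_inv X -> (forall i, exists j k, e i = t j + eK k) ->
  (npat X e <= npat X eK ^ #|J|)%N.
Proof.
move=> sX cov; rewrite [X in (_ <= X ^ _)%N]/npat; set Sp := [set p | _]%SET.
rewrite -card_ffun_on -cardsE.
pose P (x : G -> A) (c : {ffun J -> {ffun K -> A}}) := forall j k, c j k = x (t j + eK k).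
apply: (@npat_le _ _ _ _ _ P).
  move=> x Xx; exists [ffun j => [ffun k => x (t j + eK k)]]; last by move=> j k; rewrite !ffunE.
  rewrite inE; apply/ffun_onP => j; rewrite !ffunE inE; apply/asboolP.
  by exists (fun u => x (t j + u)); [apply: sX|move=> i; rewrite ffunE].
by move=> x y c _ _ Px Py i; have [j [k ->]] := cov i; rewrite -Px -Py.
Qed.

(** By shift invariance, a pattern that appears somewhere also appears at the origin. *)
Lemma pattern_count_npat X (F : {fset G}) (I : finType) (e : I -> G) :
  shift_inv X -> injective e -> (forall i, e i \in F) ->
  (forall u, u \in F -> exists i, u = e i) -> pattern_count X F = npat X e.
Proof.
move=> sX ei eF eS; rewrite /pattern_count /npat; apply/eqP; rewrite eqn_leq; apply/andP; split.
  rewrite -(@card_in_imset _ _ (fun p : {ffun F -> A} => [ffun i => p (FSetSub (eF i))])).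
    apply/fintype.subset_leq_card/fintype.subsetP => _ /imsetP[p + ->].
    rewrite inE => /asboolP[x Xx [t ap]]; rewrite inE; apply/asboolP.
    exists (fun u => x (t + u)); first exact: sX.
    by move=> i; rewrite ffunE (ap _ (p (FSetSub (eF i)))) // in_fnd.
  move=> p q _ _ /ffunP E; apply/ffunP => -[u uF].
  have [i ui] := eS u uF; have := E i; rewrite !ffunE.
  have -> // : FSetSub (eF i) = FSetSub uF by apply: val_inj; rewrite /= ui.
have /choice[g gP] : forall u : F, exists i, val u = e i by move=> [u uF]; apply: eS.
rewrite -(@card_in_imset _ _ (fun p : {ffun I -> A} => [ffun u => p (g u)])).
  apply/fintype.subset_leq_card/fintype.subsetP => _ /imsetP[p + ->].
  rewrite inE => /asboolP[x Xx px]; rewrite inE; apply/asboolP.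
  exists x => //; exists 0 => u a.
  have [uF|uF] := boolP (u \in F); last by rewrite not_fnd.
  by rewrite in_fnd ffunE add0r px -gP /= => -[].
move=> p q _ _ /ffunP E; apply/ffunP => i; have := E (FSetSub (eF i)); rewrite !ffunE.
by have <- // : i = g (FSetSub (eF i)) by apply: ei; rewrite -gP.
Qed.

Lemma avoiding_shift (F : {fset pattern G A}) : shift_inv (avoiding F).
Proof.
move=> x t aF p pF [s ap]; apply: (aF p pF); exists (t + s) => u a /ap.
by rewrite addrA.
Qed.
End Npat.

Definition emb1 n (i : 'I_n) : int := (i : nat)%:Z.
Definition emb2 n1 n2 (i : 'I_n1 * 'I_n2) : int * int := ((i.1 : nat)%:Z, (i.2 : nat)%:Z).

Lemma in_box1 n u : reflect (exists i : 'I_n, u = emb1 i) (u \in box1 n).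
Proof.
apply: (iffP idP) => [/imfsetP[i _ ->]|[i ->]]; first by exists i.
by apply/imfsetP; exists i.
Qed.

Lemma pattern_count1 (A : finType) (X : set (int -> A)) n : shift_inv X ->
  pattern_count X (box1 n) = npat X (@emb1 n).
Proof.
move=> sX; apply: pattern_count_npat => //.
- by move=> i j /eqP; rewrite eqz_nat => /eqP /val_inj.
- by move=> i; apply/in_box1; exists i.
- by move=> u /in_box1.
Qed.

Lemma pattern_count2 (A : finType) (X : set (int * int -> A)) n : shift_inv X ->
  pattern_count X (box2 n) = npat X (@emb2 n n).
Proof.
move=> sX; apply: pattern_count_npat => //.
- by move=> [i j] [i' j'] [/val_inj -> /val_inj ->].
- move=> [i j]; rewrite in_fsetM /=; apply/andP; split; apply/in_box1; by [exists i|exists j].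
- move=> [u v]; rewrite in_fsetM /= => /andP[/in_box1[i ->] /in_box1[j ->]].
  by exists (i, j).
Qed.

Lemma horiz_shift (A : finType) (H : set (int -> A)) F : shift_inv H ->
  shift_inv (horizontally_constrained H F).
Proof.
move=> sH x t [aF Hx]; split; first exact: avoiding_shift.
by move=> j; have := sH _ t.1 (Hx (t.2 + j)).
Qed.

Lemma SFT_shift (G : zmodType) (A : finType) (X : set (G -> A)) : is_SFT X -> shift_inv X.
Proof. by move=> [F ->]; apply: avoiding_shift. Qed.

Lemma cover1 (A : finType) (X : set (int -> A)) n m : shift_inv X -> (0 < m)%N ->
  (npat X (@emb1 n) <= npat X (@emb1 m) ^ (n %/ m + 1))%N.
Proof.
move=> sX m0; rewrite -[in X in (_ <= X)%N](card_ord (n %/ m + 1)).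
apply: (npat_cover (t := fun j : 'I_(n %/ m + 1) => (j * m)%N%:Z)) => // i.
have lt : (i %/ m < n %/ m + 1)%N by rewrite addn1 ltnS leq_div2r // ltnW.
exists (Ordinal lt), (Ordinal (ltn_pmod i m0)).
by rewrite /emb1 /= -PoszD -divn_eq.
Qed.

Lemma cover2 (A : finType) (X : set (int * int -> A)) n m : shift_inv X -> (0 < m)%N ->
  (npat X (@emb2 n n) <= npat X (@emb2 m m) ^ ((n %/ m + 1) ^ 2))%N.
Proof.
move=> sX m0; pose J := ('I_(n %/ m + 1) * 'I_(n %/ m + 1))%type.
have -> : ((n %/ m + 1) ^ 2)%N = #|{: J}| by rewrite card_prod card_ord.
apply: (npat_cover (t := fun j : J => ((j.1 * m)%N%:Z, (j.2 * m)%N%:Z))) => // -[i i'].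
have lt (k : 'I_n) : (k %/ m < n %/ m + 1)%N by rewrite addn1 ltnS leq_div2r // ltnW.
exists (Ordinal (lt i), Ordinal (lt i')), (Ordinal (ltn_pmod i m0), Ordinal (ltn_pmod i' m0)).
by rewrite /emb2 /=; congr (_, _); rewrite -PoszD -divn_eq.
Qed.

Section Free.
Variables (A : finType) (H : set (int -> A)).
Hypothesis H0 : H !=set0.

Lemma npat_free n :
  npat (horizontally_constrained H fset0) (@emb2 n n) = (npat H (@emb1 n) ^ n)%N.
Proof.
rewrite [in RHS]/npat; set Sp := [set p | _]%SET.
have -> : (#|Sp| ^ n)%N = (#|Sp| ^ #|'I_n|)%N by rewrite card_ord.
rewrite -card_ffun_on -cardsE.
apply/eqP; rewrite eqn_leq; apply/andP; split.
  pose P (x : int * int -> A) (c : {ffun 'I_n -> {ffun 'I_n -> A}}) :=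
    forall j i, c j i = x (emb2 (i, j)).
  apply: (@npat_le _ _ _ _ _ _ _ P).
    move=> x [_ Hx]; exists [ffun j => [ffun i => x (emb2 (i, j))]]; last by move=> j i; rewrite !ffunE.
    rewrite inE; apply/ffun_onP => j; rewrite !ffunE inE; apply/asboolP.
    by exists (fun k => x (k, (j : nat)%:Z)) => // i; rewrite ffunE.
  by move=> x y c _ _ Px Py [i j]; rewrite -Px -Py.
have [x0 Hx0] := H0.
have /choice[dc dcP] : forall p : {ffun 'I_n -> A}, exists x, H x /\
    (p \in Sp -> forall i, p i = x (emb1 i)).
  move=> p; have [|_] := boolP (p \in Sp); last by exists x0.
  by rewrite inE => /asboolP[x Hx px]; exists x.
(* A row of negative index copies the opposite one, and rows far away are [x0]: any rows of [H] do,
   outside the square. *)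
pose dec (c : {ffun 'I_n -> {ffun 'I_n -> A}}) (u : int * int) : A :=
  if insub `|u.2|%N is Some j then dc (c j) u.1 else x0 u.1.
apply: (@npat_ge _ _ _ _ _ _ _ dec).
  move=> c _; split; first by move=> p; rewrite in_fset0.
  by move=> j; rewrite /dec /=; case: insubP => [k _ _|_] //; have [] := dcP (c k).
move=> c c'; rewrite !inE => /ffun_onP cS /ffun_onP c'S E; apply/ffunP => j; apply/ffunP => i.
have := E (i, j); rewrite /dec /emb2 /= valK.
by rewrite -(dcP (c j)).2 // -(dcP (c' j)).2.
Qed.
End Free.

(** * Rates of submultiplicative sequences *)

Section RealFacts.
Variable R : realType.
Implicit Types (x y e : R).

Lemma cvg_natV : (fun n : nat => n%:R^-1 : R) @ \oo --> 0.
Proof. by rewrite -cvg_shiftS; exact: cvg_harmonic. Qed.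

Lemma ln2_gt0 : 0 < ln 2 :> R.
Proof. by rewrite ln_gt0 // ltr1n. Qed.

Lemma log2_ge0 x : 1 <= x -> 0 <= log2 x.
Proof. by move=> x1; apply: divr_ge0; [exact: ln_ge0|exact: ltW ln2_gt0]. Qed.

Lemma log2X x n : 0 < x -> log2 (x ^+ n) = log2 x *+ n.
Proof. by move=> x0; rewrite /log2 lnXn // mulrnAl. Qed.

Lemma log2M x y : 0 < x -> 0 < y -> log2 (x * y) = log2 x + log2 y.
Proof. by move=> x0 y0; rewrite /log2 lnM ?posrE // mulrDl. Qed.

Lemma ler_log2 x y : 0 < x -> x <= y -> log2 x <= log2 y.
Proof.
move=> x0 xy; rewrite /log2 ler_pM2r; last by rewrite invr_gt0; exact: ln2_gt0.
by rewrite ler_ln ?posrE //; apply: lt_le_trans xy.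
Qed.

Lemma log22 : log2 2 = 1 :> R.
Proof. by rewrite /log2 divff // gt_eqF //; exact: ln2_gt0. Qed.

Lemma log2_exp2 n : log2 (2 ^+ n) = n%:R :> R.
Proof. by rewrite log2X // log22. Qed.

Section Fekete.
Variables (u : nat -> nat) (k : nat).
Hypotheses (u0 : forall n, (0 < u n)%N)
  (uM : forall n m, (0 < m)%N -> (u n <= u m ^ ((n %/ m + 1) ^ k))%N).
Let w n : R := log2 (u n)%:R / n%:R ^+ k.

Lemma rate_ge0 n : 0 <= w n.
Proof. by rewrite divr_ge0 ?exprn_ge0 ?ler0n // log2_ge0 // ler1n. Qed.

Lemma rate_le n m : (0 < n)%N -> (0 < m)%N ->
  w n <= (m%:R^-1 + n%:R^-1) ^+ k * log2 (u m)%:R.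
Proof.
move=> n0 m0; have nR : 0 < n%:R :> R by rewrite ltr0n.
have mR : 0 < m%:R :> R by rewrite ltr0n.
have um0 : 0 <= log2 (u m)%:R :> R by rewrite log2_ge0 // ler1n.
rewrite /w ler_pdivrMr ?exprn_gt0 //.
have -> : (m%:R^-1 + n%:R^-1) ^+ k * log2 (u m)%:R * n%:R ^+ k
        = log2 (u m)%:R * (n%:R / m%:R + 1) ^+ k :> R.
  rewrite mulrAC -exprMn mulrC; congr (_ * _ ^+ _).
  by field; rewrite !gt_eqF.
apply: (@le_trans _ _ (log2 ((u m) ^ ((n %/ m + 1) ^ k))%N%:R)).
  by apply: ler_log2; rewrite ?ltr0n // ler_nat uM.
rewrite natrX log2X ?ltr0n // -[leLHS]mulr_natr ler_wpM2l // natrX.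
rewrite lerXn2r ?nnegrE ?ler0n ?addr_ge0 ?divr_ge0 ?ler0n //.
rewrite natrD lerD2r ler_pdivlMr // -natrM ler_nat.
exact: leq_trunc_div.
Qed.

Let L := inf [set w m | m in [set m | (0 < m)%N]].

Let L_has : has_inf [set w m | m in [set m | (0 < m)%N]].
Proof.
split; first by exists (w 1), 1%N.
by exists 0 => _ [m _ <-]; apply: rate_ge0.
Qed.

Lemma fekete_le m : (0 < m)%N -> L <= w m.
Proof. by move=> m0; apply: ge_inf; [exact: L_has.2|exists m]. Qed.

Lemma fekete_ge0 : 0 <= L.
Proof. by apply: lb_le_inf; [exact: L_has.1|move=> _ [m _ <-]; apply: rate_ge0]. Qed.

(** Fekete's argument: for fixed [m], the bound of [rate_le] tends to [w m] as [n] grows, and [w m]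
    can be chosen close to the infimum. *)
Lemma fekete_cvg : w @ \oo --> L.
Proof.
apply/cvgrPdist_lt => e e0.
have e20 : 0 < e / 2 by rewrite divr_gt0.
have [_ [m m0 <-] wm] := inf_adherent e20 L_has; rewrite -/L in wm.
have cv : (fun n : nat => (m%:R^-1 + n%:R^-1) ^+ k * log2 (u m)%:R : R) @ \oo --> w m.
  rewrite /w mulrC -exprVn; apply: cvgMl => /=.
  have -> : m%:R^-1 ^+ k = (m%:R^-1 + 0) ^+ k :> R by rewrite addr0.
  have c1 : (fun n : nat => m%:R^-1 + n%:R^-1 : R) @ \oo --> (m%:R^-1 + 0 : R).
    by apply: cvgD; [exact: cvg_cst|exact: cvg_natV].
  exact: (cvg_comp _ _ c1 (@exprn_continuous R k _)).
have wm2 : w m < L + e by apply: lt_le_trans wm _; rewrite lerD2l; lra.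
have near1 := (cvgr_lt _ cv) _ wm2.
near=> n; have n0 : (0 < n)%N by near: n; exists 1%N.
rewrite ltr_norml; apply/andP; split; last by have := fekete_le n0; lra.
have : (m%:R^-1 + n%:R^-1) ^+ k * log2 (u m)%:R < L + e by near: n; exact: near1.
by have := rate_le n0 m0; lra.
Unshelve. all: by end_near.
Qed.

Lemma fekete_lim : lim (w @ \oo) = L.
Proof. by apply: cvg_lim; [exact: Rhausdorff|exact: fekete_cvg]. Qed.
End Fekete.

Section Entropy.
Variable A : finType.

Lemma entropy1E (X : set (int -> A)) : shift_inv X ->
  entropy1 R X = lim ((fun n : nat => log2 (npat X (@emb1 n))%:R / n%:R ^+ 1 : R) @ \oo).
Proof.
move=> sX; rewrite /entropy1; suff -> : (fun n : nat =>
    log2 (pattern_count X (box1 n))%:R / n%:R : R) =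
    (fun n : nat => log2 (npat X (@emb1 n))%:R / n%:R ^+ 1) by [].
by apply: funext => n; rewrite pattern_count1 // expr1.
Qed.

Lemma entropy2E (X : set (int * int -> A)) : shift_inv X ->
  entropy2 R X = lim ((fun n : nat => log2 (npat X (@emb2 n n))%:R / n%:R ^+ 2 : R) @ \oo).
Proof.
move=> sX; rewrite /entropy2; suff -> : (fun n : nat =>
    log2 (pattern_count X (box2 n))%:R / n%:R ^+ 2 : R) =
    (fun n : nat => log2 (npat X (@emb2 n n))%:R / n%:R ^+ 2) by [].
by apply: funext => n; rewrite pattern_count2.
Qed.

Lemma entropy1_spec (X : set (int -> A)) : shift_inv X -> X !=set0 ->
  [/\ 0 <= entropy1 R X,
      forall m, (0 < m)%N -> entropy1 R X <= log2 (npat X (@emb1 m))%:R / m%:R &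
      (fun n : nat => log2 (npat X (@emb1 n))%:R / n%:R : R) @ \oo --> entropy1 R X].
Proof.
move=> sX X0; rewrite entropy1E //.
have u0 n : (0 < npat X (@emb1 n))%N by apply: npat_gt0.
have uM n m : (0 < m)%N -> (npat X (@emb1 n) <= npat X (@emb1 m) ^ ((n %/ m + 1) ^ 1))%N.
  by rewrite expn1; apply: cover1.
rewrite (fekete_lim u0 uM); split; first exact: fekete_ge0.
  by move=> m m0; have := fekete_le 1 u0 m0; rewrite expr1.
by under eq_fun do rewrite -[X in _ / X]expr1; exact: fekete_cvg.
Qed.

Lemma entropy2_spec (X : set (int * int -> A)) : shift_inv X -> X !=set0 ->
  [/\ 0 <= entropy2 R X,
      forall m, (0 < m)%N -> entropy2 R X <= log2 (npat X (@emb2 m m))%:R / m%:R ^+ 2 &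
      (fun n : nat => log2 (npat X (@emb2 n n))%:R / n%:R ^+ 2 : R) @ \oo --> entropy2 R X].
Proof.
move=> sX X0; rewrite entropy2E //.
have u0 n : (0 < npat X (@emb2 n n))%N by apply: npat_gt0.
have uM n m : (0 < m)%N -> (npat X (@emb2 n n) <= npat X (@emb2 m m) ^ ((n %/ m + 1) ^ 2))%N.
  by apply: cover2.
rewrite (fekete_lim u0 uM); split; first exact: fekete_ge0.
  by move=> m m0; exact: (fekete_le 2 u0 m0).
exact: fekete_cvg.
Qed.

Lemma entropy_free (H : set (int -> A)) : shift_inv H -> H !=set0 ->
  entropy2 R (horizontally_constrained H fset0) = entropy1 R H.
Proof.
move=> sH H0; rewrite entropy1E // entropy2E; last exact: horiz_shift.
suff -> : (fun n : nat =>
    log2 (npat (horizontally_constrained H fset0) (@emb2 n n))%:R / n%:R ^+ 2 : R) =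
    (fun n : nat => log2 (npat H (@emb1 n))%:R / n%:R ^+ 1) by [].
apply: funext => n; rewrite npat_free // natrX log2X ?ltr0n ?npat_gt0 //.
have [->|n0] := posnP n; first by rewrite !mulr0n mul0r expr1 invr0 mulr0.
rewrite expr1 -[X in X / _]mulr_natr expr2; field.
by rewrite pnatr_eq0 -lt0n.
Qed.

Lemma free_subset (H : set (int -> A)) F :
  horizontally_constrained H F `<=` horizontally_constrained H fset0.
Proof. by move=> x [_ Hx]; split=> // p; rewrite in_fset0. Qed.

Lemma entropy_le_free (H : set (int -> A)) F : shift_inv H ->
  horizontally_constrained H F !=set0 ->
  entropy2 R (horizontally_constrained H F) <= entropy1 R H.
Proof.
move=> sH X0.
have H0 : H !=set0 by case: X0 => x [_ Hx]; exists (fun k => x (k, 0)); apply: Hx.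
have Y0 : horizontally_constrained H fset0 !=set0.
  by case: X0 => x Xx; exists x; apply: free_subset Xx.
rewrite -(entropy_free sH H0).
have [_ _ c1] := entropy2_spec (horiz_shift (F := F) sH) X0.
have [_ _ c2] := entropy2_spec (horiz_shift (F := fset0) sH) Y0.
rewrite -(cvg_lim (@Rhausdorff R) c2); apply: limr_ge; first exact: cvgP c2.
near=> n; have n0 : (0 < n)%N by near: n; exists 1%N.
have [_ + _] := entropy2_spec (horiz_shift (F := F) sH) X0 => /(_ n n0) /le_trans; apply.
rewrite ler_pM2r ?invr_gt0 ?exprn_gt0 ?ltr0n //; apply: ler_log2; first by rewrite ltr0n npat_gt0.
by rewrite ler_nat; apply: npat_subset; apply: free_subset.
Unshelve. all: by end_near.
Qed.
End Entropy.
End RealFacts.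

(** * Freely concatenable words in a one-dimensional SFT *)

Section Walks.
Variables (T : finType) (e : rel T).

Fixpoint walk_count (U : {set T}) n s : nat :=
  if n is n'.+1 then (\sum_(r in U | e s r) walk_count U n' r)%N else 1%N.

Fixpoint walk_count_to (U : {set T}) n s s' : nat :=
  if n is n'.+1 then (\sum_(r in U | e s r) walk_count_to U n' r s')%N else (s == s')%N.

Fixpoint walks n s : seq (seq T) :=
  if n is n'.+1 then [seq r :: t | r <- [seq r <- enum T | e s r], t <- walks n' r]
  else [:: [::]].

Lemma walksP n s t : (t \in walks n s) = (size t == n) && path e s t.
Proof.
elim: n s t => [|n IH] s t /=; first by rewrite inE; case: t.
apply/allpairsPdep/idP => [[r [t' [+ + ->]]]|].
  by rewrite mem_filter IH /= eqSS => /andP[-> _] /andP[-> ->].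
case: t => [//|r t] /=; rewrite eqSS => /and3P[st er pt]; exists r, t; split=> //.
  by rewrite mem_filter er mem_enum.
by rewrite IH st pt.
Qed.

Lemma walks_uniq n s : uniq (walks n s).
Proof.
elim: n s => [//|n IH] s /=; apply: allpairs_uniq_dep => [|//|].
  by apply: filter_uniq; apply: enum_uniq.
by move=> [r t] [r' t'] _ _ /= [-> ->].
Qed.

Lemma size_walks n s : size (walks n s) = walk_count finset.setT n s.
Proof.
elim: n s => [//|n IH] s /=; rewrite size_allpairs_dep sumnE big_map big_filter big_enum_cond /=.
by apply: eq_big => [r|r _]; rewrite ?inE.
Qed.

Lemma size_walks_to n s s' :
  size [seq t <- walks n s | last s t == s'] = walk_count_to finset.setT n s s'.
Proof.
elim: n s => [|n IH] s /=; first by case: (s == s').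
rewrite size_filter count_flatten -map_comp sumnE big_map big_filter big_enum_cond /=.
by apply: eq_big => [r|r _]; rewrite ?inE // count_map -IH size_filter.
Qed.

(** Cut a walk that meets [s] at its last visit: before it comes a walk from [r] to [s], after it a
    walk that avoids [s]. *)
Lemma last_visit (U : {set T}) s m r : s \in U ->
  (walk_count U m r = walk_count (U :\ s) m r +
    \sum_(l < m) walk_count_to U l.+1 r s * walk_count (U :\ s) (m.-1 - l) s)%N.
Proof.
move=> sU; elim: m r => [|m IH] r; first by rewrite big_ord0.
rewrite /= big_ord_recl /= subn0.
under eq_bigr => r' _ do rewrite IH.
rewrite big_split /= exchange_big /= addnA; congr (_ + _)%N; last first.
  apply: eq_bigr => l _; rewrite big_distrl /=.
  apply: eq_bigr => r' _; congr (_ * walk_count _ _ _)%N.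
  by rewrite /bump /= add1n; lia.
have E : (\sum_(r' in U | e r r') (r' == s) = e r s)%N.
  rewrite big_mkcond (bigD1 s) //= sU eqxx big1 ?addn0; first by case: (e r s).
  by move=> i /negPf ->; case: ifP.
rewrite E (bigID (pred1 s)) /= addnC; congr (_ + _)%N.
  by apply: eq_bigl => r'; rewrite !inE; case: (r' == s); rewrite ?andbF ?andbT.
case: (boolP (e r s)) => ers; last first.
  by rewrite mul0n big_pred0 // => i; case: eqP => [->|_]; rewrite ?(negPf ers) ?andbF.
rewrite mul1n (big_pred1 s) // => i.
by rewrite /=; case: eqP => [->|_]; rewrite ?ers ?sU ?andbF.
Qed.

Lemma walk_count_to_mono (U : {set T}) n s s' :
  (walk_count_to U n s s' <= walk_count_to finset.setT n s s')%N.
Proof.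
elim: n s => [//|n IH] s /=.
rewrite [X in (X <= _)%N]big_mkcond [X in (_ <= X)%N]big_mkcond leq_sum // => i _.
by rewrite inE /=; case: (i \in U) => //=; case: (e s i).
Qed.

Variables (R : realType) (g : R).
Hypotheses (g1 : 1 <= g)
  (loops_le : forall s l, (walk_count_to finset.setT l s s)%:R <= g ^+ l).

(** Induction on [#|U|]. The first vertex can be chosen in at most [#|T|] ways; cutting at the last
    visit to it leaves at most [m.+1] terms, each a loop, controlled by [g], followed by a walk in a
    smaller set. So walks outgrow loops by a polynomial factor only. *)
Lemma walk_count_le (U : {set T}) m s :
  (walk_count U m s)%:R <= (#|T| * m.+1)%N%:R ^+ #|U| * g ^+ m.
Proof.
have g0 : 0 <= g by apply: le_trans g1.
elim: {U}#|U| {-2}U (eqxx #|U|) m s => [|k IH] U /eqP cU m s.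
  move/cards0_eq: cU => ->; rewrite cards0 expr0 mul1r; case: m => [//|m] /=.
  by rewrite big_pred0 ?exprn_ge0 // => i; rewrite inE.
have T0 : (0 < #|T|)%N by apply/card_gt0P; exists s.
have inU n r : r \in U ->
    (walk_count U n r)%:R <= n.+1%:R * (#|T| * n.+1)%N%:R ^+ k * g ^+ n.
  move=> rU; have cU' : #|U :\ r| == k by have := cardsD1 r U; rewrite rU cU add1n => -[<-].
  rewrite (last_visit n r rU) natrD natr_sum.
  have bd l : (l <= n)%N -> g ^+ l * (walk_count (U :\ r) (n - l) r)%:R <=
      (#|T| * n.+1)%N%:R ^+ k * g ^+ n.
    move=> ln; rewrite -[X in _ <= _ * g ^+ X](subnKC ln) exprD mulrCA ler_wpM2l ?exprn_ge0 //.
    apply: le_trans (IH _ cU' _ _) _; rewrite (eqP cU') ler_wpM2r ?exprn_ge0 //.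
    by rewrite lerXn2r ?nnegrE ?ler0n // ler_nat leq_mul2l ltnS leq_subr orbT.
  have -> : n.+1%:R * (#|T| * n.+1)%N%:R ^+ k * g ^+ n = (#|T| * n.+1)%N%:R ^+ k * g ^+ n +
      \sum_(l < n) (#|T| * n.+1)%N%:R ^+ k * g ^+ n.
    by rewrite sumr_const card_ord -mulr_natr -mulrA -natr1; ring.
  apply: lerD; first by have := bd 0%N isT; rewrite expr0 mul1r subn0.
  apply: ler_sum => l _; apply: le_trans (bd l.+1 (ltn_ord l)).
  rewrite natrM; have -> : (n.-1 - l = n - l.+1)%N by have := ltn_ord l; lia.
  rewrite ler_wpM2r ?ler0n //; apply: le_trans (loops_le r l.+1).
  by rewrite ler_nat walk_count_to_mono.
rewrite cU exprS; case: m => [|m].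
  rewrite expr0 mulr1 -exprS muln1 /=; apply: exprn_ege1.
  by rewrite (ler_nat _ 1).
rewrite [walk_count _ _ _]/= natr_sum.
have -> : (#|T| * m.+2)%N%:R * (#|T| * m.+2)%N%:R ^+ k * g ^+ m.+1 =
    \sum_(r : T) m.+2%:R * (#|T| * m.+2)%N%:R ^+ k * g ^+ m.+1 :> R.
  by rewrite sumr_const -mulr_natr natrM; ring.
rewrite big_mkcond; apply: ler_sum => r _.
have ge0 n n' : 0 <= n.+1%:R * (#|T| * n.+1)%N%:R ^+ k * g ^+ n' :> R.
  by rewrite !mulr_ge0 ?exprn_ge0 ?ler0n.
case: ifP => [/andP[rU _]|_]; last exact: ge0.
apply: le_trans (inU _ _ rU) _; rewrite exprS [g * _]mulrC mulrA.
apply: le_trans (_ : _ <= m.+2%:R * (#|T| * m.+2)%N%:R ^+ k * g ^+ m) _; last first.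
  by rewrite ler_peMr.
rewrite ler_wpM2r ?exprn_ge0 // ler_pM ?exprn_ge0 ?ler0n ?ler_nat //.
by rewrite lerXn2r ?nnegrE ?ler0n // ler_nat leq_mul2l leqnSn orbT.
Qed.
End Walks.

Lemma pattern_bound (G : zmodType) (A : finType) (F : {fset pattern G A}) (f : G -> nat) :
  exists B, forall p u a, p \in F -> p.[? u]%fmap = Some a -> (f u <= B)%N.
Proof.
exists (\max_(p <- F) \max_(u <- domf p) f u)%N => p u a pF pu.
have up : u \in domf p by case: fndP pu.
have pF' : p \in enum_fset F := pF; have up' : u \in enum_fset (domf p) := up.
by apply: (leq_trans (leq_bigmax_seq (F := f) u up' isT));
  apply: (leq_trans (leq_bigmax_seq (F := fun p : pattern G A => \max_(u <- domf p) f u)%N p pF' isT)).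
Qed.

Lemma shift_nat (B : nat) (u : int) : (`|u| <= B)%N ->
  exists2 r : nat, (B%:Z + u)%R = r%:Z & (r < (B + B).+1)%N.
Proof. by move=> uB; exists `|(B%:Z + u)%R|%N; lia. Qed.

Lemma SFT_window (A : finType) (H : set (int -> A)) : is_SFT H ->
  exists2 M, (0 < M)%N & forall y : int -> A,
    (forall t, exists2 x, H x & forall r : nat, (r < M)%N -> y (t + r%:Z) = x r%:Z) -> H y.
Proof.
move=> [F ->]; have [B Bp] := pattern_bound F absz.
exists (B + B).+1 => // y yP p pF [t ap]; have [x Hx xP] := yP (t - B%:Z).
apply: (Hx p pF); exists B%:Z => u a pu; rewrite -(ap u a pu).
have [r Er rM] := shift_nat (Bp p u a pF pu).
have -> : t + u = t - B%:Z + r%:Z by rewrite -Er addrA subrK.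
by rewrite xP // -Er.
Qed.

Lemma euclz (l a : nat) (q k : int) : (a < l)%N -> k = q * l%:Z + a%:Z ->
  (k %/ l)%Z = q /\ `|(k %% l)%Z|%N = a.
Proof.
move=> al ->; have l0 : l%:Z != 0 by move: al; clear; lia.
rewrite divzMDl // modzMDl divz_small; last by move: al; clear; lia.
by rewrite addr0 modz_small //; move: al; clear; lia.
Qed.

Lemma euclz_eq (l : nat) (k : int) : (0 < l)%N ->
  k = (k %/ l)%Z * l%:Z + `|(k %% l)%Z|%N%:Z /\ (`|(k %% l)%Z| < l)%N.
Proof.
move=> l0; have h0 : 0 <= (k %% l)%Z by apply: modz_ge0; move: l0; clear; lia.
have h1 : (k %% l)%Z < l%:Z by apply: ltz_pmod; move: l0; clear; lia.
split; last by move: h0 h1; move: (k %% l)%Z; clear; lia.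
by rewrite gez0_abs // -divz_eq.
Qed.

(** Loops at [s] end where they begin, so any bi-infinite sequence of them is again a walk. *)
Lemma loop_words (A : finType) (H : set (int -> A)) M (s : {ffun 'I_M -> A}) l
    (e : rel {ffun 'I_M -> A}) : (0 < M)%N -> (0 < l)%N ->
  (forall B : int -> {ffun 'I_M -> A}, (forall k, e (B k) (B (k + 1))) ->
    exists2 x, H x & forall (k : int) (r : 'I_M), x (k * M%:Z + (r : nat)%:Z) = B k r) ->
  exists w : nat -> nat -> A,
    (forall c : int -> 'I_(walk_count_to e finset.setT l s s),
      H (fun i => w (c (i %/ (l * M)%N)%Z) `|(i %% (l * M)%N)%Z|%N)) /\
    (forall d d' : 'I_(walk_count_to e finset.setT l s s), d != d' ->
      exists2 r, (r < l * M)%N & w d r != w d' r).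
Proof.
move=> M0 l0 eH; pose W := [seq t <- walks e l s | last s t == s].
have szW : size W = walk_count_to e finset.setT l s s by rewrite size_walks_to.
have uW : uniq W by apply: filter_uniq; apply: walks_uniq.
have WP (d : 'I_(walk_count_to e finset.setT l s s)) :
    [/\ size (nth [::] W d) = l, path e s (nth [::] W d) & last s (nth [::] W d) = s].
  have := mem_nth [::] (_ : (d < size W)%N); rewrite szW ltn_ord => /(_ isT).
  by rewrite mem_filter walksP => /and3P[/eqP ? /eqP ? ?].
pose w d i := nth s (nth [::] W d) (i %/ M) (Ordinal (ltn_pmod i M0)).
exists w; split.
  move=> c; pose B (k : int) := nth s (nth [::] W (c (k %/ l)%Z)) `|(k %% l)%Z|%N.
  have eB k : e (B k) (B (k + 1)).
    have [s1 /(pathP s) p1 l1] := WP (c (k %/ l)%Z).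
    have [kE lt] := euclz_eq k l0.
    have [lt1|ge1] := ltnP `|(k %% l)%Z|.+1 l.
      have := p1 _ (_ : (`|(k %% l)%Z|.+1 < size (nth [::] W (c (k %/ l)%Z)))%N).
      rewrite s1 => /(_ lt1) /=; rewrite /B.
      have kE1 : k + 1 = (k %/ l)%Z * l%:Z + `|(k %% l)%Z|.+1%N%:Z.
        by rewrite {1}kE -addrA -PoszD addn1.
      by have [-> ->] := euclz lt1 kE1.
    have [s2 /(pathP s) p2 l2] := WP (c ((k + 1) %/ l)%Z).
    have := p2 0%N; rewrite s2 => /(_ l0) /=; rewrite /B.
    have E : `|(k %% l)%Z|%N = l.-1 by move: lt ge1; clear; lia.
    have kE1 : k + 1 = ((k %/ l)%Z + 1) * l%:Z + 0%N%:Z.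
      by rewrite {1}kE E mulrDl mul1r addr0 -addrA; congr (_ + _); move: l0; clear; lia.
    have [_ ->] := euclz l0 kE1.
    have nl (t : seq {ffun 'I_M -> A}) : size t = l -> last s t = s -> nth s t l.-1 = s.
      by move=> <-; rewrite nth_last.
    by rewrite E nl.
  have [x Hx xB] := eH B eB; suff -> : (fun i => w (c (i %/ (l * M)%N)%Z) `|(i %% (l * M)%N)%Z|%N) = x by [].
  apply: funext => i.
  have [Ei lt] := euclz_eq i M0; have [Eq lq] := euclz_eq (i %/ M)%Z l0.
  rewrite [in RHS]Ei (xB _ (Ordinal lt)) /w /B.
  have lt2 : (`|((i %/ M)%Z %% l)%Z| * M + `|(i %% M)%Z| < l * M)%N.
    by move: lt lq; clear; nia.
  have E2 : i = ((i %/ M)%Z %/ l)%Z * (l * M)%N%:Z +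
      (`|((i %/ M)%Z %% l)%Z| * M + `|(i %% M)%Z|)%N%:Z.
    by rewrite [LHS]Ei [in LHS]Eq PoszD !PoszM; ring.
  have [-> ->] := euclz lt2 E2.
  rewrite divnMDl // divn_small // addn0.
  by congr (_ _); apply: val_inj => /=; rewrite modnMDl modn_small.
move=> d d' dd'.
have [s1 _ _] := WP d; have [s2 _ _] := WP d'.
have [//|H0] := pselect (exists2 r, (r < l * M)%N & w d r != w d' r).
case/negP: dd'; apply/eqP/val_inj/eqP.
rewrite -(nth_uniq [::] _ _ uW) ?szW ?ltn_ord //; apply/eqP.
apply: (@eq_from_nth _ s) => [|i]; rewrite ?s1 ?s2 // => li.
apply/ffunP => r; apply/eqP/negP => /negP ne; apply: H0; exists (i * M + r)%N.
  by have := ltn_ord r; move: li; clear; nia.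
rewrite /w; have -> : ((i * M + r) %/ M = i)%N by rewrite divnMDl // divn_small // addn0.
suff -> : Ordinal (ltn_pmod (i * M + r) M0) = r by [].
by apply: val_inj; rewrite /= modnMDl modn_small.
Qed.

Lemma linear_lt_exp2 (R : realType) (C T d : R) : 0 <= C -> 0 <= T -> 0 < d ->
  exists j : nat, C + T * j%:R < d * 2 ^+ j.
Proof.
(* With [j = 2 * i], the power [2 ^ j] is the square of [2 ^ i], hence at least [(i + 1) ^ 2], which
   beats a linear function. *)
move=> C0 T0 d0; pose i := Num.truncn ((C + 2 * T) / d); exists (2 * i)%N.
have hi : (C + 2 * T) / d < i%:R + 1 by rewrite natr1; apply: Num.Theory.truncnS_gt.
rewrite ltr_pdivrMr // in hi.
have h2 : i%:R + 1 <= 2 ^+ i :> R by rewrite natr1 -natrX ler_nat; apply: ltn_expl.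
have i0 : 0 <= i%:R :> R by rewrite ler0n.
rewrite exprM exprAC expr2 natrM.
have h3 : (i%:R + 1) * (i%:R + 1) <= 2 ^+ i * 2 ^+ i :> R by apply: ler_pM => //; lra.
have h4 : (C + 2 * T) * (i%:R + 1) < (i%:R + 1) * d * (i%:R + 1) by rewrite ltr_pM2r //; lra.
have h5 : d * ((i%:R + 1) * (i%:R + 1)) <= d * (2 ^+ i * 2 ^+ i) by rewrite ler_pM2l.
have h6 : 0 <= C * i%:R by apply: mulr_ge0.
move: h4 h5 h6; move: (i%:R) (2 ^+ i * 2 ^+ i) => I P; nra.
Qed.

Section Loops.
Variables (R : realType) (A : finType) (H : set (int -> A)).
Hypotheses (HS : is_SFT H) (H0 : H !=set0).

Let sH : shift_inv H := SFT_shift HS.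

Let block_rel M : rel {ffun 'I_M -> A} := fun s s' =>
  `[< exists2 x, H x & forall r : 'I_M,
      s r = x (r : nat)%:Z /\ s' r = x (M%:Z + (r : nat)%:Z) >].

(** A window of length [M] meets at most two consecutive blocks, and for these two [block_rel]
    provides a point of [H]. *)
Let block_chain M (M0 : (0 < M)%N) :
  (forall y : int -> A, (forall t, exists2 x, H x & forall r : nat, (r < M)%N ->
     y (t + r%:Z) = x r%:Z) -> H y) ->
  forall B : int -> {ffun 'I_M -> A}, (forall k, block_rel (B k) (B (k + 1))) ->
    exists2 x, H x & forall (k : int) (r : 'I_M), x (k * M%:Z + (r : nat)%:Z) = B k r.
Proof.
move=> win B eB; pose y (i : int) := B (i %/ M)%Z (Ordinal (ltn_pmod `|(i %% M)%Z| M0)).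
have yE (k : int) (r : nat) (rM : (r < M)%N) : y (k * M%:Z + r%:Z) = B k (Ordinal rM).
  rewrite /y; have [-> ->] := euclz rM (erefl (k * M%:Z + r%:Z)).
  by congr (B k _); apply: val_inj; rewrite /= modn_small.
exists y; last by move=> k [r rM]; rewrite yE.
apply: win => t; have [tE tl] := euclz_eq t M0; set a := `|(t %% M)%Z|%N in tE tl.
have [x Hx xP] := asboolP _ (eB (t %/ M)%Z).
exists (fun u => x (a%:Z + u)); first exact: sH.
move=> r rM; rewrite {1}tE -addrA -PoszD.
have [lt|ge] := ltnP (a + r) M.
  by rewrite (yE _ _ lt); have [-> _] := xP (Ordinal lt).
have lt : (a + r - M < M)%N by move: rM tl; clear; lia.
have -> : (t %/ M)%Z * M%:Z + (a + r)%N%:Z = ((t %/ M)%Z + 1) * M%:Z + (a + r - M)%N%:Z.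
  by rewrite -subzn // mulrDl mul1r; ring.
rewrite (yE _ _ lt); have [_ ->] := xP (Ordinal lt).
by congr x; rewrite /= -subzn //; ring.
Qed.

Let npat_walks M n : (0 < M)%N ->
  (npat H (@emb1 (n.+1 * M)) <= \sum_s walk_count (@block_rel M) finset.setT n s)%N.
Proof.
move=> M0; have [x0 _] := H0; pose s0 : {ffun 'I_M -> A} := [ffun => x0 0].
pose W := [seq s :: t | s <- enum {ffun 'I_M -> A}, t <- walks (@block_rel M) n s].
have -> : (\sum_s walk_count (@block_rel M) finset.setT n s)%N = size W.
  rewrite size_allpairs_dep sumnE big_map big_enum /=.
  by apply: eq_bigr => s _; rewrite size_walks.
rewrite -[size W]card_ord -cardsT.
pose P (x : int -> A) (c : 'I_(size W)) := forall k (r : 'I_M), (k <= n)%N ->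
  nth s0 (nth [::] W c) k r = x (k * M + r)%N%:Z.
apply: (@npat_le _ _ _ _ _ _ _ P).
  move=> x Hx; pose bl k : {ffun 'I_M -> A} := [ffun r : 'I_M => x (k * M + r)%N%:Z].
  have inW : mkseq bl n.+1 \in W.
    apply/allpairsPdep; exists (bl 0%N), (behead (mkseq bl n.+1)); split=> //.
      by rewrite mem_enum.
    rewrite walksP size_behead size_mkseq eqxx /=.
    apply/(pathP s0) => i; rewrite size_map size_iota => li.
    have -> : nth s0 (bl 0%N :: [seq bl i | i <- iota 1 n]) i = bl i.
      have -> : bl 0%N :: [seq bl i | i <- iota 1 n] = mkseq bl n.+1 by [].
      by rewrite nth_mkseq // ltnW.
    rewrite (nth_map 0%N) ?size_iota // nth_iota // add1n.
    apply/asboolP; exists (fun u => x ((i * M)%N%:Z + u)); first exact: sH.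
    move=> r; rewrite !ffunE; split; first by rewrite PoszD.
    by congr x; rewrite mulSn !PoszD; ring.
  have lt : (index (mkseq bl n.+1) W < size W)%N by rewrite index_mem.
  exists (Ordinal lt); rewrite ?inE // => k r kn /=.
  by rewrite nth_index // nth_mkseq // ffunE.
move=> x y c _ _ Px Py i; rewrite /emb1.
have lk : (i %/ M <= n)%N by rewrite -ltnS ltn_divLR.
rewrite (divn_eq i M); have := Px _ (Ordinal (ltn_pmod i M0)) lk.
by rewrite /= => <-; have := Py _ (Ordinal (ltn_pmod i M0)) lk.
Qed.

(** Here [g] is [2 ^ (M h)]. If at every vertex the loops of each length [l] numbered at most
    [g ^ l], the words of [H] would have rate at most [h], the polynomial factor being
    negligible. *)
Theorem SFT_loops (h : R) : 0 <= h -> h < entropy1 R H ->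
  exists L D (w : nat -> nat -> A), [/\ (0 < L)%N /\ (0 < D)%N, L%:R * h < log2 D%:R,
    forall c : int -> 'I_D, H (fun i => w (c (i %/ L)%Z) `|(i %% L)%Z|%N) &
    forall d d' : 'I_D, d != d' -> exists2 r, (r < L)%N & w d r != w d' r].
Proof.
move=> h0 hH; have [M M0 win] := SFT_window HS.
pose g : R := expR (M%:R * h * ln 2).
have ln2 : 0 < ln 2 :> R := ln2_gt0 R.
have g1 : 1 <= g by rewrite -expR0 ler_expR !mulr_ge0 ?ler0n // ltW.
have lg n : log2 (g ^+ n) = (n * M)%:R * h.
  rewrite log2X ?expR_gt0 // /log2 expRK mulfK ?gt_eqF //.
  by rewrite -[LHS]mulr_natl natrM; ring.
have [|no] := pselect (exists s l, (0 < l)%N /\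
    g ^+ l < (walk_count_to (@block_rel M) finset.setT l s s)%:R).
  move=> [s [l [l0 big]]].
  have [w [w1 w2]] := loop_words s M0 l0 (block_chain M0 win).
  exists (l * M)%N, (walk_count_to (@block_rel M) finset.setT l s s), w.
  have D1 : g ^+ l > 0 by rewrite exprn_gt0 // expR_gt0.
  split=> //; first by split; [rewrite muln_gt0 l0|rewrite -(ltr_nat R); apply: lt_trans big].
  rewrite -lg /log2 ltr_pM2r ?invr_gt0 // ltr_ln // posrE //.
  exact: lt_trans big.
have loops s l : (walk_count_to (@block_rel M) finset.setT l s s)%:R <= g ^+ l.
  case: l => [|l]; first by rewrite /= eqxx.
  by rewrite leNgt; apply/negP => lt; apply: no; exists s, l.+1.
have [x0 _] := H0.
set T := #|{ffun 'I_M -> A}|; have T0 : (0 < T)%N.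
  by apply/card_gt0P; exists [ffun => x0 0].
have [_ inf _] := entropy1_spec R sH H0.
have M0R : 0 < M%:R :> R by rewrite ltr0n.
have T1 : 1 <= T%:R :> R by rewrite (ler_nat _ 1).
have lT : 0 <= log2 (T%:R : R) by apply: log2_ge0.
have bound n : entropy1 R H * (n.+1 * M)%:R <=
    log2 T%:R + T%:R * log2 (T * n.+1)%N%:R + (n * M)%:R * h.
  have p0 : (0 < n.+1 * M)%N by rewrite muln_gt0.
  have := inf _ p0; rewrite ler_pdivlMr ?ltr0n // => /le_trans; apply.
  rewrite -lg mulr_natl -log2X; last by rewrite ltr0n muln_gt0 T0.
  have q0 : 0 < (T * n.+1)%N%:R ^+ T :> R by rewrite exprn_gt0 // ltr0n muln_gt0 T0.
  have q1 : 0 < g ^+ n by rewrite exprn_gt0 // expR_gt0.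
  rewrite -!log2M ?mulr_gt0 ?ltr0n //; apply: ler_log2.
    by rewrite ltr0n npat_gt0.
  apply: (@le_trans _ _ (\sum_s walk_count (@block_rel M) finset.setT n s)%N%:R).
    by rewrite ler_nat npat_walks.
  rewrite natr_sum; apply: le_trans (_ : _ <= \sum_(s : {ffun 'I_M -> A}) ((T * n.+1)%N%:R ^+ T * g ^+ n)) _.
    apply: ler_sum => s _; have := walk_count_le g1 loops finset.setT n s.
    by rewrite cardsT.
  by rewrite sumr_const -[leLHS]mulr_natl mulrA.
have [|||j] := @linear_lt_exp2 R (log2 T%:R + T%:R * log2 T%:R) T%:R ((entropy1 R H - h) * M%:R).
- by apply: addr_ge0 => //; apply: mulr_ge0 => //; rewrite ler0n.
- by rewrite ler0n.
- by rewrite mulr_gt0 // subr_gt0.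
(* The bound is applied with [n.+1 = 2 ^ j], so that its logarithmic term is linear in [j]. *)
have E : (2 ^ j).-1.+1 = (2 ^ j)%N by rewrite prednK // expn_gt0.
have := bound (2 ^ j).-1; rewrite E.
have -> : log2 (T * 2 ^ j)%N%:R = log2 T%:R + j%:R :> R.
  by rewrite natrM log2M ?ltr0n ?expn_gt0 // natrX log2_exp2.
have nM : ((2 ^ j).-1 * M)%:R * h <= 2 ^+ j * M%:R * h.
  by rewrite ler_wpM2r // natrM -natrX ler_wpM2r ?ler0n // ler_nat leq_pred.
rewrite natrM natrX => b1 b2; move: nM b1 b2; set p := 2 ^+ j; set X := _ * h.
by move: X => X; nra.
Qed.
End Loops.

(* [wd (true, v0)] serves as a horizontal phase marker: its periodic repetition has no
   period smaller than [K]. *)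
Record macro_words (A : finType) (H : set (int -> A)) (K n : nat) := MacroWords {
  mw_V : finType;
  mw_v0 : mw_V;
  mw_wd : bool * mw_V -> nat -> A;
  mw_card : (2 ^ n <= #|mw_V|)%N;
  mw_free : forall c : int -> bool * mw_V,
    H (fun i => mw_wd (c (i %/ K)%Z) `|(i %% K)%Z|%N);
  mw_inj : forall c c', (forall r, (r < K)%N -> mw_wd c r = mw_wd c' r) -> c = c';
  mw_prim : forall t : int,
    (forall i : int, mw_wd (true, mw_v0) `|((i + t)%R %% K)%Z|%N =
                     mw_wd (true, mw_v0) `|(i %% K)%Z|%N) -> (K %| t)%Z }.

Section Macro.
Variables (A : finType) (H : set (int -> A)) (L D : nat) (w : nat -> nat -> A).
Hypotheses (L0 : (0 < L)%N) (D2 : (1 < D)%N)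
  (wH : forall c : int -> 'I_D, H (fun i => w (c (i %/ L)%Z) `|(i %% L)%Z|%N))
  (wI : forall d d' : 'I_D, d != d' -> exists2 r, (r < L)%N & w d r != w d' r).

Variables (k m : nat).
Hypotheses (Lk : (L %| k)%N) (k1 : (0 < k)%N) (mk : (2 ^ m <= D ^ k.-1)%N).

Let d0 : 'I_D := Ordinal (ltnW D2).
Let d1 : 'I_D := Ordinal D2.
Let V := {ffun 'I_k.-1 -> 'I_D}.
Let v0 : V := [ffun => d0].
(** A macro word consists of [k] loops: the first one, [d0] or [d1], is the boolean, and the others
    spell [v]. In the repetition of the word of [(true, v0)], the loop [d1] occurs exactly every [k]
    loops. *)
Let sym (c : bool * V) (q : nat) : 'I_D :=
  if q is q'.+1 then (if insub q' is Some i then c.2 i else d0) else if c.1 then d1 else d0.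
Let wd c i := w (sym c (i %/ L)%N) (i %% L)%N.
Let K := (k * L)%N.

Let wdE (c : int -> bool * V) (i : int) :
  wd (c (i %/ K)%Z) `|(i %% K)%Z|%N =
  w (sym (c ((i %/ L)%Z %/ k)%Z) `|((i %/ L)%Z %% k)%Z|%N) `|(i %% L)%Z|%N.
Proof.
have [Ei lt] := euclz_eq i L0; have [Eq lq] := euclz_eq (i %/ L)%Z k1.
have lt2 : (`|((i %/ L)%Z %% k)%Z| * L + `|(i %% L)%Z| < k * L)%N.
  by move: lt lq; clear; nia.
have E2 : i = ((i %/ L)%Z %/ k)%Z * (k * L)%N%:Z +
    (`|((i %/ L)%Z %% k)%Z| * L + `|(i %% L)%Z|)%N%:Z.
  by rewrite [LHS]Ei [in LHS]Eq PoszD !PoszM; ring.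
rewrite /K; have [-> ->] := euclz lt2 E2.
by rewrite /wd divnMDl // divn_small // addn0 modnMDl modn_small.
Qed.

Let wd_inj c c' : (forall r, (r < K)%N -> wd c r = wd c' r) -> c = c'.
Proof.
move=> E; have S q : (q < k)%N -> sym c q = sym c' q.
  move=> qk; apply/eqP/negP => /negP /wI[r rL]; case/negP; apply/eqP.
  have := E (q * L + r)%N; rewrite /wd divnMDl // divn_small // addn0 modnMDl modn_small //.
  by apply; rewrite /K; move: qk rL; clear; nia.
case: c c' S E => [b v] [b' v'] S _; congr (_, _).
  by have := S 0%N k1; rewrite /sym /=; case: b b' {S} => [] [].
apply/ffunP => i; have lt : (i.+1 < k)%N by have := ltn_ord i; move: k1; clear; lia.
by have := S _ lt; rewrite /sym /= valK.
Qed.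

Let rho (q : int) : 'I_D := if (k %| q)%Z then d1 else d0.

Let rhoE (i : int) : wd (true, v0) `|(i %% K)%Z|%N = w (rho (i %/ L)%Z) `|(i %% L)%Z|%N.
Proof.
rewrite (wdE (fun=> (true, v0))) /rho; congr (w (val _) _).
have [Eq lq] := euclz_eq (i %/ L)%Z k1.
have -> : (k %| (i %/ L)%Z)%Z = (k %| `|((i %/ L)%Z %% k)%Z|%N%:Z)%Z.
  by rewrite {1}Eq rpredDl // dvdz_mull.
move: lq; case: (`|_|%N) => [|q] lq /=; first by rewrite dvdz0.
have -> : (k %| q.+1%:Z)%Z = false by apply/negP; rewrite dvdzE => /dvdn_leq /= /(_ isT); move: lq; clear; lia.
by case: insub => // i'; rewrite ffunE.
Qed.

(** A period [t] is not known to be a multiple of [L], but [t * L] is a period too, and comparing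
    loops gives [k %| t]. As [L] divides [k], it divides [t] after all, and comparing loops once
    more gives the conclusion. *)
Let rho_prim (t : int) :
  (forall i : int, wd (true, v0) `|((i + t)%R %% K)%Z|%N = wd (true, v0) `|(i %% K)%Z|%N) ->
  (K %| t)%Z.
Proof.
move=> per; have L0z : L%:Z != 0 by move: L0; clear; lia.
have perL s : (forall i : int, wd (true, v0) `|((i + s * L%:Z)%R %% K)%Z|%N =
    wd (true, v0) `|(i %% K)%Z|%N) -> (k %| s)%Z.
  move=> ps; have E : rho s = rho 0.
    apply/eqP/negP => /negP /wI[r rL]; case/negP; apply/eqP.
    have := ps r%:Z; rewrite !rhoE addrC.
    have [-> ->] := euclz rL (erefl (s * L%:Z + r%:Z)).
    have rE : r%:Z = 0 * L%:Z + r%:Z by rewrite mul0r add0r.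
    by have [-> ->] := euclz rL rE.
  by move: E; rewrite /rho dvdz0; case: ifP.
have perM n : forall i : int, wd (true, v0) `|((i + t * n%:Z)%R %% K)%Z|%N =
    wd (true, v0) `|(i %% K)%Z|%N.
  elim: n => [|n IH] i; first by rewrite mulr0 addr0.
  have -> : i + t * n.+1%:Z = (i + t * n%:Z) + t by rewrite -addn1 PoszD; ring.
  by rewrite per IH.
have kt : (k %| t)%Z by apply: perL; apply: perM.
have Lt : (L %| t)%Z by apply: dvdz_trans kt; apply: Lk.
have /dvdzP[t' tE] := Lt; rewrite tE /K PoszM dvdz_mul //.
by apply: perL => i; rewrite -tE.
Qed.

Lemma macro_words_ex : inhabited (macro_words H (k * L) m).
Proof.
constructor; exists V v0 wd => //.
- by rewrite card_ffun !card_ord.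
- move=> c; rewrite -/K; have -> : (fun i : int => wd (c (i %/ K)%Z) `|(i %% K)%Z|%N) =
    (fun i => w (sym (c ((i %/ L)%Z %/ k)%Z) `|((i %/ L)%Z %% k)%Z|%N) `|(i %% L)%Z|%N).
    by apply: funext => i; rewrite wdE.
  exact: (wH (fun q => sym (c (q %/ k)%Z) `|(q %% k)%Z|%N)).
Qed.
End Macro.

Theorem SFT_macro_words (R : realType) (A : finType) (H : set (int -> A)) (h : R) :
  is_SFT H -> H !=set0 -> 0 <= h -> h < entropy1 R H ->
  exists K m : nat, [/\ (0 < K)%N, h * K%:R < m%:R &
    forall r, (0 < r)%N -> inhabited (macro_words H (r * K) (r * m))].
Proof.
move=> HS H0 h0 hH; have [L [D [w [[L0 D0] Lh wH wI]]]] := SFT_loops HS H0 h0 hH.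
have lD0 : 0 < log2 D%:R :> R by apply: le_lt_trans Lh; rewrite mulr_ge0 ?ler0n.
have D2 : (1 < D)%N.
  case: D D0 lD0 {Lh wH wI} => [|[|D]] // _.
  by rewrite /log2 ln1 mul0r ltxx.
pose e := log2 D%:R - L%:R * h; have e0 : 0 < e by rewrite subr_gt0.
(* The boolean costs one loop, hence [log2 D], and rounding the logarithm costs at most one bit; [q]
   is chosen so that the surplus pays for both. The factor [L] in [k] serves the primitivity of the
   marker. *)
pose q := (Num.truncn ((log2 D%:R + 1) / e)).+1.
have qP : log2 D%:R + 1 < q%:R * e.
  by rewrite -ltr_pdivrMr //; apply: Num.Theory.truncnS_gt.
pose k := (q * L)%N; have k0 : (0 < k)%N by rewrite muln_gt0.
pose m := trunc_log 2 (D ^ k.-1).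
have Dk0 : (0 < D ^ k.-1)%N by rewrite expn_gt0 D0.
exists (k * L)%N, m; split; first by rewrite muln_gt0 k0.
  have : (D ^ k.-1 < 2 ^ m.+1)%N by apply: trunc_log_ltn.
  rewrite -(ltr_nat R) => lt.
  have : log2 (D ^ k.-1)%N%:R < m.+1%:R :> R.
    rewrite -[ltRHS]log2_exp2 -natrX /log2 ltr_pM2r ?invr_gt0; last exact: ln2_gt0.
    by rewrite ltr_ln // posrE ltr0n // expn_gt0.
  rewrite natrX log2X ?ltr0n // -[X in X < _]mulr_natr.
  have -> : k.-1%:R = k%:R - 1 :> R by rewrite -[in RHS](prednK k0) -natr1 addrK.
  have qk : q%:R <= k%:R :> R by rewrite ler_nat leq_pmulr.
  rewrite -natr1 natrM => l1.
  have : log2 D%:R + 1 < k%:R * e by apply: lt_le_trans qP _; rewrite ler_pM2r.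
  have arith (x y z u : R) : x * (y - 1) < u + 1 -> x + 1 < y * (x - z * h) -> h * (y * z) < u.
    by clear; lra.
  exact: arith l1.
move=> r r0; have := @macro_words_ex A H L D w L0 D2 wH wI (r * k) (r * m).
rewrite mulnA; apply.
- by rewrite dvdn_mull // dvdn_mull.
- by rewrite muln_gt0 r0.
- apply: leq_trans (_ : (D ^ k.-1) ^ r <= _)%N; last first.
    rewrite -expnM leq_pexp2l //; move: k0 r0; clear; nia.
  by rewrite mulnC expnM leq_exp2r // trunc_logP.
Qed.

(** * Coding tilings in rows of H *)

(** Forbid each pattern of support [W] that no element of [X] shows there; being functions on a
    finite set, these patterns are finitely many. *)
Lemma avoiding_windows (G : zmodType) (A : finType) (W : {fset G}) (X : set (G -> A)) :
  exists F, forall x, avoiding F x <->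
    forall t, exists2 y, X y & forall u, u \in W -> x (t + u) = y u.
Proof.
pose occ (p : {ffun W -> A}) := exists2 y, X y & forall u : W, p u = y (val u).
exists [fset (FinMap p : pattern G A) | p in {ffun W -> A} & `[< ~ occ p >]]%fset.
move=> x; split.
  move=> aF t; pose p : {ffun W -> A} := [ffun u => x (t + val u)].
  have [[y Xy py]|no] := pselect (occ p).
    by exists y => // u uW; have := py (FSetSub uW); rewrite ffunE.
  case: (aF (FinMap p)).
    by apply/imfsetP; exists p => //; apply/asboolP.
  exists t => u a; have [uW|uW] := boolP (u \in W); last by rewrite not_fnd.
  by rewrite in_fnd ffunE /= => -[].
move=> win p /imfsetP[q /asboolP no ->] [t ap]; apply: no.
have [y Xy yP] := win t; exists y => // u; rewrite -(yP _ (valP u)).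
by apply/esym/ap; rewrite in_fnd => [|uW]; [exact: valP|congr (Some (q _)); apply: val_inj].
Qed.

Lemma fin_embed (S T : finType) : (#|S| <= #|T|)%N -> T -> exists f : S -> T, injective f.
Proof.
move=> le t0; exists (fun s => nth t0 (enum T) (enum_rank s)) => s s' /eqP.
have lt x : (@enum_rank S x < size (enum T))%N by rewrite -cardE; apply: leq_trans le.
by rewrite nth_uniq ?enum_uniq // => /eqP /val_inj /enum_rank_inj.
Qed.

Section Coding.
Variables (A : finType) (H : set (int -> A)) (K m : nat) (W : macro_words H K m).
Variables (f : 2.-tuple nat -> nat) (dt : density_tiles f) (N u0 : nat).
Hypotheses (K0 : (0 < K)%N) (Nodd : odd N) (uN : (u0 + 4 <= N)%N).
Local Notation B := (dt_B dt).
Local Notation V := (mw_V W).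
Local Notation wd := (@mw_wd _ _ _ _ W).
Local Notation Q := ('I_(2 ^ m)).
Variables (code : B -> V) (emb : Q -> V).
Hypotheses (codeI : injective code) (embI : injective emb).

Definition weight (b : B) : nat := (u0 + dt_sel b)%N.

(* Rows 0 and 1 of a block are equal, and no other consecutive rows of a configuration
   are, since the booleans alternate ([N] is odd): this fixes the vertical phase. Row 2
   fixes the horizontal one. Rows 3 to [weight b + 2] are free. *)
Definition block_row (b : B) (g : nat -> Q) (ry : nat) : bool * V :=
  if (ry < 2)%N then (false, code b)
  else if ry == 2%N then (true, mw_v0 W)
  else (~~ odd ry, if (ry < weight b + 3)%N then emb (g ry) else mw_v0 W).

Definition config (S1 S2 : int) (z : int -> int -> B) (g : int -> int -> nat -> Q)
    (u : int * int) : A :=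
  let P := ((u.1 - S1)%R %/ K)%Z in let R := ((u.2 - S2)%R %/ N)%Z in
  wd (block_row (z P R) (g P R) `|((u.2 - S2)%R %% N)%Z|%N) `|((u.1 - S1)%R %% K)%Z|%N.

Definition coded : set (int * int -> A) := [set x | exists S1 S2 z g,
  tiling_by (dt_T (d := dt)) z /\ x = config S1 S2 z g].

Let N0 : (0 < N)%N. Proof. by move: uN; clear; lia. Qed.

Lemma configE S1 S2 z g (P R : int) (rx ry : nat) : (rx < K)%N -> (ry < N)%N ->
  config S1 S2 z g (S1 + P * K%:Z + rx%:Z, S2 + R * N%:Z + ry%:Z) =
  wd (block_row (z P R) (g P R) ry) rx.
Proof.
move=> lx ly; rewrite /config /=.
have -> : S1 + P * K%:Z + rx%:Z - S1 = P * K%:Z + rx%:Z by ring.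
have -> : S2 + R * N%:Z + ry%:Z - S2 = R * N%:Z + ry%:Z by ring.
by have [-> ->] := euclz lx (erefl (P * K%:Z + rx%:Z));
  have [-> ->] := euclz ly (erefl (R * N%:Z + ry%:Z)).
Qed.

Lemma config_translate S1 S2 z g a b :
  config (S1 + a * K%:Z) (S2 + b * N%:Z) z g =
  config S1 S2 (fun P R => z (P - a) (R - b)) (fun P R => g (P - a) (R - b)).
Proof.
apply: funext => -[i j]; rewrite [RHS]/config /=.
have [iE lx] := euclz_eq (i - S1) K0; have [jE ly] := euclz_eq (j - S2) N0.
move: iE jE lx ly; move: ((i - S1)%R %/ K)%Z ((j - S2)%R %/ N)%Z => P R.
move: `|((i - S1)%R %% K)%Z|%N `|((j - S2)%R %% N)%Z|%N => rx ry iE jE lx ly.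
have -> : i = S1 + a * K%:Z + (P - a) * K%:Z + rx%:Z.
  by rewrite -[LHS](subrK S1) iE; ring.
have -> : j = S2 + b * N%:Z + (R - b) * N%:Z + ry%:Z.
  by rewrite -[LHS](subrK S2) jE; ring.
by rewrite configE.
Qed.

Lemma coded_shift : shift_inv coded.
Proof.
move=> x [t1 t2] [S1 [S2 [z [g [tz ->]]]]]; exists (S1 - t1), (S2 - t2), z, g; split=> //.
apply: funext => -[i j]; rewrite /config /=.
have -> : t1 + i - S1 = i - (S1 - t1) by ring.
by have -> : t2 + j - S2 = j - (S2 - t2) by ring.
Qed.

Lemma block_row_neq b g ry : (ry.+1 < N)%N -> (0 < ry)%N ->
  block_row b g ry <> block_row b g ry.+1.
Proof.
move=> lt; case: ry lt => [//|[|[|ry]]] lt _; rewrite /block_row //=.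
by case=> E _; move: E; case: (odd ry).
Qed.

(** Any [2 * K] consecutive columns contain a whole macro word of each row, so by [mw_inj] equal
    rows force equal letters of [block_row]. *)
Lemma config_rows S1 S2 z g (i0 j : int) :
  (forall i, i0 <= i < i0 + (2 * K)%N%:Z ->
     config S1 S2 z g (i, j) = config S1 S2 z g (i, j + 1)) <-> (N %| j - S2)%Z.
Proof.
have [jE ly] := euclz_eq (j - S2) N0.
move: jE ly; move: ((j - S2)%R %/ N)%Z `|((j - S2)%R %% N)%Z|%N => R ry jE ly.
have jE' : j = S2 + R * N%:Z + ry%:Z by rewrite -[LHS](subrK S2) jE; ring.
split.
  move=> E; have [iE lx] := euclz_eq (i0 - S1) K0.
  move: iE lx; move: ((i0 - S1)%R %/ K)%Z `|((i0 - S1)%R %% K)%Z|%N => P rx iE lx.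
  have E' r : (r < K)%N -> config S1 S2 z g (S1 + (P + 1) * K%:Z + r%:Z, j) =
      config S1 S2 z g (S1 + (P + 1) * K%:Z + r%:Z, j + 1).
    move=> rK; apply: E; have -> : S1 + (P + 1) * K%:Z + r%:Z = i0 + (K%:Z - rx%:Z + r%:Z).
      by rewrite -[i0 in RHS](subrK S1) iE; ring.
    by move: rK lx; clear; lia.
  have [ry0|ry0] := posnP ry.
    by rewrite jE ry0 addr0 dvdz_mull.
  have [lt|ge] := ltnP ry.+1 N.
    case: (@block_row_neq (z (P + 1) R) (g (P + 1) R) ry) => //; apply: mw_inj => r rK.
    have := E' r rK; rewrite jE' configE //.
    have -> : S2 + R * N%:Z + ry%:Z + 1 = S2 + R * N%:Z + ry.+1%:Z by rewrite -addrA -PoszD addn1.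
    by rewrite configE.
  have ryE : ry = N.-1 by move: ly ge; clear; lia.
  have : block_row (z (P + 1) R) (g (P + 1) R) ry = block_row (z (P + 1) (R + 1)) (g (P + 1) (R + 1)) 0.
    apply: mw_inj => r rK; have := E' r rK; rewrite jE' configE //.
    have -> : S2 + R * N%:Z + ry%:Z + 1 = S2 + (R + 1) * N%:Z + 0%N%:Z.
      rewrite ryE mulrDl mul1r addr0 -!addrA; congr (_ + (_ + _)); move: N0; clear; lia.
    by rewrite configE.
  have ry4 : (3 <= ry)%N by move: uN ryE; clear; lia.
  have ev : ~~ odd ry by move: Nodd N0; rewrite ryE; clear; lia.
  rewrite /block_row ltnNge (leq_trans _ ry4) //= ev.
  by case: eqP.
move=> dv i _; have ry0 : ry = 0%N.
  move: dv; rewrite jE rpredDl ?dvdz_mull // dvdzE /= => dv.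
  by case: ry ly dv {jE jE'} => // r lr /(dvdn_leq (ltn0Sn r)); rewrite leqNgt lr.
have [iE lx] := euclz_eq (i - S1) K0.
move: iE lx; move: ((i - S1)%R %/ K)%Z `|((i - S1)%R %% K)%Z|%N => P rx iE lx.
have -> : i = S1 + P * K%:Z + rx%:Z by rewrite -[LHS](subrK S1) iE; ring.
have -> : j + 1 = S2 + R * N%:Z + 1%N%:Z by rewrite jE' ry0 addr0.
by rewrite jE' configE // configE // ?ry0 //; move: uN; clear; lia.
Qed.

(** The two equal rows are visible in any [N.+1] consecutive rows and give the vertical phase. This
    locates the marker row, whose repeated word has no smaller period, and hence the horizontal
    phase. *)
Lemma config_phases S1 S2 z g S1' S2' z' g' (i0 j0 : int) :
  (forall i j, i0 <= i < i0 + (2 * K)%N%:Z -> j0 <= j < j0 + N.+1%:Z ->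
     config S1 S2 z g (i, j) = config S1' S2' z' g' (i, j)) ->
  (K %| S1' - S1)%Z /\ (N %| S2' - S2)%Z.
Proof.
move=> E.
have findj (s : int) : exists2 j : int, j0 <= j < j0 + N%:Z & (N %| j - s)%Z.
  have [jE ly] := euclz_eq (s - j0) N0.
  move: jE ly; move: ((s - j0)%R %/ N)%Z `|((s - j0)%R %% N)%Z|%N => q r jE ly.
  exists (j0 + r%:Z); first by move: ly; clear; lia.
  have -> : j0 + r%:Z - s = - q * N%:Z by rewrite -[s in LHS](subrK j0) jE; ring.
  by rewrite dvdz_mull.
have dN : (N %| S2' - S2)%Z.
  have [j jj dj] := findj S2.
  have : (N %| j - S2')%Z.
    apply/(config_rows S1' S2' z' g' i0) => i ii; rewrite -!E //; try by move: jj; clear; lia.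
    by apply: (config_rows S1 S2 z g i0 j).2.
  have -> : S2' - S2 = (j - S2) - (j - S2') by ring.
  by move=> dj'; rewrite rpredB.
split=> //.
have [j jj dj] := findj (S2 + 2).
have phase T1 T2 zz gg i : (N %| j - (T2 + 2))%Z -> config T1 T2 zz gg (i, j) =
    wd (true, mw_v0 W) `|((i - T1)%R %% K)%Z|%N.
  move=> /dvdzP[R RE]; rewrite /config /=.
  have l2 : (2 < N)%N by move: uN; clear; lia.
  have jE : j - T2 = R * N%:Z + 2%:Z.
    by rewrite -RE; ring.
  by have [-> ->] := euclz l2 jE.
have dj' : (N %| j - (S2' + 2))%Z.
  have -> : j - (S2' + 2) = (j - (S2 + 2)) - (S2' - S2) by ring.
  by rewrite rpredB.
apply: (@mw_prim _ _ _ _ W) => i.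
have [iE lx] := euclz_eq (i + S1' - i0) K0.
move: iE lx; move: ((i + S1' - i0)%R %/ K)%Z `|((i + S1' - i0)%R %% K)%Z|%N => P r iE lr.
have := E (i0 + r%:Z) j _ _.
rewrite (phase S1 S2 z g _ dj) (phase S1' S2' z' g' _ dj') => E1.
have KP k (q : int) : `|((k + q * K%:Z)%R %% K)%Z|%N = `|(k %% K)%Z|%N by rewrite addrC modzMDl.
have -> : i + (S1' - S1) = i0 + r%:Z - S1 + P * K%:Z.
  by rewrite -[LHS](_ : i + S1' - i0 + (i0 - S1) = _); [rewrite iE; ring|ring].
have -> : i = i0 + r%:Z - S1' + P * K%:Z.
  by rewrite -[LHS](_ : i + S1' - i0 + (i0 - S1') = _); [rewrite iE; ring|ring].
rewrite !KP; apply: E1; first by move: lr; clear; lia.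
by move: jj; clear; lia.
Qed.

Definition window : {fset int * int} :=
  ([fset (val k)%:Z | k in 'I_((2 * K).+1)] `*` [fset (val k)%:Z | k in 'I_((2 * N).+1)])%fset.

Lemma windowP (a b : nat) : (a <= 2 * K)%N -> (b <= 2 * N)%N -> (a%:Z, b%:Z) \in window.
Proof.
move=> la lb; rewrite in_fsetM /=; apply/andP; split; apply/imfsetP.
  by exists (Ordinal (la : a < (2 * K).+1)%N).
by exists (Ordinal (lb : b < (2 * N).+1)%N).
Qed.

(** The overlap of two neighbouring windows suffices to read the phases, so these are the same for
    all windows. A window also contains a square of two by two blocks, on which the constraint
    between a tile and its right and upper neighbours is checked. *)
Lemma window_coded (x : int * int -> A) :
  (forall t, exists2 y, coded y & forall u, u \in window -> x (t + u) = y u) -> coded x.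
Proof.
move=> win.
have loc (t : int * int) : exists S : (int * int) * ((int -> int -> B) * (int -> int -> nat -> Q)),
    tiling_by (dt_T (d := dt)) S.2.1 /\
    forall i j, t.1 <= i <= t.1 + (2 * K)%N%:Z -> t.2 <= j <= t.2 + (2 * N)%N%:Z ->
      x (i, j) = config S.1.1 S.1.2 S.2.1 S.2.2 (i, j).
  have [y cy yP] := win t; have [S1 [S2 [z [g [tz yE]]]]] := coded_shift (- t) cy.
  exists ((S1, S2), (z, g)); split=> //= i j ii jj.
  have <- := congr1 (fun y => y (i, j)) yE.
  have [a ia la] : exists2 a : nat, i - t.1 = a%:Z & (a <= 2 * K)%N.
    by exists `|(i - t.1)%R|%N; move: ii; move: t.1 => t1; clear; lia.
  have [b jb lb] : exists2 b : nat, j - t.2 = b%:Z & (b <= 2 * N)%N.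
    by exists `|(j - t.2)%R|%N; move: jj; move: t.2 => t2; clear; lia.
  have E : - t + (i, j) = (a%:Z, b%:Z).
    by rewrite -ia -jb; case: (t) => t1 t2; congr (_, _); rewrite /= addrC.
  rewrite E -yP; last exact: windowP.
  by rewrite -E addrA subrr add0r.
have /choice[S SP] := loc.
have step1 t : (K %| (S (t + (1, 0))).1.1 - (S t).1.1)%Z /\ (N %| (S (t + (1, 0))).1.2 - (S t).1.2)%Z.
  have [_ E1] := SP t; have [_ E2] := SP (t + (1, 0)).
  apply: (config_phases (z := (S t).2.1) (g := (S t).2.2) (z' := (S (t + (1, 0))).2.1)
    (g' := (S (t + (1, 0))).2.2) (i0 := t.1 + 1) (j0 := t.2)) => i j ii jj; rewrite -E1 ?E2 //=;
    move: ii jj uN; move: t.1 t.2 => t1 t2; clear; lia.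
have step2 t : (K %| (S (t + (0, 1))).1.1 - (S t).1.1)%Z /\ (N %| (S (t + (0, 1))).1.2 - (S t).1.2)%Z.
  have [_ E1] := SP t; have [_ E2] := SP (t + (0, 1)).
  apply: (config_phases (z := (S t).2.1) (g := (S t).2.2) (z' := (S (t + (0, 1))).2.1)
    (g' := (S (t + (0, 1))).2.2) (i0 := t.1) (j0 := t.2 + 1)) => i j ii jj; rewrite -E1 ?E2 //=;
    move: ii jj uN; move: t.1 t.2 => t1 t2; clear; lia.
have cst (k : nat) (F : int * int -> int) :
    (forall t, (k %| F (t + (1, 0)) - F t)%Z) -> (forall t, (k %| F (t + (0, 1)) - F t)%Z) ->
    forall t, (k %| F t - F (0, 0))%Z.
  move=> h1 h2 [a b]; rewrite -eqz_mod_dvd.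
  have c1 b' i j : (F (i, b') %% k)%Z = (F (j, b') %% k)%Z.
    apply: (@const_int _ (fun a => (F (a, b') %% k)%Z)) => a'.
    have := h1 (a', b'); rewrite -eqz_mod_dvd.
    have -> : (a', b') + (1, 0) = (a' + 1, b') by congr (_, _); rewrite /= addr0.
    by move/eqP.
  have c2 i j : (F (0, i) %% k)%Z = (F (0, j) %% k)%Z.
    apply: (@const_int _ (fun a => (F (0, a) %% k)%Z)) => a'.
    have := h2 (0, a'); rewrite -eqz_mod_dvd.
    have -> : ((0, a') : int * int) + (0, 1) = (0, a' + 1) by congr (_, _); rewrite /= addr0.
    by move/eqP.
  by apply/eqP; rewrite (c1 b a 0) (c2 b 0).
have cK := cst K (fun t => (S t).1.1) (fun t => (step1 t).1) (fun t => (step2 t).1).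
have cN := cst N (fun t => (S t).1.2) (fun t => (step1 t).2) (fun t => (step2 t).2).
move: cK cN; set S1 := (S (0, 0)).1.1; set S2 := (S (0, 0)).1.2 => cK cN.
have loc2 (p : int * int) : exists zg : (int -> int -> B) * (int -> int -> nat -> Q),
    tiling_by (dt_T (d := dt)) zg.1 /\
    forall P R (rx ry : nat), (rx < K)%N -> (ry < N)%N -> p.1 <= P <= p.1 + 1 -> p.2 <= R <= p.2 + 1 ->
      x (S1 + P * K%:Z + rx%:Z, S2 + R * N%:Z + ry%:Z) = wd (block_row (zg.1 P R) (zg.2 P R) ry) rx.
  pose t := (S1 + p.1 * K%:Z, S2 + p.2 * N%:Z).
  have [tz E] := SP t; have /dvdzP[a aE] := cK t; have /dvdzP[b bE] := cN t.
  exists ((fun P R => (S t).2.1 (P - a) (R - b)), (fun P R => (S t).2.2 (P - a) (R - b))); split.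
    move=> P R /=; have := tz (P - a) (R - b).
    have -> : P - a + 1 = P + 1 - a by ring.
    by have -> : R - b + 1 = R + 1 - b by ring.
  move=> P R rx ry lx ly hP hR; rewrite E.
  - have -> : (S t).1.1 = S1 + a * K%:Z by rewrite -aE; ring.
    have -> : (S t).1.2 = S2 + b * N%:Z by rewrite -bE; ring.
    by rewrite config_translate configE.
  - rewrite /t /=; have [->|->] : P = p.1 \/ P = p.1 + 1 by move: hP; move: p.1 => q; clear; lia.
      by move: lx; move: (p.1 * _) => q; clear; lia.
    by rewrite mulrDl mul1r; move: lx; move: (p.1 * _) => q; clear; lia.
  - rewrite /t /=; have [->|->] : R = p.2 \/ R = p.2 + 1 by move: hR; move: p.2 => q; clear; lia.
      by move: ly; move: (p.2 * _) => q; clear; lia.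
    by rewrite mulrDl mul1r; move: ly; move: (p.2 * _) => q; clear; lia.
have /choice[zg zgP] := loc2.
pose z P R := (zg (P, R)).1 P R; pose g P R := (zg (P, R)).2 P R.
(* Local choices need only agree on tiles, which row 0 of a block determines by [codeI]; the free
   symbols of a block are taken from its own choice. *)
have zE p P R : p.1 <= P <= p.1 + 1 -> p.2 <= R <= p.2 + 1 -> (zg p).1 P R = z P R.
  move=> hP hR; apply: codeI.
  have : block_row ((zg p).1 P R) ((zg p).2 P R) 0 = block_row (z P R) (g P R) 0.
    apply: mw_inj => r rK; rewrite /z /g.
    by rewrite -(zgP p).2 // -(zgP (P, R)).2 //= lexx lerDl.
  by case.
exists S1, S2, z, g; split.
  move=> P R; have := (zgP (P, R)).1 P R.
  by rewrite !zE //= ?lexx ?lerDl.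
apply: funext => -[i j]; rewrite /config /=.
have [iE lx] := euclz_eq (i - S1) K0; have [jE ly] := euclz_eq (j - S2) N0.
move: iE jE lx ly; move: ((i - S1)%R %/ K)%Z ((j - S2)%R %/ N)%Z => P R.
move: `|((i - S1)%R %% K)%Z|%N `|((j - S2)%R %% N)%Z|%N => rx ry iE jE lx ly.
have -> : i = S1 + P * K%:Z + rx%:Z by rewrite -[LHS](subrK S1) iE; ring.
have -> : j = S2 + R * N%:Z + ry%:Z by rewrite -[LHS](subrK S2) jE; ring.
by rewrite (zgP (P, R)).2 //= lexx lerDl.
Qed.

Lemma coded_rows (shH : shift_inv H) x (j : int) : coded x -> H (fun k => x (k, j)).
Proof.
move=> [S1 [S2 [z [g [_ ->]]]]].
have := shH _ (- S1) (mw_free (m := W) (fun P => block_row (z P ((j - S2)%R %/ N)%Z)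
  (g P ((j - S2)%R %/ N)%Z) `|((j - S2)%R %% N)%Z|%N)).
congr H; apply: funext => k; rewrite /config /=.
by rewrite [- S1 + k]addrC.
Qed.

Theorem constrained_eq_coded (shH : shift_inv H) :
  exists F, horizontally_constrained H F = coded.
Proof.
have [F FP] := avoiding_windows window coded; exists F; apply/seteqP; split.
  by move=> x [/FP /window_coded].
move=> x cx; split; last by move=> j; apply: coded_rows.
apply/FP => t; exists (fun u => x (t + u)) => //.
exact: coded_shift.
Qed.
End Coding.

(** * Counting the patterns of coded configurations *)

Lemma card_support (I Q : finType) (q0 : Q) (S : {set I}) :
  #|[set g : {ffun I -> Q} | [forall i, (i \notin S) ==> (g i == q0)]]%SET| = (#|Q| ^ #|S|)%N.
Proof.
have -> : (#|Q| ^ #|S|)%N = #|pffun_on q0 S (@predT Q)|.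
  by rewrite card_pffun_on.
apply: eq_card => g; rewrite inE; apply/forallP/pffun_onP => [gS|[/fintype.subsetP gS _] i].
  split=> //; apply/fintype.subsetP => i; rewrite inE.
  by move=> gi; apply/negPn/negP => iS; have := gS i; rewrite iS (negPf gi).
apply/implyP; apply: contraR => gi; apply: gS.
by rewrite inE.
Qed.

Lemma card_itv_ord N a w : (a + w <= N)%N -> #|[set r : 'I_N | (a <= r < w + a)%N]%SET| = w.
Proof.
move=> aw; have lt (i : 'I_w) : (a + i < N)%N by have := ltn_ord i; move: aw; clear; lia.
rewrite -[RHS]card_ord -cardsT -(@card_imset _ _ (fun i : 'I_w => Ordinal (lt i))); last first.
  by move=> i j /(congr1 val) /= /addnI /val_inj.
apply: eq_card => r; rewrite inE; apply/idP/imsetP => [/andP[h1 h2]|[i _ ->] /=].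
  have lr : (r - a < w)%N by move: h1 h2; clear; lia.
  by exists (Ordinal lr) => //; apply: val_inj; rewrite /= subnKC.
by rewrite leq_addr addnC ltn_add2r ltn_ord.
Qed.

Lemma card_dep_pair (X Y : finType) (S : X -> {set Y}) M : (forall x, #|S x| <= M)%N ->
  (#|[set u : X * Y | u.2 \in S u.1]%SET| <= #|X| * M)%N.
Proof.
move=> SM; rewrite -sum1dep_card -(pair_big_dep predT (fun x y => y \in S x) (fun _ _ => 1%N)) /=.
by rewrite -sum_nat_const leq_sum // => x _; rewrite sum1_card.
Qed.

Section CodedCount.
Variables (A : finType) (H : set (int -> A)) (K m : nat) (W : macro_words H K m).
Variables (f : 2.-tuple nat -> nat) (dt : density_tiles f) (N u0 : nat).
Hypotheses (K0 : (0 < K)%N) (uN : (u0 + 4 <= N)%N).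
Local Notation B := (dt_B dt).
Local Notation V := (mw_V W).
Local Notation wd := (@mw_wd _ _ _ _ W).
Local Notation Q := ('I_(2 ^ m)).
Variables (code : B -> V) (emb : Q -> V).
Hypotheses (codeI : injective code) (embI : injective emb).
Local Notation X := (coded N u0 code emb).
Local Notation cfg := (config N u0 code emb).
Local Notation tiled := (tiling_by (dt_T (d := dt))).

Let N0 : (0 < N)%N. Proof. by move: uN; clear; lia. Qed.

Section Free.
Variables a1 a2 : nat.
Let I := (('I_a1 * 'I_a2) * 'I_N)%type.

Definition free_cells (z : int -> int -> B) : {set I} :=
  [set i : I | (3 <= i.2 < weight u0 (z (i.1.1 : nat)%:Z (i.1.2 : nat)%:Z) + 3)%N]%SET.

Lemma card_free_cells z :
  #|free_cells z| = (a2 * (u0 * a1) +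
    \sum_(y < a2) #|[set i : 'I_a1 | dt_sel (z (i : nat)%:Z (y : nat)%:Z)]%SET|)%N.
Proof.
rewrite /free_cells -sum1dep_card.
rewrite -(pair_big_dep predT (fun (p : 'I_a1 * 'I_a2) (r : 'I_N) =>
  (3 <= r < weight u0 (z (p.1 : nat)%:Z (p.2 : nat)%:Z) + 3)%N) (fun _ _ => 1%N)) /=.
under eq_bigr => p _.
  rewrite sum1dep_card card_itv_ord; first over.
  rewrite /weight; case: (dt_sel _); move: uN; clear; lia.
rewrite -(pair_big predT predT (fun (x : 'I_a1) (y : 'I_a2) => weight u0 (z (x : nat)%:Z (y : nat)%:Z))) /=.
rewrite exchange_big /= /weight.
under eq_bigr => y _ do rewrite big_split /= sum_nat_const card_ord.
rewrite big_split /= sum_nat_const card_ord [(a1 * u0)%N]mulnC; congr (_ + _)%N.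
apply: eq_bigr => y _; rewrite -sum1dep_card [RHS]big_mkcond /=.
by apply: eq_bigr => x _; case: (dt_sel _).
Qed.
End Free.

Let pow_gt0 : (0 < 2 ^ m)%N. Proof. by rewrite expn_gt0. Qed.

Let q0 : Q := Ordinal pow_gt0.

Lemma block_row_free b (g g' : nat -> Q) ry : (ry < N)%N ->
  ((3 <= ry < weight u0 b + 3)%N -> g ry = g' ry) ->
  block_row u0 code emb b g ry = block_row u0 code emb b g' ry.
Proof.
move=> ly E; rewrite /block_row; case: ifP => // r2; case: eqP => // r3.
by case: ifP => // r4; rewrite E // r4 andbT; move: r2 r3; clear; lia.
Qed.

(** With both phases 0 and a side divisible by [K] and [N], all the blocks of the square are
    complete, and their free symbols vary independently. *)
Lemma coded_lower z a1 a2 n M : tiled z -> n = (a1 * K)%N -> n = (a2 * N)%N ->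
  (forall y, (M <= #|[set i : 'I_a1 | dt_sel (z (i : nat)%:Z y)]%SET|)%N) ->
  ((2 ^ m) ^ (a2 * (u0 * a1 + M)) <= npat X (@emb2 n n))%N.
Proof.
move=> tz n1 n2 hM; pose I := (('I_a1 * 'I_a2) * 'I_N)%type.
pose Fr := free_cells a1 a2 z.
apply: leq_trans (_ : (2 ^ m) ^ #|Fr| <= _)%N.
  rewrite leq_pexp2l ?expn_gt0 // card_free_cells mulnDr leq_add2l.
  by rewrite -{1}[a2]card_ord -sum_nat_const leq_sum.
rewrite -[in X in (X <= _)%N](card_ord (2 ^ m)) -(card_support q0 Fr).
pose g (c : {ffun I -> Q}) (P R : int) (ry : nat) : Q :=
  if insub `|P|%N is Some p then if insub `|R|%N is Some r then
    if insub ry is Some s then c ((p, r), s) else q0 else q0 else q0.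
apply: (@npat_ge _ _ _ _ _ _ _ (fun c => cfg 0 0 z (g c))).
  by move=> c _; exists 0, 0, z, (g c).
move=> c c'; rewrite !inE => /forallP sc /forallP sc' E; apply/ffunP => -[[p r] s].
have [iF|iF] := boolP (((p, r), s) \in Fr); last first.
  by have := sc ((p, r), s); have := sc' ((p, r), s); rewrite iF /= => /eqP -> /eqP ->.
have : block_row u0 code emb (z (p : nat)%:Z (r : nat)%:Z) (g c (p : nat)%:Z (r : nat)%:Z) s =
       block_row u0 code emb (z (p : nat)%:Z (r : nat)%:Z) (g c' (p : nat)%:Z (r : nat)%:Z) s.
  apply: mw_inj => x xK.
  have l1 : (p * K + x < n)%N by rewrite n1; have := ltn_ord p; move: xK; clear; nia.
  have l2 : (r * N + s < n)%N by rewrite n2; have := ltn_ord r; have := ltn_ord s; clear; nia.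
  have := E (Ordinal l1, Ordinal l2); rewrite /emb2 /=.
  have -> : (p * K + x)%N%:Z = 0 + (p : nat)%:Z * K%:Z + x%:Z by rewrite add0r PoszD PoszM.
  have -> : (r * N + s)%N%:Z = 0 + (r : nat)%:Z * N%:Z + (s : nat)%:Z by rewrite add0r PoszD PoszM.
  by rewrite !configE.
move: iF; rewrite inE /= => /andP[s3 s4]; rewrite /block_row ltnNge (ltnW s3) /= s4.
have -> : ((s : nat) == 2)%N = false by move: s3; clear; lia.
by case=> /embI; rewrite /g /= !valK.
Qed.

Lemma coded_upper n L M : (K %| n)%N -> (N %| n)%N ->
  (n %/ K + 1 <= 2 ^ L)%N -> (n %/ N + 1 <= 2 ^ L)%N ->
  (forall z, tiled z -> forall y,
     #|[set i : 'I_(n %/ K + 1) | dt_sel (z (i : nat)%:Z y)]%SET| <= M)%N ->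
  (npat X (@emb2 n n) <=
    K * N * (2 ^ L.+1 * 2 ^ L.+1 * 5 * #|B| ^ (n %/ K + 1) * #|B| ^ (n %/ N + 1)) *
    (2 ^ m) ^ ((n %/ N + 1) * (u0 * (n %/ K + 1) + M)))%N.
Proof.
move=> Kn Nn; set a1 := (n %/ K + 1)%N; set a2 := (n %/ N + 1)%N => l1 l2 hM.
have [C [Pz [cC Pex Pinj]]] := dt_code dt l1 l2.
rewrite -cC; pose I := (('I_a1 * 'I_a2) * 'I_N)%type.
have [z0|no] := pselect (exists z, tiled z); last first.
  suff -> : npat X (@emb2 n n) = 0%N by [].
  apply/eqP; rewrite cards_eq0; apply/eqP/setP => p; rewrite !inE.
  by apply/negP => /asboolP[x [S1 [S2 [z [g [tz _]]]]] _]; apply: no; exists z.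
(* The set of free cells has to be a function of the code alone; a representative tiling of each
   code provides it. *)
have /choice[rep repP] : forall c, exists z, tiled z /\ ((exists2 z', tiled z' & Pz z' c) -> Pz z c).
  move=> c; have [[z' tz' zc]|nz] := pselect (exists2 z', tiled z' & Pz z' c).
    by exists z'.
  by case: z0 => z tz; exists z.
pose S (s : 'I_K * 'I_N * C) : {set {ffun I -> Q}} :=
  [set g : {ffun I -> Q} | [forall i, (i \notin free_cells a1 a2 (rep s.2)) ==> (g i == q0)]]%SET.
have cS s : (#|S s| <= (2 ^ m) ^ (a2 * (u0 * a1 + M)))%N.
  rewrite card_support card_ord leq_pexp2l ?expn_gt0 // card_free_cells mulnDr leq_add2l.
  have -> : (a2 * M = \sum_(y < a2) M)%N by rewrite sum_nat_const card_ord.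
  apply: leq_sum => y _.
  by apply: hM; have [] := repP s.2.
have := card_dep_pair cS; rewrite !card_prod !card_ord; apply: leq_trans.
pose P (x : int * int -> A) (s : 'I_K * 'I_N * C * {ffun I -> Q}) := exists z g,
  [/\ tiled z, x = cfg (- (s.1.1.1 : nat)%:Z) (- (s.1.1.2 : nat)%:Z) z g, Pz z s.1.2 &
      forall i : I, i \in free_cells a1 a2 z -> s.2 i = g (i.1.1 : nat)%:Z (i.1.2 : nat)%:Z i.2].
have freeE z z' c : tiled z -> tiled z' -> Pz z c -> Pz z' c -> free_cells a1 a2 z = free_cells a1 a2 z'.
  move=> tz tz' zc zc'; apply/setP => i; rewrite !inE.
  by rewrite (Pinj z z' c tz tz' zc zc').
apply: (@npat_le _ _ _ _ _ _ _ P).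
  move=> x [S1 [S2 [z [g [tz xE]]]]].
  have [E1 k1] := euclz_eq (- S1) K0; have [E2 k2] := euclz_eq (- S2) N0.
  pose z' P R := z (P - - ((- S1)%R %/ K)%Z) (R - - ((- S2)%R %/ N)%Z).
  pose g' P R := g (P - - ((- S1)%R %/ K)%Z) (R - - ((- S2)%R %/ N)%Z).
  have tz' : tiled z'.
    move=> i j; rewrite /z' [i + 1 - _]addrAC [j + 1 - _]addrAC; exact: tz.
  have [c zc] := Pex z' tz'.
  pose h : {ffun I -> Q} := [ffun i : I => if i \in free_cells a1 a2 z' then
     g' (i.1.1 : nat)%:Z (i.1.2 : nat)%:Z i.2 else q0].
  have [tr zr] := repP c; have rc : Pz (rep c) c by apply: zr; exists z'.
  exists ((Ordinal k1, Ordinal k2), c, h); last first.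
    exists z', g'; split=> //; last by move=> i iF; rewrite /= ffunE iF.
    rewrite xE /=; have e1 : S1 = - `|((- S1)%R %% K)%Z|%N%:Z + (- ((- S1)%R %/ K)%Z) * K%:Z.
      by rewrite -[LHS]opprK {1}E1; ring.
    have e2 : S2 = - `|((- S2)%R %% N)%Z|%N%:Z + (- ((- S2)%R %/ N)%Z) * N%:Z.
      by rewrite -[LHS]opprK {1}E2; ring.
    by rewrite {1}e1 {1}e2; exact: config_translate.
  rewrite !inE; apply/forallP => i; rewrite /= -(freeE z' (rep c) c) // ffunE.
  by case: ifP.
move=> x y [[[s1 s2] c] h] _ _ [z [g [tz -> zc hg]]] [z' [g' [tz' -> zc' hg']]] [i j].
rewrite /emb2 /=; move: hg hg' zc zc' => /= hg hg' zc zc'.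
have pos (k : nat) (q : 'I_n) (s : 'I_k) : (0 < k)%N -> (k %| n)%N ->
    exists p r : nat, [/\ (p < n %/ k + 1)%N, (r < k)%N &
      (q : nat)%:Z = - (s : nat)%:Z + p%:Z * k%:Z + r%:Z].
  move=> k0 kn; exists ((q + s) %/ k)%N, ((q + s) %% k)%N; split; last first.
  - rewrite -addrA -PoszM -PoszD -divn_eq PoszD; ring.
  - exact: ltn_pmod.
  - rewrite ltn_divLR // mulnDl mul1n divnK //.
    by have := ltn_ord q; have := ltn_ord s; clear; lia.
have [p [r [lp lr ->]]] := pos K i s1 K0 Kn.
have [p' [r' [lp' lr' ->]]] := pos N j s2 N0 Nn.
rewrite !configE // (Pinj z z' c tz tz' zc zc') //; congr (wd _ _).
apply: block_row_free => // fr.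
have iF' : ((Ordinal lp, Ordinal lp'), Ordinal lr') \in free_cells a1 a2 z' by rewrite inE.
have iF : ((Ordinal lp, Ordinal lp'), Ordinal lr') \in free_cells a1 a2 z.
  by rewrite (freeE z z' c).
by have := hg _ iF; rewrite (hg' _ iF') /= => ->.
Qed.
End CodedCount.

(** * Entropy of the coded configurations *)

Section Dyadic.
Variable R : realType.

Lemma dyadic_sum (b : nat -> bool) L :
  \sum_(l < L) (b l)%:R / 2 ^+ l.+1 = (dyadic_num b L)%:R / 2 ^+ L :> R.
Proof.
elim: L => [|L IH]; first by rewrite big_ord0 mul0r.
rewrite big_ord_recr /= IH natrD natrM exprS.
by field; rewrite expf_neq0.
Qed.

Lemma dyadic_digits (d : R) : 0 <= d -> d < 1 -> exists b : nat -> bool, forall n,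
  (dyadic_num b n)%:R <= d * 2 ^+ n /\ d * 2 ^+ n < (dyadic_num b n)%:R + 1.
Proof.
move=> d0 d1; pose V n := Num.truncn (d * 2 ^+ n).
have VP n : (V n)%:R <= d * 2 ^+ n /\ d * 2 ^+ n < (V n)%:R + 1.
  have p0 : 0 <= d * 2 ^+ n by rewrite mulr_ge0 // exprn_ge0.
  by have /andP[h1 h2] := Num.Theory.truncn_itv p0; rewrite natr1.
exists (fun n => V n.+1 == (V n).*2.+1) => n.
suff -> : dyadic_num (fun n => V n.+1 == (V n).*2.+1) n = V n by [].
elim: n => [|n IH].
  by apply/esym/Num.Theory.truncn0Pn; rewrite expr0 mulr1 -ltNge.
rewrite /= IH; have [h1 h2] := VP n; have [h3 h4] := VP n.+1.
rewrite exprS in h3 h4.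
have l1 : ((V n).*2 < (V n.+1).+1)%N.
  by rewrite -(ltr_nat R) -mul2n natrM -natr1; lra.
have l2 : (V n.+1 < (V n).*2.+2)%N.
  by rewrite -(ltr_nat R) -mul2n -!natr1 natrM; lra.
by case: eqP => E; move: l1 l2 E; move: (V n) (V n.+1) => a c; clear; lia.
Qed.

Lemma log2_code_size (k s x y m e c : nat) : (0 < k)%N -> (0 < c)%N ->
  log2 (k * (2 ^ s * 2 ^ s * 5 * c ^ x * c ^ y) * (2 ^ m) ^ e)%N%:R =
  log2 k%:R + (s%:R + s%:R + log2 5 + x%:R * log2 c%:R + y%:R * log2 c%:R) + m%:R * e%:R :> R.
Proof.
move=> k0 c0; have kR : 0 < k%:R :> R by rewrite ltr0n.
have cR n : 0 < c%:R ^+ n :> R by rewrite exprn_gt0 // ltr0n.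
have pR n : 0 < 2 ^+ n :> R by rewrite exprn_gt0.
have -> : (k * (2 ^ s * 2 ^ s * 5 * c ^ x * c ^ y) * (2 ^ m) ^ e)%N%:R =
    k%:R * (2 ^+ s * 2 ^+ s * 5 * c%:R ^+ x * c%:R ^+ y) * 2 ^+ (m * e) :> R.
  by rewrite -expnM !natrM !natrX.
rewrite log2M ?log2_exp2 ?mulr_gt0 // log2M ?mulr_gt0 // log2M ?mulr_gt0 //.
rewrite log2M ?mulr_gt0 // log2M ?mulr_gt0 // log2M ?mulr_gt0 // !log2_exp2 !log2X ?ltr0n // natrM.
by rewrite -!(mulr_natl (log2 _)).
Qed.
End Dyadic.

Section CodedEntropy.
Variables (R : realType) (A : finType) (H : set (int -> A)) (K m : nat) (W : macro_words H K m).
Variables (f : 2.-tuple nat -> nat) (dt : density_tiles f) (N u0 : nat).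
Hypotheses (K0 : (0 < K)%N) (uN : (u0 + 4 <= N)%N).
Local Notation B := (dt_B dt).
Local Notation V := (mw_V W).
Local Notation Q := ('I_(2 ^ m)).
Variables (code : B -> V) (emb : Q -> V).
Hypotheses (codeI : injective code) (embI : injective emb).
Local Notation X := (coded N u0 code emb).
Variable d : R.
Hypotheses (d0 : 0 <= d) (d1 : d < 1)
  (fd : forall b : nat -> bool, (forall n, f [tuple n; dyadic_num b n] = 0%N) <->
     (forall n, (dyadic_num b n)%:R <= d * 2 ^+ n)).

Let N0 : (0 < N)%N. Proof. by move: uN; clear; lia. Qed.
Let KR : 0 < K%:R :> R. Proof. by rewrite ltr0n. Qed.
Let NR : 0 < N%:R :> R. Proof. by rewrite ltr0n. Qed.

Let pow2_gt0 : (0 < 2 ^ m)%N. Proof. by rewrite expn_gt0. Qed.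

Lemma coded_digits : exists b z, [/\ tiling_by (dt_T (d := dt)) z,
    forall n, d * 2 ^+ n < (dyadic_num b n)%:R + 1 &
    forall y n L, (\sum_(l < L) b l * (n %/ 2 ^ l.+1) <=
       #|[set i : 'I_n | dt_sel (z (i : nat)%:Z y)]%SET|)%N].
Proof.
have [b bP] := dyadic_digits d0 d1.
have [|z tz zP] := @dt_lower f dt b.
  by apply/fd => n; have [] := bP n.
by exists b, z; split=> // n; have [] := bP n.
Qed.

Lemma coded_nonempty : X !=set0.
Proof.
have [b [z [tz _ _]]] := coded_digits.
have q0 : Q by exists 0%N; exact: pow2_gt0.
by exists (config N u0 code emb 0 0 z (fun _ _ _ => q0)), 0, 0, z, (fun _ _ _ => q0).
Qed.

Let rate : R := m%:R * (u0%:R + d) / (K%:R * N%:R).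

Lemma coded_npat_ge j :
  m%:R * (u0%:R + d) * (K%:R * N%:R) * (2 ^+ j * 2 ^+ j) - m%:R * K%:R * N%:R * 2 ^+ j <=
  log2 (npat X (@emb2 (K * N * 2 ^ j) (K * N * 2 ^ j)))%:R :> R.
Proof.
have [b [z [tz bd zP]]] := coded_digits.
pose M := (\sum_(l < j) b l * ((N * 2 ^ j) %/ 2 ^ l.+1))%N.
have n1 : (K * N * 2 ^ j = N * 2 ^ j * K)%N by ring.
have n2 : (K * N * 2 ^ j = K * 2 ^ j * N)%N by ring.
have ME : M%:R = N%:R * (dyadic_num b j)%:R :> R.
  rewrite natr_sum; transitivity (\sum_(l < j) N%:R * 2 ^+ j * ((b l)%:R / 2 ^+ l.+1) : R).
    apply: eq_bigr => l _; have lj := ltn_ord l.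
    have -> : ((N * 2 ^ j) %/ 2 ^ l.+1 = N * 2 ^ (j - l.+1))%N.
      have -> : (2 ^ j = 2 ^ l.+1 * 2 ^ (j - l.+1))%N by rewrite -expnD subnKC.
      by rewrite mulnCA mulKn ?expn_gt0.
    have -> : 2 ^+ j = 2 ^+ l.+1 * 2 ^+ (j - l.+1) :> R by rewrite -exprD subnKC.
    rewrite natrM natrM natrX.
    by field; rewrite expf_neq0.
  by rewrite -big_distrr /= dyadic_sum; field; rewrite expf_neq0.
have := @coded_lower _ _ _ _ _ _ _ _ _ uN code _ embI z _ _ _ M tz n1 n2 (fun y => zP y _ j).
move=> le; apply: le_trans (_ : log2 ((2 ^ m) ^ (K * 2 ^ j * (u0 * (N * 2 ^ j) + M)))%N%:R <= _); last first.
  by apply: ler_log2; rewrite ?ler_nat // ltr0n !expn_gt0.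
rewrite -expnM natrX log2_exp2 !(natrM, natrD) ME natrX.
have h : d * 2 ^+ j - 1 <= (dyadic_num b j)%:R by have := bd j; lra.
have h2 : N%:R * (d * 2 ^+ j - 1) <= N%:R * (dyadic_num b j)%:R by rewrite ler_pM2l.
have h3 : 0 <= m%:R * (K%:R * 2 ^+ j) :> R by rewrite !mulr_ge0 ?ler0n ?exprn_ge0.
have := ler_wpM2l h3 h2; move: (2 ^+ j) (dyadic_num b j)%:R => p v; lra.
Qed.

(** The phases, the code of the tiling and the cut blocks contribute to the logarithm a term linear
    in the side; the rounding of densities at [j] levels, multiplied by the side, explains the
    factor [j + 1]. *)
Lemma coded_npat_le : exists2 C : R, 0 <= C & forall j,
  log2 (npat X (@emb2 (K * N * 2 ^ j) (K * N * 2 ^ j)))%:R <=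
  m%:R * (u0%:R + d) * (K%:R * N%:R) * (2 ^+ j * 2 ^+ j) + C * (j%:R + 1) * 2 ^+ j.
Proof.
have B0 : (0 < #|B|)%N.
  by have [b [z _]] := coded_digits; apply/card_gt0P; exists (z 0 0).
pose be : R := log2 #|B|%:R; have be0 : 0 <= be by apply: log2_ge0; rewrite (ler_nat _ 1).
pose c0 : R := log2 (K * N)%N%:R + (2 + log2 5).
have c00 : 0 <= c0.
  apply: addr_ge0; first by apply: log2_ge0; rewrite (ler_nat _ 1) muln_gt0 K0.
  by apply: addr_ge0 => //; apply: log2_ge0; rewrite (ler_nat _ 1).
have ud : 0 <= u0%:R + d by rewrite addr_ge0.
pose C1 : R := (N%:R + K%:R + 2) * (2 + be).
have C10 : 0 <= C1 by rewrite mulr_ge0 // ?addr_ge0.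
pose C2 : R := m%:R * (u0%:R + d) * (K%:R + N%:R + 1).
have C20 : 0 <= C2 by rewrite !mulr_ge0 // ?addr_ge0.
pose C3 : R := m%:R * (K%:R + 1) * (N%:R + 2).
have C30 : 0 <= C3 by rewrite !mulr_ge0 // ?addr_ge0.
exists (c0 + C1 + C2 + C3); first by apply: addr_ge0 => //; apply: addr_ge0 => //; apply: addr_ge0.
move=> j; pose p : R := 2 ^+ j; have p1 : 1 <= p by rewrite exprn_ege1 // ler1n.
have e1 : ((K * N * 2 ^ j) %/ K + 1 = N * 2 ^ j + 1)%N by rewrite -mulnA mulKn.
have e2 : ((K * N * 2 ^ j) %/ N + 1 = K * 2 ^ j + 1)%N by rewrite mulnAC mulnK.
set a1 := (N * 2 ^ j + 1)%N in e1; set a2 := (K * 2 ^ j + 1)%N in e2.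
have a1R : a1%:R = N%:R * p + 1 :> R by rewrite natrD natrM natrX.
have a2R : a2%:R = K%:R * p + 1 :> R by rewrite natrD natrM natrX.
(* Bound on the selected columns: one unit of rounding for each of the [j] lowest levels, and
   [N + 2] for the columns of higher level. *)
pose M := Num.truncn (d * a1%:R + (j + N + 2)%N%:R).
have M0 : 0 <= d * a1%:R + (j + N + 2)%N%:R by rewrite addr_ge0 // mulr_ge0.
have Mle : M%:R <= d * a1%:R + (j + N + 2)%N%:R by rewrite Num.Theory.truncn_le.
have Kn : (K %| K * N * 2 ^ j)%N by rewrite -mulnA dvdn_mulr.
have Nn : (N %| K * N * 2 ^ j)%N by rewrite mulnAC dvdn_mull.
(* A crude choice of the level at which tilings are coded: it only has to be linear in the side. *)
have l1 : (a1 <= 2 ^ (a1 + a2))%N.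
  by apply: leq_trans (ltnW (ltn_expl _ (ltnSn 1))) _; rewrite leq_exp2l // leq_addr.
have l2 : (a2 <= 2 ^ (a1 + a2))%N.
  by apply: leq_trans (ltnW (ltn_expl _ (ltnSn 1))) _; rewrite leq_exp2l // leq_addl.
have := @coded_upper _ _ _ _ _ _ _ _ _ K0 uN code emb (K * N * 2 ^ j) (a1 + a2) M Kn Nn.
rewrite e1 e2 => /(_ l1 l2 _) le.
have {}le : (npat X (@emb2 (K * N * 2 ^ j) (K * N * 2 ^ j)) <=
  K * N * (2 ^ (a1 + a2).+1 * 2 ^ (a1 + a2).+1 * 5 * #|B| ^ a1 * #|B| ^ a2) *
  (2 ^ m) ^ (a2 * (u0 * a1 + M)))%N.
  apply: le => z tz y; have [b bf bP] := dt_upper tz; have {}bf := (fd b).1 bf.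
  apply: leq_trans (bP y a1 j) _; rewrite Num.Theory.truncn_ge_nat // 4!natrD natr_sum.
  have div a k : (a %/ 2 ^ k)%N%:R <= a%:R / 2 ^+ k :> R.
    by rewrite ler_pdivlMr ?exprn_gt0 // -natrX -natrM ler_nat leq_trunc_div.
  have s1 : \sum_(l < j) (b l * (a1 %/ 2 ^ l.+1 + 1))%N%:R <=
      \sum_(l < j) (a1%:R * ((b l)%:R / 2 ^+ l.+1) + 1) :> R.
    apply: ler_sum => l _; rewrite natrM natrD.
    have := div a1 l.+1; case: (b l); last by rewrite !mul0r mulr0 add0r.
    by rewrite !mul1r; lra.
  have s2 : \sum_(l < j) (a1%:R * ((b l)%:R / 2 ^+ l.+1) + 1) =
      a1%:R * ((dyadic_num b j)%:R / 2 ^+ j) + j%:R :> R.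
    by rewrite big_split /= -big_distrr /= dyadic_sum sumr_const card_ord.
  have s3 : a1%:R * ((dyadic_num b j)%:R / 2 ^+ j) <= d * a1%:R.
    by rewrite mulrC ler_wpM2r // ler_pdivrMr ?exprn_gt0.
  have s4 : (a1 %/ 2 ^ j)%N%:R <= N%:R + 1 :> R.
    apply: le_trans (div a1 j) _; rewrite ler_pdivrMr ?exprn_gt0 // a1R -/p.
    by move: p1; move: (N%:R * p) (p) => s t; lra.
  by move: s1 s2 s3 s4; move: (\sum_(l < j) _) (\sum_(l < j) _) => s t; lra.
have lB : 0 < #|B|%:R :> R by rewrite ltr0n.
have {le} : log2 (npat X (@emb2 (K * N * 2 ^ j) (K * N * 2 ^ j)))%:R <=
   log2 (K * N)%N%:R + ((a1 + a2).+1%:R + (a1 + a2).+1%:R + log2 5 + a1%:R * be + a2%:R * be)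
   + m%:R * (a2%:R * (u0%:R * a1%:R + M%:R)) :> R.
  apply: le_trans (_ : log2 (K * N * (2 ^ (a1 + a2).+1 * 2 ^ (a1 + a2).+1 * 5 * #|B| ^ a1 * #|B| ^ a2) *
  (2 ^ m) ^ (a2 * (u0 * a1 + M)))%N%:R <= _).
    by apply: ler_log2; [rewrite ltr0n npat_gt0 //; exact: coded_nonempty|rewrite ler_nat].
  rewrite log2_code_size ?muln_gt0 ?K0 ?N0 // [(a2 * _)%N%:R]natrM.
  by rewrite [(_ + M)%N%:R]natrD [(u0 * a1)%N%:R]natrM.
have Mle2 : m%:R * (a2%:R * (u0%:R * a1%:R + M%:R)) <=
    m%:R * (a2%:R * (u0%:R * a1%:R + (d * a1%:R + (j + N + 2)%N%:R))).
  by rewrite ler_wpM2l // ler_wpM2l // lerD2l.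
move=> le; apply: le_trans le _.
move: Mle2; rewrite -[(a1 + a2).+1%:R]natr1 [(a1 + a2)%:R]natrD [(j + N + 2)%:R]natrD
  [(j + N)%:R]natrD a1R a2R -/p.
have j0 : 0 <= j%:R :> R by [].
have q1 : c0 <= c0 * (j%:R + 1) * p.
  by rewrite -mulrA ler_peMr // -[1]mulr1 ler_pM //; lra.
have q2 : C1 * p <= C1 * (j%:R + 1) * p.
  by rewrite ler_wpM2r ?ler_peMr //; lra.
have q3 : C2 * p <= C2 * (j%:R + 1) * p.
  by rewrite ler_wpM2r ?ler_peMr //; lra.
have q4 : m%:R * ((K%:R * p + 1) * (j%:R + N%:R + 2)) <= C3 * (j%:R + 1) * p.
  have -> : C3 * (j%:R + 1) * p = m%:R * (((K%:R + 1) * p) * ((N%:R + 2) * (j%:R + 1))).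
    by rewrite /C3; ring.
  have Nj : 0 <= N%:R * j%:R :> R by rewrite mulr_ge0.
  have Kp : 0 <= K%:R * p by rewrite mulr_ge0 //; lra.
  by rewrite ler_wpM2l // ler_pM //; lra.
have q5 : (N%:R * p + 1 + (K%:R * p + 1)) * (2 + be) <= C1 * p.
  rewrite /C1 mulrAC ler_wpM2r ?addr_ge0 //.
  by rewrite !mulrDl; lra.
have q6 : m%:R * (u0%:R + d) * ((K%:R + N%:R) * p + 1) <= C2 * p.
  by rewrite /C2 -[leRHS]mulrA ler_wpM2l ?mulr_ge0 // [leRHS]mulrDl mul1r; lra.
by rewrite /c0 in q1 *; lra.
Qed.

Theorem coded_entropy : entropy2 R X = rate.
Proof.
have [nn inf cv] := entropy2_spec R (coded_shift (code := code) (emb := emb)) coded_nonempty.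
have n0 j : (0 < K * N * 2 ^ j)%N by rewrite !muln_gt0 K0 N0 expn_gt0.
have nR j : (K * N * 2 ^ j)%N%:R ^+ 2 = (K%:R * N%:R) ^+ 2 * (2 ^+ j * 2 ^+ j) :> R.
  by rewrite !natrM natrX !expr2; ring.
have KN2 : 0 < (K%:R * N%:R) ^+ 2 :> R by rewrite exprn_gt0 ?mulr_gt0.
have p0 j : 0 < 2 ^+ j :> R by rewrite exprn_gt0.
have rE : m%:R * (u0%:R + d) * (K%:R * N%:R) = rate * (K%:R * N%:R) ^+ 2.
  by rewrite /rate expr2; field; rewrite !gt_eqF.
apply/eqP; rewrite eq_le; apply/andP; split.
  apply/ler_addgt0Pr => e e0.
  have [C C0 CP] := coded_npat_le.
  have [|||j jP] := @linear_lt_exp2 R C C (e * (K%:R * N%:R) ^+ 2) => //.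
    by rewrite mulr_gt0.
  apply: le_trans (inf _ (n0 j)) _; rewrite ler_pdivrMr ?exprn_gt0 ?ltr0n //.
  apply: le_trans (CP j) _; rewrite rE nR.
  have := p0 j; move: (2 ^+ j) jP => p; move: (_ ^+ 2) => q jP p00.
  have : (C + C * j%:R) * p <= e * q * p * p by rewrite ler_pM2r // ltW.
  by lra.
rewrite leNgt; apply/negP => lt; pose e := (rate - entropy2 R X) / 2.
have e0 : 0 < e by rewrite divr_gt0 // subr_gt0.
have [|n1 _ near] := (cvgr_lt _ cv) (entropy2 R X + e); first by rewrite ltrDl.
have [|||j1 jP] := @linear_lt_exp2 R (m%:R * K%:R * N%:R) 0 (e * (K%:R * N%:R) ^+ 2) => //.
- by rewrite mulr_gt0.
pose j := (j1 + n1)%N.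
have le0 : (n1 <= K * N * 2 ^ j)%N.
  apply: leq_trans (ltnW (ltn_expl n1 (ltnSn 1))) _.
  apply: leq_trans (_ : 2 ^ j <= _)%N; first by rewrite leq_exp2l // leq_addl.
  by rewrite leq_pmull // muln_gt0 K0.
have := near _ le0; rewrite /= ltNge => /negP; apply.
rewrite ler_pdivlMr ?exprn_gt0 ?ltr0n //; apply: le_trans (coded_npat_ge j).
rewrite rE nR.
have le2 : m%:R * K%:R * N%:R <= e * (K%:R * N%:R) ^+ 2 * 2 ^+ j.
  rewrite mul0r addr0 in jP; apply: le_trans (ltW jP) _; apply: ler_wpM2l; first exact: ltW (mulr_gt0 e0 KN2).
  by rewrite ler_weXn2l ?ler1n // leq_addr.
have le3 : m%:R * K%:R * N%:R * 2 ^+ j <= e * (K%:R * N%:R) ^+ 2 * 2 ^+ j * 2 ^+ j by rewrite ler_pM2r.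
have eE : entropy2 R X + e = rate - e by rewrite /e; field.
rewrite eE; move: le3; move: (2 ^+ j) (_ ^+ 2) => p q.
by lra.
Qed.
End CodedEntropy.

(** * Every right-computable value is attained *)

Lemma dyadic_num_le b n k : (dyadic_num b n * 2 ^ k <= dyadic_num b (k + n))%N.
Proof.
elim: k => [|k IH]; first by rewrite expn0 muln1.
rewrite addSn /= expnS mulnCA; apply: leq_trans (leq_addr _ _).
by rewrite leq_pmul2l.
Qed.

(** With [V] the number read from the first [n] digits, this vanishes iff
    [(V / 2 ^ n + u0) * m / (N * K)] is at most the [n]-th rational [a n / b n]: denominators are
    cleared, and subtraction is truncated. *)
Definition density_check (N K m u0 : nat) (a b : nat -> nat) (v : 2.-tuple nat) : nat :=
  let n := thead v in
  ((thead (ttail v) + u0 * 2 ^ n) * m * b n - N * K * a n * 2 ^ n)%N.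

Lemma cf_density_check N K m u0 a b : computable a -> computable b ->
  cf (density_check N K m u0 a b).
Proof.
move=> ca cb; have ch := cf_head 1; have ch2 := cf_head2 0.
have c2 : cf (fun v : 2.-tuple nat => 2 ^ thead v)%N by apply: cf_exp => //; exact: cf_const.
apply: cf_sub; last first.
  by apply: cf_mul => //; apply: cf_mul; [exact: cf_const|exact: cf_computable].
apply: cf_mul; last exact: cf_computable.
apply: cf_mul; last exact: cf_const.
by apply: cf_add => //; apply: cf_mul => //; exact: cf_const.
Qed.

Section Realize.
Variables (R : realType) (A : finType) (H : set (int -> A)).
Hypotheses (HS : is_SFT H) (H0 : H !=set0).

Lemma nonneg_rat_seq (q : nat -> rat) (h : R) : computable_rat_seq q -> 0 <= h ->
  (forall n, h <= ratr (q n)) ->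
  exists a b : nat -> nat, [/\ computable a, computable b,
    forall n, (0 < b n)%N & forall n, ratr (q n) = (a n)%:R / (b n)%:R :> R].
Proof.
move=> [s [a [b [_ ca cb qE]]]] h0 hq; exists a, b; split=> // n.
  by have [b0 _] := qE n; rewrite lt0n.
have [b0 qn] := qE n.
have q0 : 0 <= q n by rewrite -(ler0q R); apply: le_trans (hq n).
have -> : q n = (a n)%:R / (b n)%:R.
  have ab : 0 <= (a n)%:R / (b n)%:R :> rat by rewrite divr_ge0.
  move: q0; rewrite qn -signr_odd; case: (odd (s n)); last by rewrite expr0 mul1r.
  rewrite expr1 mulN1r mulNr => q0; apply/eqP; rewrite -subr_eq0.
  have -> : (a n)%:R / (b n)%:R = 0 :> rat by apply/eqP; rewrite eq_le ab andbT -oppr_ge0.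
  by rewrite oppr0 subrr.
by rewrite rmorphM /= fmorphV /= !ratr_nat.
Qed.

(** The test number [k] also bounds the shorter prefixes, whose values are smaller; letting [k]
    grow, each prefix is bounded by the limit [h]. *)
Lemma density_checkP (N K m u0 : nat) (a b : nat -> nat) (h : R) :
  (0 < N)%N -> (0 < K)%N -> (0 < m)%N -> (forall n, 0 < b n)%N ->
  (forall n, h <= (a n)%:R / (b n)%:R) -> (fun n => (a n)%:R / (b n)%:R : R) @ \oo --> h ->
  forall c : nat -> bool,
   (forall n, density_check N K m u0 a b [tuple n; dyadic_num c n] = 0%N) <->
   (forall n, (dyadic_num c n)%:R <= (h * N%:R * K%:R / m%:R - u0%:R) * 2 ^+ n).
Proof.
move=> N0 K0 m0 b0 hx cx c.
have NR : 0 < N%:R :> R by rewrite ltr0n. have KR : 0 < K%:R :> R by rewrite ltr0n.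
have mR : 0 < m%:R :> R by rewrite ltr0n.
have pR n : 0 < 2 ^+ n :> R by rewrite exprn_gt0.
have E n : (density_check N K m u0 a b [tuple n; dyadic_num c n] = 0%N) <->
    ((dyadic_num c n)%:R / 2 ^+ n + u0%:R) * m%:R / (N%:R * K%:R) <= (a n)%:R / (b n)%:R :> R.
  have bR : 0 < (b n)%:R :> R by rewrite ltr0n.
  rewrite /density_check.
  have -> : thead (ttail [tuple n; dyadic_num c n]) = dyadic_num c n by [].
  have -> : thead [tuple n; dyadic_num c n] = n by [].
  rewrite ler_pdivrMr ?mulr_gt0 // mulrAC ler_pdivlMr //.
  rewrite -(ler_pM2r (pR n)).
  have -> : ((dyadic_num c n)%:R / 2 ^+ n + u0%:R) * m%:R * (b n)%:R * 2 ^+ n =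
     ((dyadic_num c n + u0 * 2 ^ n) * m * b n)%N%:R :> R.
    by rewrite !natrM natrD natrM natrX; field; rewrite gt_eqF.
  have -> : (a n)%:R * (N%:R * K%:R) * 2 ^+ n = (N * K * a n * 2 ^ n)%N%:R :> R.
    by rewrite !natrM natrX; ring.
  by rewrite ler_nat -subn_eq0; split => [->|/eqP].
have D n : ((dyadic_num c n)%:R <= (h * N%:R * K%:R / m%:R - u0%:R) * 2 ^+ n) <->
    ((dyadic_num c n)%:R / 2 ^+ n + u0%:R) * m%:R / (N%:R * K%:R) <= h.
  rewrite -ler_pdivrMr // lerBrDr ler_pdivlMr // ler_pdivrMr ?mulr_gt0 //.
  by rewrite mulrA.
split=> [ok n|ok n]; last by apply/E; apply: le_trans (hx n); apply/D.
apply/D; rewrite -(cvg_lim (@Rhausdorff R) cx); apply: limr_ge; first exact: cvgP cx.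
near=> k; have nk : (n <= k)%N by near: k; exists n.
apply: le_trans ((E k).1 (ok k)); rewrite ler_pM2r ?invr_gt0 ?mulr_gt0 // ler_pM2r // lerD2r.
rewrite ler_pdivrMr // mulrAC ler_pdivlMr //.
rewrite -[in leLHS](subnK nk) exprD mulrA ler_pM2r // -natrX -natrM ler_nat.
by rewrite -{2}(subnK nk) dyadic_num_le.
Unshelve. all: by end_near.
Qed.

Theorem realize_lt (h : R) : 0 <= h -> h < entropy1 R H -> Pi1 R h ->
  exists F, horizontally_constrained H F !=set0 /\
            h = entropy2 R (horizontally_constrained H F).
Proof.
move=> h0 hH [q [cq dq hq]].
have ni : nonincreasing_seq (fun n => ratr (q n) : R).
  by apply/nonincreasing_seqP => n; rewrite ler_rat.
have hle n : h <= ratr (q n).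
  by rewrite -(cvg_lim (@Rhausdorff R) hq); apply: nonincreasing_cvgn_ge => //; exact: cvgP hq.
have [a [b [ca cb b0 qE]]] := nonneg_rat_seq cq h0 hle.
have [K1 [m1 [K10 hK mw]]] := SFT_macro_words HS H0 h0 hH.
have K1R : 0 < K1%:R :> R by rewrite ltr0n.
have m1R : 0 < m1%:R :> R by apply: le_lt_trans hK; rewrite mulr_ge0.
have m10 : (0 < m1)%N by rewrite -(ltr_nat R).
pose t := (h * K1%:R / m1%:R); have t1 : t < 1 by rewrite ltr_pdivrMr // mul1r.
have t0 : 0 <= t by rewrite divr_ge0 // mulr_ge0.
(* [t] is the proportion of rows to be left free. The height [N] is odd, as the coding requires, and
   [N * (1 - t) > 4] leaves three rows for the marks and one for the selection. *)
pose N := (Num.truncn (4 / (1 - t))).*2.+1.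
have Nodd : odd N by rewrite /= odd_double.
have N0 : (0 < N)%N by [].
have NR : 0 < N%:R :> R by rewrite ltr0n.
have Nt : 4 < N%:R * (1 - t).
  rewrite -ltr_pdivrMr ?subr_gt0 //; apply: lt_le_trans (Num.Theory.truncnS_gt _) _.
  by rewrite ler_nat ltnS -addnn leq_addr.
pose e := h * N%:R * K1%:R / m1%:R.
have eE : e = N%:R * t by rewrite /e /t; ring.
have e0 : 0 <= e by rewrite eE mulr_ge0.
pose u0 := Num.truncn e; pose d := e - u0%:R.
have /andP[u1 u2] := Num.Theory.truncn_itv e0; rewrite -/u0 in u1 u2.
have d0 : 0 <= d by rewrite subr_ge0.
have d1 : d < 1 by rewrite ltrBlDl natr1.
have uN : (u0 + 4 <= N)%N.
  rewrite -(ler_nat R) natrD; apply: le_trans (_ : e + 4 <= _); first by rewrite lerD2r.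
  by rewrite eE; move: Nt; rewrite mulrBr mulr1; lra.
have cx : (fun n => (a n)%:R / (b n)%:R : R) @ \oo --> h.
  by under eq_fun do rewrite -qE; exact: hq.
have hx n : h <= (a n)%:R / (b n)%:R by rewrite -qE.
have fd := density_checkP u0 N0 K10 m10 b0 hx cx.
have [dt] := density_tiles_exist (cf_density_check N K1 m1 u0 ca cb).
(* Only now is the number of tiles known. Replacing [K1] and [m1] by [r * K1] and [r * m1] makes
   room for their names, and the test, which depends on the ratio, keeps its meaning. *)
pose r := #|dt_B dt|.+1.
have [W] := mw r isT.
have rK : (0 < r * K1)%N by rewrite muln_gt0.
have cV : (2 ^ (r * m1) <= #|mw_V W|)%N := mw_card W.
have [emb embI] : exists emb : 'I_(2 ^ (r * m1)) -> mw_V W, injective emb.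
  by apply: fin_embed; rewrite ?card_ord //; exact: mw_v0.
have [code codeI] : exists code : dt_B dt -> mw_V W, injective code.
  apply: fin_embed; last exact: mw_v0.
  apply: leq_trans cV; apply: ltnW; apply: leq_trans (ltn_expl _ (ltnSn 1)) _.
  by rewrite leq_exp2l // -(muln1 #|_|) leq_mul.
have [F FE] := constrained_eq_coded rK Nodd uN emb codeI (SFT_shift HS).
exists F; rewrite FE; split; first exact: coded_nonempty d0 d1 fd.
rewrite (coded_entropy rK uN code embI d0 d1 fd) /d addrC subrK /e !natrM.
by field; rewrite !gt_eqF // ltr0n.
Qed.
End Realize.

(** * Entropies of SFTs are right-computable *)

Section Digits.
Variable a : nat.
Hypothesis a0 : (0 < a)%N.

(** Squares of symbols are represented by numbers written in base [#|A|], so that counting them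
    becomes arithmetic. *)
Definition digit c k : nat := ((c %/ a ^ k) %% a)%N.

Lemma digit0 c : digit c 0 = (c %% a)%N.
Proof. by rewrite /digit expn0 divn1. Qed.

Lemma digitS c k : digit c k.+1 = digit (c %/ a) k.
Proof. by rewrite /digit expnS divnMA. Qed.

Lemma digit_lt c k : (digit c k < a)%N.
Proof. exact: ltn_pmod. Qed.

Lemma digits_ex M (g : nat -> nat) : (forall k, g k < a)%N ->
  exists2 c, (c < a ^ M)%N & forall k, (k < M)%N -> digit c k = g k.
Proof.
elim: M g => [|M IH] g ga; first by exists 0%N.
have [c cM cd] := IH (fun k => g k.+1) (fun k => ga k.+1).
exists (c * a + g 0)%N.
  by rewrite expnSr; have := ga 0%N; move: cM; move: (a ^ M)%N => p; clear; nia.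
case=> [|k] lk; first by rewrite digit0 modnMDl modn_small.
by rewrite digitS divnMDl // divn_small // addn0 cd.
Qed.

Lemma digits_inj M c c' : (c < a ^ M)%N -> (c' < a ^ M)%N ->
  (forall k, (k < M)%N -> digit c k = digit c' k) -> c = c'.
Proof.
elim: M c c' => [|M IH] c c' cM c'M E; first by move: cM c'M; rewrite !ltnS !leqn0 => /eqP -> /eqP ->.
rewrite (divn_eq c a) (divn_eq c' a); congr (_ * _ + _)%N.
  by apply: IH => [||k lk]; rewrite ?ltn_divLR // -?expnSr // -!digitS E.
by have := E 0%N isT; rewrite !digit0.
Qed.
End Digits.

(* [fs] lists forbidden patterns as lists of (position, symbol), with positions in
   [0, S)^2. *)
Section Admissible.
Variables (A : finType) (fs : seq (seq ((nat * nat) * A))) (S : nat).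
Hypothesis fsS : forall l e, l \in fs -> e \in l -> (e.1.1 < S)%N && (e.1.2 < S)%N.
Variable X : set (int * int -> A).
Hypothesis XP : forall x, X x <-> forall l, l \in fs -> forall t1 t2 : int,
  exists2 e, e \in l & x (t1 + e.1.1%:Z, t2 + e.1.2%:Z) != e.2.
Hypothesis X0 : X !=set0.

Definition admissible n (w : nat -> nat -> A) : bool :=
  [forall t1 : 'I_n, [forall t2 : 'I_n, (t1 + S <= n)%N && (t2 + S <= n)%N ==>
    all (fun l => has (fun e => w (t1 + e.1.1)%N (t2 + e.1.2)%N != e.2) l) fs]].

Lemma admissibleP n w : admissible n w -> forall t1 t2 l, (t1 < n)%N -> (t2 < n)%N ->
  (t1 + S <= n)%N -> (t2 + S <= n)%N -> l \in fs ->
  exists2 e, e \in l & w (t1 + e.1.1)%N (t2 + e.1.2)%N != e.2.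
Proof.
move=> /forallP ad t1 t2 l l1 l2 s1 s2 lfs.
have /forallP/(_ (Ordinal l2)) /= := ad (Ordinal l1).
by rewrite s1 s2 => /allP /(_ l lfs) /hasP.
Qed.

Lemma admissible_X n x : X x -> admissible n (fun i j => x (i%:Z, j%:Z)).
Proof.
move=> /XP Xx; apply/forallP => t1; apply/forallP => t2; apply/implyP => _.
by apply/allP => l lfs; apply/hasP; have := Xx l lfs (t1 : nat)%:Z (t2 : nat)%:Z.
Qed.

Lemma admissible_sub n m o1 o2 w : (o1 + m <= n)%N -> (o2 + m <= n)%N -> admissible n w ->
  admissible m (fun i j => w (o1 + i)%N (o2 + j)%N).
Proof.
move=> h1 h2 ad; apply/forallP => t1; apply/forallP => t2; apply/implyP => /andP[s1 s2].
apply/allP => l lfs; apply/hasP; have l1 := ltn_ord t1; have l2 := ltn_ord t2.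
have [||||e el E] := admissibleP ad (t1 := (o1 + t1)%N) (t2 := (o2 + t2)%N) _ _ _ _ lfs.
- by move: h1 l1; clear; lia.
- by move: h2 l2; clear; lia.
- by move: h1 s1; clear; lia.
- by move: h2 s2; clear; lia.
by exists e => //; rewrite !addnA.
Qed.

Lemma admissible_ext n w w' : (forall i j, (i < n)%N -> (j < n)%N -> w i j = w' i j) ->
  admissible n w -> admissible n w'.
Proof.
move=> E ad; apply/forallP => t1; apply/forallP => t2; apply/implyP => /andP[s1 s2].
apply/allP => l lfs; apply/hasP.
have [e el ew] := admissibleP ad (ltn_ord t1) (ltn_ord t2) s1 s2 lfs.
exists e => //; rewrite -E //; have /andP[e1 e2] := fsS lfs el.
  by apply: leq_trans s1; rewrite ltn_add2l.
by apply: leq_trans s2; rewrite ltn_add2l.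
Qed.

Let ultra_forall (U : set_system nat) (I : finType) (f : I -> set nat) : UltraFilter U ->
  (forall i, U (f i)) -> U [set k | forall i, f i k].
Proof. by move=> UU Uf; exact: (@filter_forall _ _ f U _ Uf). Qed.

Let ultra_value (U : set_system nat) (v : nat -> A) : UltraFilter U ->
  exists a, U [set k | v k = a].
Proof.
move=> UU; have [//|no] := pselect (exists a, U [set k | v k = a]); exfalso.
have : U [set k | forall a, v k <> a].
  apply: (@ultra_forall U A (fun a => [set k | v k <> a]) UU) => a; have [h|h] := in_ultra_setVsetC [set k | v k = a] UU.
    by case: no; exists a.
  exact: h.
by move=> /filter_ex[k /(_ (v k))].
Qed.

(** Otherwise there is a counterexample [w K] for each [K]. Centre it at the point [(K, K)] and take
    the limit along an ultrafilter finer than the cofinite one: the limit lies in [X] and, on the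
    finite central square, coincides with some [w K]. *)
Lemma compactness m : exists K, forall w, admissible (m + 2 * K) w ->
  exists2 x, X x & forall i j : nat, (i < m)%N -> (j < m)%N -> x (i%:Z, j%:Z) = w (K + i)%N (K + j)%N.
Proof.
have [//|no] := pselect (exists K, forall w, admissible (m + 2 * K) w -> exists2 x, X x &
  forall i j : nat, (i < m)%N -> (j < m)%N -> x (i%:Z, j%:Z) = w (K + i)%N (K + j)%N).
exfalso; have /choice[w wP] : forall K, exists w, admissible (m + 2 * K) w /\
    ~ exists2 x, X x & forall i j : nat, (i < m)%N -> (j < m)%N -> x (i%:Z, j%:Z) = w (K + i)%N (K + j)%N.
  move=> K; apply: contrapT => h; apply: no; exists K => w ad; apply: contrapT => nx.
  by apply: h; exists w.
have [U [UU Uoo]] := ultraFilterLemma (@eventually_filter).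
pose v (u : int * int) K := w K `|(K%:Z + u.1)%R|%N `|(K%:Z + u.2)%R|%N.
have /choice[x xP] : forall u, exists a, U [set K | v u K = a] by move=> u; apply: ultra_value.
have Xx : X x.
  apply/XP => l lfs t1 t2.
  have [//|nx] := pselect (exists2 e, e \in l & x (t1 + e.1.1%:Z, t2 + e.1.2%:Z) != e.2).
  exfalso; have : U [set K | forall e : seq_sub l, v (t1 + (val e).1.1%:Z, t2 + (val e).1.2%:Z) K =
      x (t1 + (val e).1.1%:Z, t2 + (val e).1.2%:Z)].
    apply: (@ultra_forall U _ (fun e : seq_sub l => [set K |
      v (t1 + (val e).1.1%:Z, t2 + (val e).1.2%:Z) K =
      x (t1 + (val e).1.1%:Z, t2 + (val e).1.2%:Z)]) UU) => e; exact: xP.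
  have big : U [set K | (`|t1| + `|t2| + S < K)%N].
    by apply: Uoo; exists (`|t1| + `|t2| + S).+1%N.
  move=> /(filterI big) /filter_ex[K [/= bK vK]]; have [ad _] := wP K.
  have [s1 s1E] : exists s1 : nat, K%:Z + t1 = s1%:Z by exists `|(K%:Z + t1)%R|%N; move: bK; clear; lia.
  have [s2 s2E] : exists s2 : nat, K%:Z + t2 = s2%:Z by exists `|(K%:Z + t2)%R|%N; move: bK; clear; lia.
  have [||||e el E] := admissibleP ad (t1 := s1) (t2 := s2) _ _ _ _ lfs.
  - by move: bK s1E; clear; lia.
  - by move: bK s2E; clear; lia.
  - by move: bK s1E; clear; lia.
  - by move: bK s2E; clear; lia.
  case/negP: E; have ne : x (t1 + e.1.1%:Z, t2 + e.1.2%:Z) = e.2.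
    by apply/eqP/negPn/negP => ne; apply: nx; exists e.
  rewrite -[X in _ == X]ne -(vK (SeqSub el)) /v /= !addrA s1E s2E -!PoszD.
  exact: eqxx.
have : U [set K | forall e : 'I_m * 'I_m, v ((e.1 : nat)%:Z, (e.2 : nat)%:Z) K =
    x ((e.1 : nat)%:Z, (e.2 : nat)%:Z)].
  apply: (@ultra_forall U _ (fun e : 'I_m * 'I_m => [set K |
    v ((e.1 : nat)%:Z, (e.2 : nat)%:Z) K = x ((e.1 : nat)%:Z, (e.2 : nat)%:Z)]) UU) => e.
  exact: xP.
move=> /filter_ex[K vK]; have [_ []] := wP K; exists x => // i j li lj.
by rewrite -(vK (Ordinal li, Ordinal lj)).
Qed.

Let a := #|A|.
Let a0 : (0 < a)%N.
Proof. by have [x _] := X0; apply/card_gt0P; exists (x 0). Qed.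

Let sym (k : nat) : A := enum_val (Ordinal (ltn_pmod k a0)).

Let symK y : sym (enum_rank y) = y.
Proof.
rewrite /sym -[RHS]enum_rankK; congr enum_val; apply: val_inj => /=.
exact: modn_small.
Qed.

Let sym_inj k k' : (k < a)%N -> (k' < a)%N -> sym k = sym k' -> k = k'.
Proof. by move=> lk lk' /enum_val_inj /(congr1 val) /=; rewrite !modn_small. Qed.

Definition decode n c (i j : nat) : A := sym (digit a c (i * n + j)).

Lemma decodeE n c i j y :
  (decode n c i j == y) = (digit #|A| c (i * n + j) == enum_rank y :> nat).
Proof.
apply/eqP/eqP => [<-|E]; last by rewrite /decode [digit _ _ _]E symK.
by rewrite /decode /sym enum_valK /= modn_small // digit_lt.
Qed.

Definition local_count n : nat :=
  #|[set c : 'I_(a ^ (n * n)) | admissible n (decode n c)]%SET|.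

Let pos_lt n i j : (i < n)%N -> (j < n)%N -> (i * n + j < n * n)%N.
Proof. by clear; nia. Qed.

Lemma decode_ex n (w : nat -> nat -> A) : exists2 c, (c < a ^ (n * n))%N &
  forall i j, (i < n)%N -> (j < n)%N -> decode n c i j = w i j.
Proof.
have [|c cM cd] := digits_ex a0 (n * n) (g := fun k => enum_rank (w (k %/ n)%N (k %% n)%N)).
  by move=> k; apply: ltn_ord.
exists c => // i j li lj; rewrite /decode cd; last exact: pos_lt.
have n0 : (0 < n)%N by apply: leq_ltn_trans li.
by rewrite symK divnMDl // divn_small // addn0 modnMDl modn_small.
Qed.

Lemma decode_inj n c c' : (c < a ^ (n * n))%N -> (c' < a ^ (n * n))%N ->
  (forall i j, (i < n)%N -> (j < n)%N -> decode n c i j = decode n c' i j) -> c = c'.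
Proof.
move=> cM c'M E; apply: (digits_inj a0 cM c'M) => k lk.
have n0 : (0 < n)%N by move: lk; clear; case: n.
have lq : (k %/ n < n)%N by rewrite ltn_divLR.
have := E _ _ lq (ltn_pmod k n0); rewrite /decode -divn_eq.
by apply: sym_inj; exact: digit_lt.
Qed.

Lemma local_count_le n (C : finType) (D : {set C}) (P : (nat -> nat -> A) -> C -> Prop) :
  (forall w, admissible n w -> exists2 c, c \in D & P w c) ->
  (forall w w' c, P w c -> P w' c -> forall i j, (i < n)%N -> (j < n)%N -> w i j = w' i j) ->
  (local_count n <= #|D|)%N.
Proof.
move=> ex inj; have [E0|/set0Pn[s0]] := eqVneq [set c : 'I_(a ^ (n * n)) | admissible n (decode n c)]%SET finset.set0.
  by rewrite /local_count E0 cards0.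
rewrite inE => /ex[d0 _ _].
have /choice[F FP] : forall s : 'I_(a ^ (n * n)), exists d,
    admissible n (decode n s) -> d \in D /\ P (decode n s) d.
  move=> s; have [/ex[d dD Pd]|_] := boolP (admissible n (decode n s)); last by exists d0.
  by exists d.
rewrite /local_count -(@card_in_imset _ _ F).
  by apply/fintype.subset_leq_card/fintype.subsetP => _ /imsetP[s + ->]; rewrite inE => /FP[].
move=> s s'; rewrite !inE => /FP[_ P1] /FP[_ P2] E; apply: val_inj.
by apply: decode_inj (ltn_ord s) (ltn_ord s') _; apply: inj P1 _; rewrite E.
Qed.

Lemma npat_local n : (npat X (@emb2 n n) <= local_count n)%N.
Proof.
pose P (x : int * int -> A) (c : 'I_(a ^ (n * n))) :=
  forall i j, (i < n)%N -> (j < n)%N -> decode n c i j = x (i%:Z, j%:Z).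
apply: (@npat_le _ _ _ _ _ _ _ P).
  move=> x Xx; have [c cM cP] := decode_ex n (fun i j => x (i%:Z, j%:Z)).
  exists (Ordinal cM) => //; rewrite inE.
  apply: admissible_ext (admissible_X n Xx) => i j li lj.
  by rewrite -cP.
by move=> x y c _ _ Px Py [i j]; rewrite /emb2 /= -Px // -Py.
Qed.

Lemma local_count_gt0 n : (0 < local_count n)%N.
Proof. exact: leq_trans (npat_gt0 _ X0) (npat_local n). Qed.

(** The four quarters of an admissible square are admissible; along the sides [2 ^ k] the rates are
    therefore nonincreasing. *)
Lemma local_count_double n : (local_count (2 * n) <= local_count n ^ 4)%N.
Proof.
rewrite [X in (_ <= X ^ _)%N]/local_count; set D := [set c | _]%SET.
have -> : (#|D| ^ 4 = #|D| ^ #|{: 'I_2 * 'I_2}|)%N by rewrite card_prod !card_ord.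
rewrite -card_ffun_on -cardsE.
pose P (w : nat -> nat -> A) (g : {ffun 'I_2 * 'I_2 -> 'I_(a ^ (n * n))}) :=
  forall (s : 'I_2 * 'I_2) i j, (i < n)%N -> (j < n)%N ->
    decode n (g s) i j = w (s.1 * n + i)%N (s.2 * n + j)%N.
apply: (@local_count_le _ _ _ P).
  move=> w ad; have /choice[g gP] : forall s : 'I_2 * 'I_2, exists c : 'I_(a ^ (n * n)),
      forall i j, (i < n)%N -> (j < n)%N -> decode n c i j = w (s.1 * n + i)%N (s.2 * n + j)%N.
    move=> s; have [c cM cP] := decode_ex n (fun i j => w (s.1 * n + i)%N (s.2 * n + j)%N).
    by exists (Ordinal cM).
  exists [ffun s => g s]; last by move=> s i j li lj; rewrite ffunE gP.
  rewrite inE; apply/ffun_onP => s; rewrite ffunE inE.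
  have le (k : 'I_2) : (k * n + n <= 2 * n)%N by have := ltn_ord k; clear; nia.
  apply: admissible_ext (admissible_sub (le s.1) (le s.2) ad) => i j li lj.
  by rewrite gP.
move=> w w' g Pw Pw' i j li lj.
have n0 : (0 < n)%N by move: li; clear; case: n.
have q k : (k < 2 * n)%N -> (k %/ n < 2)%N by rewrite ltn_divLR.
have := Pw (Ordinal (q i li), Ordinal (q j lj)) _ _ (ltn_pmod i n0) (ltn_pmod j n0).
have := Pw' (Ordinal (q i li), Ordinal (q j lj)) _ _ (ltn_pmod i n0) (ltn_pmod j n0).
by rewrite /= -!divn_eq => -> ->.
Qed.

(** Squares of side [m] at distance at least [K] from the border show true patterns of [X], by
    [compactness]; [q * q] of them cover all but horizontal and vertical strips of total width [r],
    where the symbols are arbitrary. *)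
Lemma local_count_bound m : (0 < m)%N -> exists K, forall n, exists q r,
  [/\ (q * m <= n)%N, (r <= 2 * K + m)%N &
     (local_count n <= npat X (@emb2 m m) ^ (q * q) * (a ^ (r * n) * a ^ (r * n)))%N].
Proof.
move=> m0; have [K KP] := compactness m; exists K => n.
pose q := ((n - 2 * K) %/ m)%N; pose r := (n - q * m)%N.
have qm : (q * m <= n - 2 * K)%N by rewrite leq_trunc_div.
have qm2 : (n - 2 * K < q * m + m)%N.
  by rewrite {1}(divn_eq (n - 2 * K) m) ltn_add2l ltn_pmod.
exists q, r; split; first by apply: leq_trans qm (leq_subr _ _).
  by rewrite /r; move: qm2; clear; lia.
rewrite [X in (_ <= X ^ _ * _)%N]/npat; set Sp := [set p | _]%SET.
have -> : (#|Sp| ^ (q * q) = #|Sp| ^ #|{: 'I_q * 'I_q}|)%N by rewrite card_prod !card_ord.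
have ar : (a ^ (r * n) = #|[set: {ffun 'I_r * 'I_n -> A}]%SET|)%N.
  by rewrite cardsT card_ffun card_prod !card_ord.
rewrite -card_ffun_on -cardsE ar -!cardsX.
(* Enumerates the indices of the strips by jumping over the central interval of length [q * m]. *)
pose o s := if (s < K)%N then s else (s + q * m)%N.
pose P (w : nat -> nat -> A) (c : {ffun 'I_q * 'I_q -> {ffun 'I_m * 'I_m -> A}} *
    ({ffun 'I_r * 'I_n -> A} * {ffun 'I_r * 'I_n -> A})) :=
  [/\ forall s t, c.1 s t = w (K + (s.1 * m + t.1))%N (K + (s.2 * m + t.2))%N,
      forall s (j : 'I_n), c.2.1 (s, j) = w (o s) j &
      forall s (i : 'I_n), c.2.2 (s, i) = w i (o s)].
apply: (@local_count_le _ _ _ P).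
  move=> w ad.
  exists ([ffun s : 'I_q * 'I_q => [ffun t : 'I_m * 'I_m => w (K + (s.1 * m + t.1))%N (K + (s.2 * m + t.2))%N]],
    ([ffun s : 'I_r * 'I_n => w (o s.1) s.2], [ffun s : 'I_r * 'I_n => w s.2 (o s.1)])); last first.
    by split=> /= *; rewrite !ffunE.
  rewrite !inE /= !andbT; apply/ffun_onP => s; rewrite ffunE inE; apply/asboolP.
  have le (k : 'I_q) : (k * m + (m + 2 * K) <= n)%N.
    by have := ltn_ord k; move: qm m0; clear; nia.
  have [x Xx xP] := KP _ (admissible_sub (le s.1) (le s.2) ad).
  exists x => // t; rewrite ffunE /emb2 xP //.
  by congr w; rewrite addnCA.
move=> w w' c [w1 w2 w3] [w1' w2' w3'] i j li lj.
have strip k : (k < n)%N -> (k < K)%N || (K + q * m <= k)%N -> exists s : 'I_r, k = o s.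
  move=> lk /orP[kK|kK].
    have lt : (k < r)%N by rewrite /r; move: lk kK qm; clear; lia.
    by exists (Ordinal lt); rewrite /o /= kK.
  have lt : (k - q * m < r)%N by rewrite /r; move: lk kK; clear; lia.
  exists (Ordinal lt); rewrite /o /=; case: ifP => h; move: h kK lk; clear; lia.
have [/(strip i li)[s ->]|hi] := boolP ((i < K)%N || (K + q * m <= i)%N).
  by rewrite -(w2 s (Ordinal lj)) -(w2' s (Ordinal lj)).
have [/(strip j lj)[s ->]|hj] := boolP ((j < K)%N || (K + q * m <= j)%N).
  by rewrite -(w3 s (Ordinal li)) -(w3' s (Ordinal li)).
have dec k : ~~ ((k < K)%N || (K + q * m <= k)%N) -> exists (s : 'I_q) (t : 'I_m), k = (K + (s * m + t))%N.
  move=> h; have lt : ((k - K) %/ m < q)%N by rewrite ltn_divLR //; move: h; clear; lia.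
  exists (Ordinal lt), (Ordinal (ltn_pmod (k - K) m0)).
  by rewrite /= -divn_eq; move: h; clear; lia.
have [s1 [t1 ->]] := dec i hi; have [s2 [t2 ->]] := dec j hj.
by rewrite -(w1 (s1, s2) (t1, t2)) -(w1' (s1, s2) (t1, t2)).
Qed.
End Admissible.

Section PatternList.
Variables (A : finType) (G : zmodType) (h : G -> nat * nat).

Definition pattern_list (p : pattern G A) : seq ((nat * nat) * A) :=
  [seq (h (val u), p u) | u <- enum {: domf p}].

Lemma pattern_listP p e : e \in pattern_list p <-> exists2 u, p.[? u]%fmap = Some e.2 & e.1 = h u.
Proof.
split=> [/mapP[u _ ->]|[u pu eE]].
  by exists (val u) => //=; rewrite (in_fnd (valP u)); congr (Some (p _)); exact: val_inj.
have up : u \in domf p by case: fndP pu.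
apply/mapP; exists (FSetSub up); first by rewrite mem_enum.
rewrite [LHS]surjective_pairing eE; congr (_, _).
by move: pu; rewrite in_fnd => -[].
Qed.
End PatternList.

Definition plane_index (B : nat) (u : int * int) : nat * nat := (`|(B%:Z + u.1)%R|%N, `|(B%:Z + u.2)%R|%N).
Definition line_index (B : nat) (u : int) : nat * nat := (`|(B%:Z + u)%R|%N, 0%N).

(** Positions are translated by [B] to become natural numbers, and a pattern forbidden in [H]
    becomes a plane pattern of height one. *)
Lemma constrained_list (A : finType) (H : set (int -> A)) F : is_SFT H ->
  exists (fs : seq (seq ((nat * nat) * A))) (S : nat), (forall l e, l \in fs -> e \in l -> (e.1.1 < S)%N && (e.1.2 < S)%N) /\
    forall x, horizontally_constrained H F x <-> forall l, l \in fs -> forall t1 t2 : int,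
      exists2 e, e \in l & x (t1 + e.1.1%:Z, t2 + e.1.2%:Z) != e.2.
Proof.
move=> [F1 ->]; have [B1 b1] := pattern_bound F1 absz.
have [B2 b2] := pattern_bound F (fun u : int * int => `|u.1| + `|u.2|)%N.
pose B := (B1 + B2)%N.
exists ([seq pattern_list (plane_index B) p | p <- enum_fset F] ++
  [seq pattern_list (line_index B) p | p <- enum_fset F1]), (B + B).+1; split.
  move=> l e; rewrite mem_cat => /orP[] /mapP[p pF ->] /pattern_listP[u pu ->] /=.
    by have := b2 _ _ _ pF pu; rewrite /B; move: u.1 u.2 => u1 u2; clear; lia.
  by have := b1 _ _ _ pF pu; rewrite /B; move: (u : int) => u1; clear; lia.
move=> x; split.
  move=> [aF Hx] l; rewrite mem_cat => /orP[] /mapP[p pF ->] t1 t2; apply: contrapT => no.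
    apply: (aF p pF); exists (t1 + B%:Z, t2 + B%:Z) => u c pu.
    apply/eqP/negPn/negP => ne; apply: no; exists (plane_index B u, c).
      by apply/pattern_listP; exists u.
    rewrite /plane_index /=; have := b2 _ _ _ pF pu; case: u pu ne => u1 u2 pu ne /= bu.
    have -> : t1 + `|(B%:Z + u1)%R|%N%:Z = t1 + B%:Z + u1 by move: bu; rewrite /B; clear; lia.
    by have -> : t2 + `|(B%:Z + u2)%R|%N%:Z = t2 + B%:Z + u2 by move: bu; rewrite /B; clear; lia.
  apply: (Hx t2 p pF); exists (t1 + B%:Z) => u c pu.
  apply/eqP/negPn/negP => ne; apply: no; exists (line_index B u, c).
    by apply/pattern_listP; exists u.
  rewrite /line_index /=; have := b1 _ _ _ pF pu; move: (u : int) ne => u1 ne bu.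
  have -> : t1 + `|(B%:Z + u1)%R|%N%:Z = t1 + B%:Z + u1 by move: bu; rewrite /B; clear; lia.
  by rewrite addr0.
move=> Hx; split.
  move=> p pF [[t1 t2] ap].
  have lF : pattern_list (plane_index B) p \in
      [seq pattern_list (plane_index B) p | p <- enum_fset F] ++
      [seq pattern_list (line_index B) p | p <- enum_fset F1].
    by rewrite mem_cat; apply/orP; left; apply/mapP; exists p.
  have [[e1 c] /pattern_listP[u /= pu ->] /negP] := Hx _ lF (t1 - B%:Z) (t2 - B%:Z).
  apply; rewrite /plane_index /= -(ap _ _ pu).
  have := b2 _ _ _ pF pu; case: u {pu} => u1 u2 /= bu.
  have -> : t1 - B%:Z + `|(B%:Z + u1)%R|%N%:Z = t1 + u1 by move: bu; rewrite /B; clear; lia.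
  by have -> : t2 - B%:Z + `|(B%:Z + u2)%R|%N%:Z = t2 + u2 by move: bu; rewrite /B; clear; lia.
move=> j p pF [t ap].
have lF : pattern_list (line_index B) p \in
    [seq pattern_list (plane_index B) p | p <- enum_fset F] ++
    [seq pattern_list (line_index B) p | p <- enum_fset F1].
  by rewrite mem_cat; apply/orP; right; apply/mapP; exists p.
have [[e1 c] /pattern_listP[u /= pu ->] /negP] := Hx _ lF (t - B%:Z) j.
apply; rewrite /line_index /= -(ap _ _ pu) addr0.
have := b1 _ _ _ pF pu; move: (u : int) => u1 bu.
by have -> : t - B%:Z + `|(B%:Z + u1)%R|%N%:Z = t + u1 by move: bu; rewrite /B; clear; lia.
Qed.

(** * Computability of the number of admissible squares *)

Section CountComputable.
Variables (A : finType) (fs : seq (seq ((nat * nat) * A))) (S : nat).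
Variable X : set (int * int -> A).
Hypothesis X0 : X !=set0.

Let A0 : (0 < #|A|)%N.
Proof. by have [x _] := X0; apply/card_gt0P; exists (x 0). Qed.

Lemma cf_local_count m (h : m.-tuple nat -> nat) : cf h ->
  cf (fun v => local_count fs S X0 (h v)).
Proof.
move=> ch.
pose t1 (u : m.+3.-tuple nat) := thead (ttail u).
pose n (u : m.+3.-tuple nat) := h (ttail (ttail (ttail u))).
pose c (u : m.+3.-tuple nat) := thead (ttail (ttail u)).
have ct2 : cf (fun u : m.+3.-tuple nat => thead u) by exact: cf_head.
have ct1 : cf t1 by exact: cf_head2.
have cc : cf c by exact: (cf_weak2 (cf_head m)).
have cn : cf n by exact: (cf_weak (cf_weak2 ch)).
have cD (k1 k2 : nat) : cf (fun u => digit #|A| (c u) ((t1 u + k1) * n u + (thead u + k2))).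
  apply: cf_mod => //; last exact: cf_const.
  apply: cf_div => //; first by move=> v; rewrite expn_gt0 A0.
  apply: cf_exp; first exact: cf_const.
  exact: (cf_add (cf_mul (cf_add ct1 (cf_const _ k1)) cn) (cf_add ct2 (cf_const _ k2))).
(* Admissibility at one position, written with negation, conjunction and finite [all] only, for
   which closure of computable predicates is available; symbols are compared through digits. *)
pose body (c t1 t2 n : nat) := ~~ (((t1 + S <= n)%N && (t2 + S <= n)%N) && ~~
  all (fun l => ~~ all (fun e : (nat * nat) * A =>
    digit #|A| c ((t1 + e.1.1) * n + (t2 + e.1.2)) == enum_rank e.2 :> nat) l) fs).
have cbody : cfb (fun u => body (c u) (t1 u) (thead u) (n u)).
  apply: cfb_not; apply: cfb_and.
    by apply: cfb_and; apply: cfb_leq => //; apply: cf_add => //; exact: cf_const.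
  apply: cfb_not; apply: cfb_all => l; apply: cfb_not; apply: cfb_all => e.
  by apply: cfb_eq; [exact: cD|exact: cf_const].
have c1 : cfb (fun u : m.+2.-tuple nat => [forall t2 : 'I_(h (ttail (ttail u))),
    body (thead (ttail u)) (thead u) t2 (h (ttail (ttail u)))]).
  apply: (@cfb_forall _ (fun u : m.+2.-tuple nat => h (ttail (ttail u)))
    (fun t2 u => body (thead (ttail u)) (thead u) t2 (h (ttail (ttail u))))) => //.
  exact: (cf_weak2 ch).
have c2 : cfb (fun u : m.+1.-tuple nat => [forall t1 : 'I_(h (ttail u)),
    [forall t2 : 'I_(h (ttail u)), body (thead u) t1 t2 (h (ttail u))]]).
  apply: (@cfb_forall _ (fun u : m.+1.-tuple nat => h (ttail u))
    (fun t1 u => [forall t2 : 'I_(h (ttail u)), body (thead u) t1 t2 (h (ttail u))])) => //.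
  exact: (cf_weak ch).
have c3 := cf_sum (F := fun c v => [forall t1 : 'I_(h v), [forall t2 : 'I_(h v), body c t1 t2 (h v)]])
  (cf_exp (cf_const m #|A|) (cf_mul ch ch)) c2.
apply: cf_ext c3 => v; rewrite /local_count -sum1dep_card [RHS]big_mkcond /=.
apply: eq_bigr => k _; rewrite /admissible.
have -> : [forall s1 : 'I_(h v), [forall s2 : 'I_(h v), body k s1 s2 (h v)]] =
  [forall s1 : 'I_(h v), [forall s2 : 'I_(h v), (s1 + S <= h v)%N && (s2 + S <= h v)%N ==>
    all (fun l => has (fun e => decode X0 (h v) k (s1 + e.1.1) (s2 + e.1.2) != e.2) l) fs]].
  apply: eq_forallb => s1; apply: eq_forallb => s2; rewrite implybE /body negb_and negbK.
  congr (_ || _); apply: eq_all => l; rewrite -has_predC; apply: eq_has => e /=.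
  by rewrite decodeE.
by case: [forall _, _].
Qed.

(** The binary length counts the powers of 2 that are at most [h v]. Their exponents are below
    [h v], so a bounded sum computes it. *)
Lemma cf_size m (h : m.-tuple nat -> nat) : (forall v, 0 < h v)%N -> cf h ->
  cf (fun v => (trunc_log 2 (h v)).+1).
Proof.
move=> h0 ch.
have c1 : cf (fun u : m.+1.-tuple nat => nat_of_bool (2 ^ thead u <= h (ttail u))%N).
  apply: cfb_leq; last exact: (cf_weak ch).
  by apply: cf_exp; [exact: cf_const|exact: cf_head].
apply: cf_ext (cf_sum (F := fun k v => nat_of_bool (2 ^ k <= h v)%N) ch c1) => v.
have lt : (0 + (trunc_log 2 (h v)).+1 <= h v)%N.
  rewrite add0n; apply: leq_trans (trunc_logP (isT : 1 < 2)%N (h0 v)).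
  exact: ltn_expl.
rewrite -[RHS](card_itv_ord lt) -sum1dep_card [RHS]big_mkcond /=.
apply: eq_bigr => k _; rewrite addn0 ltnS.
have -> : (k <= trunc_log 2 (h v))%N = (2 ^ k <= h v)%N.
  apply/idP/idP => [le|]; last exact: trunc_log_max.
  by apply: leq_trans (trunc_logP (isT : 1 < 2)%N (h0 v)); rewrite leq_exp2l.
by case: (_ <= _)%N.
Qed.
End CountComputable.

Lemma log2_cover (R : realType) (x e c f : nat) : (0 < x)%N -> (0 < c)%N ->
  log2 (x ^ e * (c ^ f * c ^ f))%N%:R = e%:R * log2 x%:R + 2 * f%:R * log2 c%:R :> R.
Proof.
move=> x0 c0; have xR : 0 < x%:R ^+ e :> R by rewrite exprn_gt0 // ltr0n.
have cR : 0 < c%:R ^+ f :> R by rewrite exprn_gt0 // ltr0n.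
have -> : (x ^ e * (c ^ f * c ^ f))%N%:R = x%:R ^+ e * (c%:R ^+ f * c%:R ^+ f) :> R.
  by rewrite !natrM !natrX.
rewrite log2M ?mulr_gt0 // log2M // !log2X ?ltr0n //.
rewrite -[log2 x%:R *+ e]mulr_natl -[log2 c%:R *+ f]mulr_natl; ring.
Qed.

(** The binary length [u k] replaces the logarithm, to obtain rationals: it still satisfies
    [u k.+1 <= 4 * u k], so the rates decrease, and the error is at most 1, negligible against the
    area [4 ^ k]. *)
Theorem entropy_Pi1 (R : realType) (A : finType) (H : set (int -> A)) F : is_SFT H ->
  horizontally_constrained H F !=set0 -> Pi1 R (entropy2 R (horizontally_constrained H F)).
Proof.
move=> HS X0; set X := horizontally_constrained H F in X0 *.
have [fs [S [fsS XP]]] := constrained_list F HS.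
have [h0 hinf hcv] := entropy2_spec R (horiz_shift (F := F) (SFT_shift HS)) X0.
set h := entropy2 R X in h0 hinf hcv *.
pose lc k := local_count fs S X0 (2 ^ k).
have lc0 k : (0 < lc k)%N by apply: (local_count_gt0 fsS XP).
pose u k := (trunc_log 2 (lc k)).+1.
pose r k : R := (u k)%:R / (2 ^+ k * 2 ^+ k).
have p0 k : 0 < 2 ^+ k :> R by rewrite exprn_gt0.
have uP k : log2 (lc k)%:R <= (u k)%:R :> R /\ (u k)%:R <= log2 (lc k)%:R + 1 :> R.
  split; last first.
    rewrite /u -natr1 lerD2r -[leLHS]log2_exp2 -natrX; apply: ler_log2.
      by rewrite ltr0n expn_gt0.
    by rewrite ler_nat trunc_logP.
  rewrite -[leRHS]log2_exp2 -natrX; apply: ler_log2; first by rewrite ltr0n.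
  by rewrite ler_nat ltnW // trunc_log_ltn.
have uS k : (u k.+1 <= 4 * u k)%N.
  rewrite /u; set T := trunc_log 2 (lc k); set T' := trunc_log 2 (lc k.+1).
  have : (2 ^ T' < 2 ^ (4 * T.+1))%N.
    apply: leq_ltn_trans (trunc_logP (isT : 1 < 2)%N (lc0 k.+1)) _.
    apply: leq_ltn_trans (_ : lc k ^ 4 < _)%N.
      by rewrite /lc expnS; apply: (local_count_double fsS).
    by rewrite mulnC expnM ltn_exp2r // trunc_log_ltn.
  by rewrite ltn_exp2l.
have rS k : r k.+1 <= r k.
  rewrite /r ler_pdivrMr ?mulr_gt0 // mulrAC ler_pdivlMr ?mulr_gt0 //.
  have le4 : (u k.+1)%:R <= 4 * (u k)%:R :> R by rewrite -natrM ler_nat.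
  have pp : 0 < 2 ^+ k * 2 ^+ k :> R by rewrite mulr_gt0.
  have -> : (u k)%:R * (2 ^+ k.+1 * 2 ^+ k.+1) = 4 * (u k)%:R * (2 ^+ k * 2 ^+ k) :> R.
    by rewrite !exprS; ring.
  by rewrite ler_pM2r.
have rni : nonincreasing_seq r by apply/nonincreasing_seqP.
have hr k : h <= r k.
  have k0 : (0 < 2 ^ k)%N by rewrite expn_gt0.
  apply: le_trans (hinf _ k0) _; rewrite natrX expr2 /r ler_pM2r ?invr_gt0 ?mulr_gt0 //.
  have [uk _] := uP k; apply: le_trans uk; apply: ler_log2; first by rewrite ltr0n npat_gt0.
  by rewrite ler_nat; apply: (npat_local fsS XP).
have small e : 0 < e -> exists k, r k < h + e.
  move=> e0; have e2 : 0 < e / 2 by rewrite divr_gt0.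
  have [|m0 _ near] := (cvgr_lt _ hcv) (h + e / 2); first by rewrite ltrDl.
  pose m := m0.+1; have mR : 0 < m%:R :> R by rewrite ltr0n.
  have wm : log2 (npat X (@emb2 m m))%:R / m%:R ^+ 2 < h + e / 2 by apply: near; exact: leqnSn.
  have N0 : (0 < npat X (@emb2 m m))%N by apply: npat_gt0.
  have w0 : 0 <= log2 (npat X (@emb2 m m))%:R :> R by apply: log2_ge0; rewrite ler1n.
  move: wm; set W := _ / _ => wm; have W0 : 0 <= W by rewrite divr_ge0 // exprn_ge0.
  have [K KP] := local_count_bound S XP X0 (ltn0Sn m0).
  have A0 : (0 < #|A|)%N by have [x _] := X0; apply/card_gt0P; exists (x 0).
  pose be : R := log2 #|A|%:R; have be0 : 0 <= be by apply: log2_ge0; rewrite ler1n.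
  pose C : R := 2 * (2 * K + m)%N%:R * be + 1.
  have C0 : 0 <= C by apply: addr_ge0 => //; apply: mulr_ge0 => //; apply: mulr_ge0.
  have [|||k kP] := @linear_lt_exp2 R C 0 (e / 2) => //.
  rewrite mul0r addr0 in kP; exists k.
  have [q [s [qm sK le]]] := KP (2 ^ k)%N.
  have pk : 2 ^+ k = (2 ^ k)%N%:R :> R by rewrite natrX.
  have le1 : log2 (lc k)%:R <= (q * q)%N%:R * log2 (npat X (@emb2 m m))%:R +
      (2 * (s%:R * 2 ^+ k)) * be :> R.
    apply: le_trans (_ : log2 (npat X (@emb2 m m) ^ (q * q) *
      (#|A| ^ (s * 2 ^ k) * #|A| ^ (s * 2 ^ k)))%N%:R <= _).
      by apply: ler_log2; [rewrite ltr0n|rewrite ler_nat].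
    rewrite log2_cover // [(s * 2 ^ k)%N%:R]natrM natrX.
    exact: lexx.
  have le2 : (q * q)%N%:R * log2 (npat X (@emb2 m m))%:R <= 2 ^+ k * 2 ^+ k * W :> R.
    have -> : (q * q)%N%:R * log2 (npat X (@emb2 m m))%:R = (q * m)%N%:R * (q * m)%N%:R * W :> R.
      by rewrite /W !natrM; field; rewrite gt_eqF.
    by rewrite ler_wpM2r // pk ler_pM // ler_nat.
  have p1 : 1 <= 2 ^+ k :> R by rewrite exprn_ege1 // ler1n.
  have le3 : 2 * (s%:R * 2 ^+ k) * be + 1 <= C * 2 ^+ k.
    have : s%:R * (2 ^+ k * be) <= (2 * K + m)%N%:R * (2 ^+ k * be).
      by rewrite ler_wpM2r ?ler_nat // mulr_ge0 // ltW.
    by rewrite /C; move: ((2 * K + m)%N%:R) => c; lra.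
  rewrite /r ltr_pdivrMr ?mulr_gt0 //; have [_ uk] := uP k; apply: le_lt_trans uk _.
  have le4 : C * 2 ^+ k < e / 2 * 2 ^+ k * 2 ^+ k by rewrite ltr_pM2r.
  have le5 : W * (2 ^+ k * 2 ^+ k) < (h + e / 2) * (2 ^+ k * 2 ^+ k) by rewrite ltr_pM2r // mulr_gt0.
  by move: le1 le2 le3 le4 le5; move: (log2 (lc k)%:R) ((q * q)%N%:R * _) => x y; lra.
have rcv : r @ \oo --> h.
  apply/cvgrPdist_lt => e /small[k rk]; exists k => // n /= kn.
  rewrite distrC ger0_norm ?subr_ge0 // ltrBlDl; apply: le_lt_trans rk.
  exact: rni.
exists (fun k => (u k)%:R / (2 ^+ k * 2 ^+ k)); split.
- exists (fun=> 0%N), u, (fun k => 2 ^ k * 2 ^ k)%N; split.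
  + by apply: computable_cf; exact: cf_const.
  + apply: computable_cf.
    apply: (@cf_size 1 (fun v : 1.-tuple nat => lc (thead v))) => //.
    apply: cf_local_count; apply: cf_exp; [exact: cf_const|exact: cf_head].
  + apply: computable_cf; apply: cf_mul; apply: cf_exp; try exact: cf_const; exact: cf_head.
  + move=> n; split; first by rewrite muln_eq0 !expn_eq0.
    by rewrite expr0 mul1r natrM !natrX.
- move=> n; rewrite -(ler_rat R) !rmorphM /= !fmorphV /= !rmorphM /= !rmorphXn /= !ratr_nat.
  exact: rS.
- have -> : (fun n => ratr ((u n)%:R / (2 ^+ n * 2 ^+ n)) : R) = r.
    apply: funext => n.
    by rewrite !rmorphM /= !fmorphV /= !rmorphM /= !rmorphXn /= !ratr_nat.
  exact: rcv.
Qed.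

Unset Implicit Arguments.
Unset Strict Implicit.

Theorem theorem3p7 (R : realType) (A : finType) (H : set (int -> A))
    (H_SFT : is_SFT H) (H_nonempty : H !=set0) :
  [set h : R | exists F : {fset pattern (int * int)%type A},
     horizontally_constrained H F !=set0 /\
     h = entropy2 R (horizontally_constrained H F)]
  = `[0, entropy1 R H] `&` Pi1 R.
Proof.
have sH := SFT_shift H_SFT.
apply/seteqP; split=> h /=.
  move=> [F [X0 ->]]; split; last exact: entropy_Pi1.
  rewrite in_itv /= entropy_le_free // andbT.
  by have [] := entropy2_spec R (horiz_shift (F := F) sH) X0.
move=> [+ hP]; rewrite in_itv /= => /andP[h0]; rewrite le_eqVlt => /orP[/eqP hE|hlt]; last first.
  exact: (realize_lt H_SFT).
(* At the largest value no row can be spared for marks, but there the empty set of patterns does: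
   the rows are then independent points of [H]. *)
exists fset0; split; last by rewrite entropy_free.
have [x Hx] := H_nonempty; exists (fun u => x u.1); split.
  by move=> p; rewrite in_fset0.
by [].
Qed.
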